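(* Let $d\ge 3$ and $m\ge 1$ be integers, let $\beta>2$ be real, and let $n\ge m+1$ be an integer. Let $(\mathcal C_t)_{t\ge0}$ be the CAT Markov chain with parameters $(d,m,\beta)$, and let $\widehat{\mathcal C}_t$ be the chain of its translation equivalence classes, considered on $n$-element sets. (i) If $n<2m+2$, then $\widehat{\mathcal C}_t$ has a unique stationary distribution, supported on $\widehat{\mathrm{Prog}}_{m,n}$, to which the law of $\widehat{\mathcal C}_t$ converges as $t\to\infty$ from any $n$-element initial set $C\subset\mathbb Z^d$. (ii) If $n\ge 2m+2$, then $\widehat{\mathcal C}_t$ is transient on $\widehat{\mathrm{Prog}}_{m,n}$.
   Context: $\|\cdot\|$ is the Euclidean norm. For $A\subset\mathbb Z^d$, $\partial A=\{x\in\mathbb Z^d\setminus A:\ \|x-y\|=1\text{ for some }y\in A\}$. Let $\phi(u,v)=\max\{\|u-v\|,1\}^{-\beta}$ for $u,v\in\mathbb Z^d$. CAT (chain activation and transport) is the Markov chain $(\mathcal C_t)_{t\ge0}$ on $\mathcal S=\{S\subset\mathbb Z^d: m+1\le|S|<\infty\}$ with the following step. Given $\mathcal C_t$, choose $x_1$ uniformly at random in $\mathcal C_t$; for $l=1,\dots,m-1$, given $x_1,\dots,x_l$, choose $x_{l+1}\in\mathcal C_t\setminus\{x_1,\dots,x_l\}$ with probability proportional to $\phi(x_l,x_{l+1})$; then for $l=m,\dots,2m-1$, given $x_1,\dots,x_l$, choose $x_{l+1}\in\partial\big((\mathcal C_t\setminus\{x_1,\dots,x_m\})\cup\{x_{m+1},\dots,x_l\}\big)$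 with probability proportional to $\phi(x_l,x_{l+1})$. Set $\mathcal C_{t+1}=(\mathcal C_t\setminus\{x_1,\dots,x_m\})\cup\{x_{m+1},\dots,x_{2m}\}$. The number of elements is conserved and the transition probabilities are translation invariant. For $C\subset\mathbb Z^d$, $\widehat C=\{D\subset\mathbb Z^d: C=D+x\text{ for some }x\in\mathbb Z^d\}$ is the class of its translates; by translation invariance $(\widehat{\mathcal C}_t)_{t\ge0}$ is a Markov chain on the classes. A set $U\in\mathcal S$ has a progressive boundary if it contains an $m$-element subset $\{x_1,\dots,x_m\}$ with $x_j\in\partial\big(U\setminus\{x_j,\dots,x_m\}\big)$ for every $j\in\{1,\dots,m\}$. $\mathrm{Prog}_{m,n}$ is the collection of $n$-element sets in $\mathcal S$ with a progressive boundary and $\widehat{\mathrm{Prog}}_{m,n}=\{\widehat U: U\in\mathrm{Prog}_{m,n}\}$. *)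

(* Defs.v *)
From HB Require Import structures.
From mathcomp Require Import all_boot all_order all_algebra finmap zify.
From mathcomp Require Import all_classical all_reals all_analysis.

Set Implicit Arguments.
Unset Strict Implicit.
Unset Printing Implicit Defensive.

Import Order.TTheory GRing.Theory Num.Theory.
Import numFieldNormedType.Exports.

Local Open Scope classical_set_scope.
Local Open Scope ring_scope.

Notation lattice d := 'rV[int]_d.
Notation config d := {fset 'rV[int]_d}.

Definition enorm (R : realType) (d : nat) (u : lattice d) : R :=
  Num.sqrt (\sum_(i < d) (u 0 i)%:~R ^+ 2).

(* `R` only serves to express the norm. *)
Definition boundary (R : realType) (d : nat) (A : set (lattice d)) :
    set (lattice d) :=
  [set x | ~ A x /\ exists2 y, A y & enorm R (x - y) = 1].

Definition phi (R : realType) (beta : R) (d : nat) (u v : lattice d) : R :=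
  Num.max (enorm R (u - v)) 1 `^ (- beta).

(* For [s = [:: x_1; ...; x_l]] with [m <= l], this is
   (C \ {x_1, ..., x_m}) U {x_(m+1), ..., x_l}. *)
Definition cat_update (d m : nat) (C : config d) (s : seq (lattice d)) :
    config d :=
  ((C `\` [fset y in take m s]) `|` [fset y in drop m s])%fset.

(* The sites among which x_(l+1) is chosen, given [s = [:: x_1; ...; x_l]]. *)
Definition cat_choices (R : realType) (d m : nat) (C : config d)
    (s : seq (lattice d)) : set (lattice d) :=
  if (size s < m)%N then [set` C] `\` [set` s]
  else boundary R [set` cat_update m C s].

Definition cat_weight (R : realType) (beta : R) (d : nat)
    (s : seq (lattice d)) (y : lattice d) : R :=
  if s is x :: s' then phi beta (last x s') y else 1.

(* The conditional probability that x_(l+1) = y, given [s = [:: x_1; ...; x_l]].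
   The sum has finitely many terms, see [finite_cat_choices]. *)
Definition cat_choice_prob (R : realType) (beta : R) (d m : nat) (C : config d)
    (s : seq (lattice d)) (y : lattice d) : R :=
  if y \in cat_choices R m C s then
    cat_weight beta s y / \sum_(z \in cat_choices R m C s) cat_weight beta s z
  else 0.

Definition cat_path_prob (R : realType) (beta : R) (d m : nat) (C : config d)
    (x : (2 * m).-tuple (lattice d)) : R :=
  \prod_(l < 2 * m) cat_choice_prob beta m C (take l x) (tnth x l).

Definition cat_kernel (R : realType) (beta : R) (d m : nat) (C D : config d) :
    \bar R :=
  (\esum_(x in [set x : (2 * m).-tuple (lattice d) | cat_update m C x = D])
     (cat_path_prob beta C x)%:E)%E.

(* [X] is a Markov chain on the discrete space [T], with transition
   probabilities [K] and [X 0 = x0] almost surely. *)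
Definition markov_chain (R : realType) (T : Type) (K : T -> T -> \bar R)
    (x0 : T) (disp : measure_display) (Omega : measurableType disp)
    (P : probability Omega R) (X : nat -> Omega -> T) : Prop :=
  [/\ forall t x, measurable [set w | X t w = x],
      P [set w | X 0%N w = x0] = 1%E
    & forall (t : nat) (x : nat -> T),
        P [set w | forall i, (i <= t.+1)%N -> X i w = x i] =
        (P [set w | forall i, (i <= t)%N -> X i w = x i]
           * K (x t) (x t.+1))%E].

Definition translate (d : nat) (D : config d) (x : lattice d) : config d :=
  [fset (y + x)%R | y in D]%fset.

Definition hat (d : nat) (C : config d) : set (config d) :=
  [set D | exists x, C = translate D x].

Definition classes (d n : nat) : set (set (config d)) :=
  [set hat C | C in [set C : config d | #|` C| = n]].
Arguments classes : clear implicits.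

(* Transition probabilities between translation classes, computed from an
   arbitrary representative of the class [c]. *)
Definition hat_kernel (R : realType) (beta : R) (d m : nat)
    (c c' : set (config d)) : \bar R :=
  (\esum_(D in c') cat_kernel beta m (xget fset0 c) D)%E.

Definition progressive_boundary (R : realType) (d m : nat) (U : config d) :
    Prop :=
  exists x : m.-tuple (lattice d),
    [/\ uniq x, {subset x <= U}
      & forall j : 'I_m, boundary R ([set` U] `\` [set` drop j x]) (tnth x j)].

Definition Prog (R : realType) (d m n : nat) : set (config d) :=
  [set U | [/\ (m < #|` U|)%N, #|` U| = n & progressive_boundary R m U]].
Arguments Prog : clear implicits.

Definition hat_Prog (R : realType) (d m n : nat) : set (set (config d)) :=
  [set hat U | U in Prog R d m n].
Arguments hat_Prog : clear implicits.

(* Distributions on a discrete set [E] are mass functions vanishing outside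
   [E], so that equality of functions is equality of distributions. *)
Definition distribution_on (R : realType) (T : choiceType) (E : set T)
    (mu : T -> R) : Prop :=
  [/\ forall c, 0 <= mu c,
      forall c, ~ E c -> mu c = 0
    & (\esum_(c in E) (mu c)%:E = 1)%E].

Definition stationary_distribution (R : realType) (T : choiceType)
    (E : set T) (K : T -> T -> \bar R) (mu : T -> R) : Prop :=
  distribution_on E mu /\
  forall c', E c' -> (\esum_(c in E) ((mu c)%:E * K c c') = (mu c')%:E)%E.

(* Convergence in total variation of the laws of the [E]-valued variables
   [Y t] to [mu]; the sum is twice the total variation distance. *)
Definition law_converges (R : realType) (T : choiceType) (E : set T)
    (disp : measure_display) (Omega : measurableType disp)
    (P : probability Omega R) (Y : nat -> Omega -> T) (mu : T -> R) : Prop :=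
  (\esum_(c in E) `| P [set w | Y t w = c] - (mu c)%:E |)%E
    @[t --> \oo] --> 0%E.

Lemma finite_boundary (R : realType) (d : nat) (A : set (lattice d)) :
  finite_set A -> finite_set (boundary R A).
Proof.
move=> finA.
pose shift (f : {ffun 'I_d -> 'I_3}) : lattice d :=
  \row_i ((f i : nat)%:Z - 1).
apply: (@sub_finite_set _ _
  (\bigcup_(y in A) ((fun f => y + shift f) @` setT))); last first.
  by apply: bigcup_finite => // y _; apply/finite_image/finite_finset.
move=> x [_ [y Ay xy1]]; exists y => //.
have small i : `|(x - y) 0 i| <= 1.
  have sum1 : \sum_(j < d) ((x - y) 0 j)%:~R ^+ 2 = 1 :> R.
    rewrite -[LHS]sqr_sqrtr ?sumr_ge0// => [|j _]; last exact: sqr_ge0.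
    by move: xy1; rewrite /enorm => ->; rewrite expr1n.
  have : ((x - y) 0 i)%:~R ^+ 2 <= 1 :> R.
    rewrite -[leRHS]sum1 [leRHS](bigD1 i)//= lerDl.
    by rewrite sumr_ge0// => j _; exact: sqr_ge0.
  by rewrite -real_normK ?num_real// expr_le1// -intr_norm lerz1.
exists [ffun i => inord (absz ((x - y) 0 i + 1))] => //.
apply/rowP => i; rewrite !mxE ffunE.
move: (small i); rewrite !mxE => small_i.
move: (x 0 i : int) (y 0 i : int) small_i => a b small_i.
rewrite inordK; lia.
Qed.

Lemma finite_cat_choices (R : realType) (d m : nat) (C : config d)
    (s : seq (lattice d)) :
  finite_set (cat_choices R m C s).
Proof.
rewrite /cat_choices; case: ifP => _; last exact/finite_boundary/finite_fset.
exact/finite_setD/finite_fset.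
Qed.

(* Main.v *)
Require Import Defs.
From mathcomp Require Import all_boot all_order all_algebra finmap zify ring lra.
From mathcomp Require Import all_classical all_reals all_analysis.

Set Implicit Arguments.
Unset Strict Implicit.
Unset Printing Implicit Defensive.

Import Order.TTheory GRing.Theory Num.Theory.
Import numFieldNormedType.Exports.

Local Open Scope classical_set_scope.
Local Open Scope ring_scope.

(* Always choosing a nearest admissible site has probability bounded below, and
   this greedy dynamics makes a configuration of at most 2m+1 points collapse to
   bounded diameter.  Hence from every such configuration the chain reaches,
   after a fixed number of steps and with probability at least c > 0, each of the
   eight straight segments based at p + r, r in {0,1}^3, for a suitable p.
   (i) Modulo translations this is a Doeblin condition, so the oscillation of the
   iterated transition operator decays geometrically.
   (ii) For n >= 2m+2, first split the configuration into clusters of m+1 to 2m+1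
   points, far apart from each other, by walking out m+1 points at a time.  As long
   as two clusters stay at distance L from each other, they move like independent
   CAT chains except for an error of order diam^b L^(-b) per step, 2 < b <= beta.
   By the Doeblin condition the relative displacement of two clusters is smeared
   out at least like a random walk in three directions, and clusters of large
   diameter collapse; so the expected total error is finite, and small if the
   initial distances are large.  With positive probability the clusters thus
   never come close again, and no translate of the initial set is revisited. *)

(** * Norms and boundaries *)

(** The number 2m+1 enters by counting: if a tight subset has more than m points, one of them stays
    in place during a step and at most m points lie outside, so greedy choices are drawn back to the
    subset. For two clusters, the mean of |x|^(-b) after t steps of a walk in three directions is at
    most of order t^(-b/2) when b < 3, and this is summable because b > 2; hence beta is replaced by
    min(beta, 5/2). Distance alone does not control the interaction, since a cluster may be
    stretched while another one is near. The product of diameter^b and distance^(-b) serves as a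
    Lyapunov function: a possible collapse makes it contract up to a multiple of the summable
    distance term, and the offset [D0] added to all lengths keeps its growth within a block small
    compared with the probability of collapse. Translating a single cluster commutes with the
    independent dynamics, which turns the shifts r into steps of a random walk. *)

Section Norm.
Variables (R : realType) (d : nat).
Implicit Types x y z : lattice d.

(** The sup norm: being integer valued, it leaves distance estimates to linear arithmetic, and it
    agrees with the Euclidean norm up to the factor d. *)
Definition nm x : nat := \max_(i < d) absz (x 0%R i).

Lemma leq_nm x (i : 'I_d) : (absz (x 0%R i) <= nm x)%N.
Proof. exact: (@leq_bigmax 'I_d (fun i => absz (x 0%R i)) i). Qed.

Lemma nm_leP x k : reflect (forall i, (absz (x 0%R i) <= k)%N) (nm x <= k)%N.
Proof.
apply: (iffP idP) => [h i|h]; first exact: leq_trans (leq_nm x i) h.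
by apply/bigmax_leqP => i _.
Qed.

Lemma nmN x : nm (- x) = nm x.
Proof. by apply: eq_bigr => i _; rewrite mxE abszN. Qed.

Lemma nmD x y : (nm (x + y) <= nm x + nm y)%N.
Proof.
apply/nm_leP => i; rewrite mxE.
by have := leq_nm x i; have := leq_nm y i; move: (x 0 i) (y 0 i) => a b; lia.
Qed.

Lemma nm_distC x y : nm (x - y) = nm (y - x).
Proof. by rewrite -nmN opprB. Qed.

Lemma nm_dist_trans y x z : (nm (x - z) <= nm (x - y) + nm (y - z))%N.
Proof. by have := nmD (x - y) (y - z); rewrite addrA subrK. Qed.

Lemma nm0 : nm (0 : lattice d) = 0%N.
Proof. by apply/eqP; rewrite -leqn0; apply/nm_leP => i; rewrite mxE. Qed.


Lemma enorm_ge0 x : 0 <= enorm R x.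
Proof. exact: sqrtr_ge0. Qed.

Lemma sqr_enorm x : enorm R x ^+ 2 = \sum_(i < d) (x 0 i)%:~R ^+ 2.
Proof. by rewrite sqr_sqrtr ?sumr_ge0// => i _; exact: sqr_ge0. Qed.

Lemma sqr_intr_absz (k : int) : k%:~R ^+ 2 = (absz k)%:R ^+ 2 :> R.
Proof. by rewrite natr_absz -[in LHS]real_normK ?num_real// -intr_norm. Qed.

Lemma nm_le_enorm x : (nm x)%:R <= enorm R x.
Proof.
case: (posnP d) => [d0|d_gt0].
  have -> : nm x = 0%N by rewrite /nm big1// => -[i ilt]; exfalso; lia.
  exact: enorm_ge0.
rewrite -(@ler_pXn2r _ 2%N) ?nnegrE ?enorm_ge0//.
have [i ->] : exists i : 'I_d, nm x = absz (x 0%R i).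
  by have [|i h] := @bigop.eq_bigmax 'I_d (fun i : 'I_d => absz (x 0%R i)); [rewrite card_ord|exists i].
rewrite sqr_enorm (bigD1 i)//= sqr_intr_absz lerDl sumr_ge0// => j _.
exact: sqr_ge0.
Qed.

Lemma enorm_le_nm x : enorm R x <= d%:R * (nm x)%:R.
Proof.
rewrite -(@ler_pXn2r _ 2%N) ?nnegrE ?enorm_ge0 ?mulr_ge0//.
rewrite sqr_enorm; apply: (@le_trans _ _ (\sum_(i < d) (nm x)%:R ^+ 2)).
  apply: ler_sum => i _; rewrite sqr_intr_absz lerXn2r ?nnegrE// ler_nat.
  exact: leq_nm.
rewrite sumr_const card_ord exprMn -[leLHS]mulr_natl ler_wpM2r ?sqr_ge0//.
by rewrite -natrX ler_nat; nia.
Qed.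

Lemma nm_enorm1 x : enorm R x = 1 -> (nm x <= 1)%N.
Proof. by move=> x1; rewrite -(ler_nat R) (le_trans (nm_le_enorm x))// x1. Qed.

Lemma nm_nearest x y z : enorm R (x - y) <= enorm R (x - z) ->
  (nm (x - y) <= d * nm (x - z))%N.
Proof.
move=> h; rewrite -(ler_nat R) natrM.
exact: le_trans (nm_le_enorm _) (le_trans h (enorm_le_nm _)).
Qed.

End Norm.

Section Phi.
Variables (R : realType) (beta : R) (d : nat).
Hypothesis beta_gt0 : 0 < beta.
Implicit Types u v w : lattice d.

Local Notation phi := (@phi R beta d).

Lemma max_enorm_gt0 (u : lattice d) : 0 < Num.max (enorm R u) 1.
Proof. by rewrite lt_max ltr01 orbT. Qed.

Lemma phi_gt0 u v : 0 < phi u v.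
Proof. by rewrite powR_gt0// max_enorm_gt0. Qed.

Lemma ler_powRN (r s : R) : 0 < r -> r <= s -> s `^ (- beta) <= r `^ (- beta).
Proof.
move=> r0 rs; have s0 := lt_le_trans r0 rs.
rewrite !powRN lef_pV2 ?posrE; [|exact: powR_gt0..].
by apply: ge0_ler_powR rs; rewrite ?nnegrE ltW.
Qed.

Lemma phi_nearest u v w : enorm R (u - v) <= enorm R (u - w) ->
  phi u w <= phi u v.
Proof.
move=> h; apply: ler_powRN (max_enorm_gt0 _) _.
by rewrite ge_max (le_max _ (enorm _ _)) h le_max lexx orbT.
Qed.

Lemma phi_le1 u v : phi u v <= 1.
Proof.
have -> : 1 = 1 `^ (- beta) :> R by rewrite powR1.
rewrite ler_powRN//.
by rewrite le_max lexx orbT.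
Qed.

Lemma phi_ge u v (r : R) : 1 <= r -> enorm R (u - v) <= r -> r `^ (- beta) <= phi u v.
Proof.
by move=> r1 h; apply: ler_powRN (max_enorm_gt0 _) _; rewrite ge_max h.
Qed.

Lemma phi_le u v (r : R) : 0 < r -> r <= enorm R (u - v) -> phi u v <= r `^ (- beta).
Proof. by move=> r0 h; apply: ler_powRN r0 _; rewrite le_max h. Qed.

Lemma phi_translate u v w : phi (u + w) (v + w) = phi u v.
Proof. by rewrite /Defs.phi opprD addrACA subrr addr0. Qed.

End Phi.

Definition dir d (i : 'I_d) : lattice d := delta_mx 0 i.

Section Boundary.
Variables (R : realType) (d : nat).
Implicit Types (A : config d) (x y a : lattice d).

Lemma enorm_dir (i : 'I_d) : enorm R (dir i) = 1.
Proof.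
rewrite /enorm (bigD1 i)//= mxE !eqxx/= big1 ?addr0 ?expr1n ?sqrtr1// => j /negPf ji.
by rewrite mxE ji andbF expr0n.
Qed.

Definition bdry A : config d := fset_set (boundary R [set` A]).

Lemma in_bdry A x : x \in bdry A <->
  x \notin A /\ exists2 y, y \in A & enorm R (x - y) = 1.
Proof.
rewrite in_fset_set; last exact/finite_boundary/finite_fset.
rewrite inE; split => -[xA [y yA xy]]; split => //; try by exists y.
  exact/negP.
exact/negP.
Qed.

Lemma bdry_dir A a (i : 'I_d) : a \in A -> a + dir i \notin A -> a + dir i \in bdry A.
Proof.
move=> aA aiA; apply/in_bdry; split=> //; exists a => //.
by rewrite addrC addKr enorm_dir.
Qed.

(** Walk from a in a coordinate direction: by pigeonhole the walk leaves A within #|A| steps, and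
    its first site outside A is a boundary site. *)
Lemma near_bdry A a (i0 : 'I_d) : a \in A ->
  exists2 y, y \in bdry A & (nm (y - a) <= #|` A|)%N.
Proof.
move=> aA; pose f (k : nat) : lattice d := a + dir i0 *+ k.
have fE k : f k.+1 = f k + dir i0 by rewrite /f mulrSr addrA.
have f_inj : injective f.
  move=> k l /addrI/rowP/(_ i0); rewrite !mulmxnE !mxE !eqxx/=; lia.
have [k kA] : exists k, (f k \notin A) && (k <= #|` A|)%N.
  apply/not_existsP => h.
  have : (size [seq f k | k <- iota 0 #|` A|.+1] <= size A)%N.
    apply: uniq_leq_size; first by rewrite map_inj_uniq ?iota_uniq.
    move=> x /mapP[k]; rewrite mem_iota/= add0n ltnS => kA ->.
    by apply: contra_notT (h k) => ->.
  by rewrite size_map size_iota ltnn.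
have ex : exists k, f k \notin A by exists k; case/andP: kA.
case: (ex_minnP ex) => l lA lmin.
have l_le : (l <= #|` A|)%N.
  by case/andP: kA => kA; apply: leq_trans; apply: lmin.
case: l lA lmin l_le => [|l] lA lmin l_le; first by rewrite /f mulr0n addr0 aA in lA.
exists (f l.+1).
  rewrite fE bdry_dir// -?fE//.
  by apply: contraT => /lmin; rewrite ltnn.
apply: leq_trans l_le; rewrite /f addrC addKr; apply/nm_leP => i.
by rewrite mulmxnE mxE eqxx/=; case: (i == i0); lia.
Qed.

Lemma card_bdry A : (#|` bdry A| <= 3 ^ d * #|` A|)%N.
Proof.
pose shift (f : {ffun 'I_d -> 'I_3}) : lattice d :=
  \row_i ((f i : nat)%:Z - 1).
have -> : (3 ^ d * #|` A| = size [seq (a + shift f)%R | a <- A, f <- enum {ffun 'I_d -> 'I_3}])%N.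
  by rewrite size_allpairs -cardE card_ffun !card_ord mulnC.
apply: uniq_leq_size; first exact: fset_uniq.
move=> x /in_bdry[_ [y yA /nm_enorm1/nm_leP xy]].
apply/allpairsP; exists (y, [ffun i => inord (absz ((x - y) 0%R i + 1))]) => /=; split => //.
  by rewrite mem_enum.
apply/rowP => i; rewrite !mxE ffunE.
move: (xy i); rewrite !mxE.
move: (x 0 i : int) (y 0 i : int) => a b small_i.
rewrite inordK; lia.
Qed.

End Boundary.

(** * Translates and straight segments *)

Section Ray.
Variable d : nat.
Implicit Types (C : config d) (x y z p : lattice d).

Definition diam_le (B : nat) C := forall x y, x \in C -> y \in C -> (nm (x - y) <= B)%N.

Lemma mem_translate C z x : (x \in translate C z) = (x - z \in C).
Proof.
apply/imfsetP/idP => [[y yC ->]|xC]; first by rewrite addrK.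
by exists (x - z); rewrite ?subrK.
Qed.

Lemma card_translate C z : #|` translate C z| = #|` C|.
Proof. by apply: card_imfset; exact: addIr. Qed.

Lemma translateD C y z : translate (translate C y) z = translate C (y + z).
Proof. by apply/fsetP => x; rewrite !mem_translate opprD [- y - z]addrC addrA. Qed.

Lemma translate0 C : translate C 0 = C.
Proof. by apply/fsetP => x; rewrite mem_translate subr0. Qed.

Definition ray (i : 'I_d) (p : lattice d) (a j : nat) : config d :=
  [fset x in [seq (p + dir i *+ k)%R | k <- iota a j]]%fset.

Lemma rayP i p a j x :
  reflect (exists2 k, (a <= k < a + j)%N & x = p + dir i *+ k) (x \in ray i p a j).
Proof.
rewrite in_fset; apply: (iffP mapP) => -[k ka ->]; exists k => //.
  by rewrite -mem_iota.
by rewrite mem_iota.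
Qed.

Lemma dirE (i l : 'I_d) k : (dir i *+ k) 0 l = ((l == i) * k)%N%:Z.
Proof. by rewrite mulmxnE mxE eqxx/= -mulrnA natz. Qed.

Lemma dir_inj (i : 'I_d) p : injective (fun k => p + dir i *+ k).
Proof. by move=> a b /addrI/rowP/(_ i); rewrite !dirE eqxx !mul1n => -[]. Qed.

Lemma card_ray i p a j : #|` ray i p a j| = j.
Proof.
rewrite card_fseq undup_id ?size_map ?size_iota// map_inj_uniq ?iota_uniq//.
exact: dir_inj.
Qed.

Lemma rayD i p a b j : ray i (p + dir i *+ a) b j = ray i p (a + b) j.
Proof.
apply/fsetP => x; apply/rayP/rayP => -[k kb ->].
  exists (a + k)%N; last by rewrite mulrnDr addrA.
  by rewrite -addnA !leq_add2l ltn_add2l.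
by exists (k - a)%N; [lia|rewrite -addrA -mulrnDr subnKC//; lia].
Qed.

Lemma rayU i p a j l : (ray i p a j `|` ray i p (a + j) l)%fset = ray i p a (j + l).
Proof.
apply/fsetP => x; rewrite inE; apply/orP/rayP => [[]/rayP[k kb ->]|[k kb ->]].
- by exists k => //; lia.
- by exists k => //; lia.
have [kj|kj] := ltnP k (a + j); [left|right]; apply/rayP; exists k => //; lia.
Qed.

Lemma diam_ray i p a j : diam_le j (ray i p a j).
Proof.
move=> x y /rayP[k kj ->] /rayP[l lj ->]; apply/nm_leP => h.
by rewrite opprD addrACA subrr add0r 2!mxE !dirE; case: (h == i); lia.
Qed.

Definition line (i0 : 'I_d) (p : lattice d) j := ray i0 p 0 j.

Lemma line_translate (i0 : 'I_d) p j : line i0 p j = translate (line i0 0 j) p.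
Proof.
apply/fsetP => x; rewrite mem_translate; apply/rayP/rayP => -[k kj xE]; exists k => //.
  by rewrite xE addrC addKr add0r.
by rewrite addrC -(subrK p x) xE add0r.
Qed.

End Ray.

(** * One step of the chain *)

Section Step.
Variables (R : realType) (beta : R) (d m : nat).
Implicit Types (C D : config d) (s : seq (lattice d)) (x y z : lattice d).

Definition chs C s : config d := fset_set (cat_choices R m C s).
Local Notation upd := (cat_update m).
Local Notation prb := (cat_choice_prob beta m).
Local Notation wt := (cat_weight beta).

Lemma mem_chs C s y : (y \in cat_choices R m C s) = (y \in chs C s).
Proof. by rewrite in_fset_set//; exact: finite_cat_choices. Qed.

Lemma in_chs_lt C s y : (size s < m)%N -> (y \in chs C s) = (y \in C) && (y \notin s).
Proof.
move=> sm; rewrite -mem_chs /cat_choices sm.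
apply/idP/andP => [|[yC ys]]; first by rewrite inE => -[yC /negP ys].
by rewrite inE; split => //; apply/negP.
Qed.

Lemma chs_ge C s : (m <= size s)%N -> chs C s = bdry R (upd C s).
Proof. by move=> sm; rewrite /chs /cat_choices ltnNge sm. Qed.

Lemma prbE C s y : prb C s y =
  if y \in chs C s then wt s y / \sum_(z <- chs C s) wt s z else 0.
Proof.
by rewrite /cat_choice_prob mem_chs fsbig_finite//; exact: finite_cat_choices.
Qed.

Lemma in_upd C s y : (y \in upd C s) = (y \in C) && (y \notin take m s) || (y \in drop m s).
Proof. by rewrite in_fsetU in_fsetD !in_fset andbC. Qed.

Lemma in_upd_le C s y : (size s <= m)%N -> (y \in upd C s) = (y \in C) && (y \notin s).
Proof. by move=> sm; rewrite in_upd take_oversize// drop_oversize// orbF. Qed.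

Lemma upd_rcons C s y : (m <= size s)%N -> upd C (rcons s y) = (y |` upd C s)%fset.
Proof.
move=> sm; apply/fsetP => z; rewrite in_fsetU in_fset1 !in_upd drop_rcons// mem_rcons inE.
by rewrite -cats1 takel_cat// orbCA.
Qed.

(** Built by appending on the right, because the admissible sites depend on the whole prefix. The
    parameter [ok] is trivial for [cvalid] and is the nearest-site rule for greedy paths. *)
Inductive cpath (ok : seq (lattice d) -> lattice d -> Prop) C : seq (lattice d) -> Prop :=
  | cpath_nil : cpath ok C [::]
  | cpath_rcons s y : cpath ok C s -> y \in chs C s -> ok s y -> cpath ok C (rcons s y).

Definition cvalid := cpath (fun _ _ => True).

Lemma cpath_rconsP ok C s y :
  cpath ok C (rcons s y) <-> [/\ cpath ok C s, y \in chs C s & ok s y].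
Proof.
split=> [|[]]; last exact: cpath_rcons.
move E : (rcons s y) => t p; case: p E => [/(congr1 size)|s' y' ? ? ? /rcons_inj[-> ->]//].
by rewrite size_rcons.
Qed.

Lemma cvalid_rcons C s y : cvalid C (rcons s y) <-> cvalid C s /\ y \in chs C s.
Proof. by split=> [/cpath_rconsP[]//|[vs yC]]; apply/cpath_rconsP. Qed.

Lemma cpath_cvalid ok C s : cpath ok C s -> cvalid C s.
Proof. by elim=> [|s' y _ v yC _]; [exact: cpath_nil|exact/cvalid_rcons]. Qed.

Lemma cpath_cat ok C s t : cpath ok C (s ++ t) -> cpath ok C s.
Proof.
elim/last_ind: t => [|t y IH]; first by rewrite cats0.
by rewrite -rcons_cat => /cpath_rconsP[/IH].
Qed.

Lemma cvalid_take C s : cvalid C s -> uniq (take m s) /\ {subset take m s <= C}.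
Proof.
elim=> {s}[|s y vs [su sC] yC _]; first by [].
have [sm|sm] := ltnP (size s) m; last by rewrite -cats1 takel_cat.
move: yC su sC; rewrite in_chs_lt// => /andP[yC ys].
rewrite !take_oversize ?size_rcons ?(ltnW sm)// rcons_uniq ys => -> sC; split => // z.
by rewrite mem_rcons inE => /predU1P[->|/sC].
Qed.

(** Each of the first m choices removes a new point of C, and each later one adds a site outside the
    current set; truncated subtraction covers both phases. *)
Lemma card_upd C s : cvalid C s ->
  (#|` upd C s| + minn m (size s) = #|` C| + (size s - m))%N.
Proof.
elim=> {s}[|s y vs IH yC _].
  rewrite (_ : upd C [::] = C) ?minn0//; apply/fsetP => z.
  by rewrite in_upd_le// andbT.
rewrite size_rcons; have [sm|sm] := ltnP (size s) m.
  have /cvalid_take[] : cvalid C (rcons s y) by apply/cvalid_rcons.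
  rewrite take_oversize ?size_rcons// => su sC.
  have -> : upd C (rcons s y) = (C `\` [fset z in rcons s y])%fset.
    by apply/fsetP => z; rewrite in_upd_le ?size_rcons// in_fsetD in_fset andbC.
  rewrite cardfsD (fsetIidPr _).
    have -> : #|` [fset z in rcons s y]%fset| = (size s).+1.
      by rewrite card_fseq undup_id// size_rcons.
    have : (size (rcons s y) <= #|` C|)%N by exact: uniq_leq_size.
    by rewrite size_rcons; lia.
  by apply/fsubsetP => z; rewrite inE => /sC.
rewrite upd_rcons// cardfsU1.
move: yC; rewrite chs_ge// => /in_bdry[-> _]; lia.
Qed.

Lemma card_upd2m C s : cvalid C s -> size s = (2 * m)%N -> #|` upd C s| = #|` C|.
Proof. by move=> /card_upd + s2m; rewrite s2m; lia. Qed.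

Lemma card_chs C s : cvalid C s -> (size s <= 2 * m)%N -> (#|` chs C s| <= 3 ^ d * #|` C|)%N.
Proof.
move=> /card_upd cs sm2; have [sm|sm] := ltnP (size s) m.
  apply: (@leq_trans #|` C|); last by rewrite leq_pmull// expn_gt0.
  by apply: fsubset_leq_card; apply/fsubsetP => z; rewrite in_chs_lt// => /andP[].
rewrite chs_ge//; apply: leq_trans (card_bdry _ _) _.
by rewrite leq_mul2l; apply/orP; right; lia.
Qed.

Lemma wt_gt0 s y : 0 < wt s y.
Proof. by case: s => [|x s]; [exact: ltr01|exact: phi_gt0]. Qed.

Lemma wt_rcons s x y : wt (rcons s x) y = phi beta x y.
Proof. by case: s => [|z s] /=; [|rewrite last_rcons]. Qed.

Lemma prb_ge0 C s y : 0 <= prb C s y.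
Proof.
rewrite prbE; case: ifP => // _.
by apply: divr_ge0; [exact/ltW/wt_gt0|apply: sumr_ge0 => z _; exact/ltW/wt_gt0].
Qed.

Lemma sum_wt_gt0 C s y : y \in chs C s -> 0 < \sum_(z <- chs C s) wt s z.
Proof.
move=> yC; apply: lt_le_trans (wt_gt0 s y) _.
rewrite (big_fsetD1 y)//= lerDl sumr_ge0// => z _; exact/ltW/wt_gt0.
Qed.

Lemma sum_prb C s y : y \in chs C s -> \sum_(z <- chs C s) prb C s z = 1.
Proof.
move=> yC; under eq_big_seq => z zC do rewrite prbE zC.
by rewrite -mulr_suml divff// gt_eqF ?(sum_wt_gt0 yC).
Qed.

(** There are at most 3^d #|C| admissible sites, and none of them has more than c times the weight
    of y. *)
Lemma prb_ge C s y (c : R) : cvalid C s -> (size s <= 2 * m)%N -> y \in chs C s -> 0 < c ->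
  (forall z, z \in chs C s -> wt s z <= c * wt s y) ->
  (c * (3 ^ d * #|` C|)%:R)^-1 <= prb C s y.
Proof.
move=> vs s2m yC c0 h; rewrite prbE yC.
have N0 : (0 < #|` chs C s|)%N by rewrite cardfs_gt0; apply/fset0Pn; exists y.
have S0 := sum_wt_gt0 yC.
have SN : \sum_(z <- chs C s) wt s z <= (c * (3 ^ d * #|` C|)%:R) * wt s y.
  apply: (@le_trans _ _ (\sum_(z <- chs C s) c * wt s y)).
    by rewrite !big_seq; apply: ler_sum => z; exact: h.
  rewrite big_const_seq count_predT iter_addr_0 -[leLHS]mulr_natl mulrA [_ * c]mulrC.
  rewrite ler_pM2r ?wt_gt0// ler_pM2l// ler_nat; exact: card_chs.
have K0 : 0 < c * (3 ^ d * #|` C|)%:R.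
  by rewrite -(pmulr_lgt0 _ (wt_gt0 s y)); exact: lt_le_trans SN.
by rewrite ler_pdivlMr// mulrC ler_pdivrMr// mulrC.
Qed.

Lemma chs_neq0 C s (i0 : 'I_d) : cvalid C s -> (m < #|` C|)%N -> exists y, y \in chs C s.
Proof.
move=> vs mC; have cs := card_upd vs; have [sm|sm] := ltnP (size s) m; last first.
  have /fset0Pn[a aU] : upd C s != fset0 by rewrite -cardfs_gt0; lia.
  by have [y yb _] := near_bdry R i0 aU; exists y; rewrite chs_ge.
have /fset0Pn[a aU] : upd C s != fset0 by rewrite -cardfs_gt0; lia.
by exists a; rewrite in_chs_lt// -in_upd_le// ltnW.
Qed.

(* Mean of h over k further choices after the choices s. *)
Fixpoint Ex C k s (h : seq (lattice d) -> R) : R :=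
  if k is k'.+1 then \sum_(y <- chs C s) prb C s y * Ex C k' (rcons s y) h else h s.

Lemma Ex_le C k s h h' : cvalid C s ->
  (forall t, cvalid C t -> size t = (size s + k)%N -> h t <= h' t) ->
  Ex C k s h <= Ex C k s h'.
Proof.
elim: k s => [|k IH] s vs hh /=; first by apply: hh; rewrite ?addn0.
rewrite !big_seq; apply: ler_sum => y yC.
rewrite ler_wpM2l ?prb_ge0// IH//; first exact/cvalid_rcons.
by move=> t vt st; apply: hh; rewrite // st size_rcons addSnnS.
Qed.

Lemma Ex_lin C k s (a : R) h h' :
  Ex C k s (fun t => a * h t + h' t) = a * Ex C k s h + Ex C k s h'.
Proof.
elim: k s => [//|k IH] s /=.
rewrite mulr_sumr -big_split/=; apply: eq_bigr => y _.
by rewrite IH mulrDr mulrCA.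
Qed.

Lemma Ex1 C k s (i0 : 'I_d) : cvalid C s -> (m < #|` C|)%N -> Ex C k s (fun=> 1) = 1.
Proof.
elim: k s => [//|k IH] s vs mC /=.
have [y yC] := chs_neq0 i0 vs mC.
rewrite -[RHS](sum_prb yC); apply: eq_big_seq => z zC.
by rewrite -[RHS]mulr1; congr (_ * _); apply: IH => //; exact/cvalid_rcons.
Qed.

Lemma Ex_ge0 C k s h : (forall t, 0 <= h t) -> 0 <= Ex C k s h.
Proof.
move=> h0; elim: k s => [//|k IH] s /=.
by apply: sumr_ge0 => y _; rewrite mulr_ge0 ?prb_ge0.
Qed.

Lemma Ex_add C k l s h : Ex C (k + l) s h = Ex C k s (fun t => Ex C l t h).
Proof. by elim: k s => [//|k IH] s /=; apply: eq_bigr => y _; rewrite IH. Qed.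

(** Only the term of the single path s is kept in the iterated sum. *)
Lemma Ex_ge_path (ok : seq (lattice d) -> lattice d -> Prop) C (c : R) s : 0 <= c ->
  (forall t y, cvalid C t -> y \in chs C t -> (size t < size s)%N -> ok t y -> c <= prb C t y) ->
  cpath ok C s ->
  forall h, (forall t, 0 <= h t) -> c ^+ size s * h s <= Ex C (size s) [::] h.
Proof.
move=> c0 + ps; elim: ps => {s}[|s y ps IH yC ksy] hc h h0.
  by rewrite expr0 mul1r.
have vs := cpath_cvalid ps.
rewrite size_rcons -addn1 Ex_add exprD expr1 -mulrA.
apply: le_trans (IH _ _ _); last 2 first.
- by move=> t y' vt yt st; apply: hc => //; rewrite size_rcons ltnS ltnW.
- by move=> t; exact: Ex_ge0.
rewrite ler_wpM2l ?exprn_ge0//= (big_fsetD1 y)//= -[leLHS]addr0 lerD//.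
  by rewrite ler_wpM2r// hc// size_rcons.
by apply: sumr_ge0 => z _; rewrite mulr_ge0 ?prb_ge0.
Qed.

Definition step C D := exists2 s, cvalid C s & size s = (2 * m)%N /\ D = upd C s.

(** The one-step transition operator of the chain, acting on functions; [cat_kernelE] links it to
    the kernel. *)
Definition U (h : config d -> R) C : R := Ex C (2 * m) [::] (fun s => h (upd C s)).

Lemma U_le C h h' : (forall D, step C D -> h D <= h' D) -> U h C <= U h' C.
Proof.
move=> hh; apply: Ex_le; first exact: cpath_nil.
by move=> t vt st; apply: hh; exists t.
Qed.

Lemma U_lin C (a : R) h h' : U (fun D => a * h D + h' D) C = a * U h C + U h' C.
Proof. exact: Ex_lin. Qed.

Lemma U1 C (i0 : 'I_d) : (m < #|` C|)%N -> U (fun=> 1) C = 1.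
Proof. by move=> mC; rewrite /U (Ex1 _ i0)//; exact: cpath_nil. Qed.

Lemma U_ge0 C h : (forall D, 0 <= h D) -> 0 <= U h C.
Proof. by move=> h0; exact: Ex_ge0. Qed.

Lemma step_card C D : step C D -> #|` D| = #|` C|.
Proof. by move=> [s vs [s2m ->]]; exact: card_upd2m. Qed.

Lemma cvalid_near C s : cvalid C s -> forall x, x \in s ->
  exists2 a, a \in C & (nm (x - a) <= size s - m)%N.
Proof.
elim=> {s}[//|s y vs IH yC _ x]; rewrite mem_rcons inE size_rcons => /predU1P[{x}->|/IH[a aC ax]].
  have [sm|sm] := ltnP (size s) m.
    by exists y; [move: yC; rewrite in_chs_lt// => /andP[]|rewrite subrr nm0].
  move: yC; rewrite chs_ge// => /in_bdry[_ [z zU /nm_enorm1 yz]].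
  have [a aC az] : exists2 a, a \in C & (nm (z - a) <= size s - m)%N.
    move: zU; rewrite in_upd => /orP[/andP[zC _]|/mem_drop/IH//].
    by exists z => //; rewrite subrr nm0.
  by exists a => //; have := nm_dist_trans z y a; lia.
by exists a => //; lia.
Qed.

Lemma upd_near C s : cvalid C s -> forall x, x \in upd C s ->
  exists2 a, a \in C & (nm (x - a) <= size s - m)%N.
Proof.
move=> vs x; rewrite in_upd => /orP[/andP[xC _]|/mem_drop/(cvalid_near vs)//].
by exists x => //; rewrite subrr nm0.
Qed.

Lemma step_near C D : step C D -> forall x, x \in D ->
  exists2 a, a \in C & (nm (x - a) <= m)%N.
Proof.
move=> [s vs [s2m ->]] x /(upd_near vs)[a aC ax]; exists a => //.
by move: ax; rewrite s2m; lia.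
Qed.

Lemma upd_sub C t r z : (m <= size t)%N -> z \in upd C t -> z \in upd C (t ++ r).
Proof.
move=> mt; rewrite !in_upd takel_cat// drop_cat.
case: ltngtP mt => // [mt _|mt _].
  by rewrite mem_cat => /orP[->//|->]; rewrite orbT.
by rewrite mt drop_size subnn drop0 orbF => ->.
Qed.

(** After the activation phase sites are only added, so z is still occupied whenever a later site is
    chosen, and that site is a vacant one. *)
Lemma upd_notin C t r z : cvalid C (t ++ r) -> (m <= size t)%N -> z \in upd C t -> z \notin r.
Proof.
move=> + mt zt; elim/last_ind: r => // r y IH.
rewrite -rcons_cat => /cvalid_rcons[v]; rewrite chs_ge ?size_cat ?(leq_trans mt) ?leq_addr//.
move=> /in_bdry[yU _]; rewrite mem_rcons inE negb_or IH// andbT.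
by apply: contraNneq yU => <-; exact: upd_sub.
Qed.

(** The m deposited sites are the witness: each was chosen on the boundary of the retained points
    together with the earlier deposits, and this set misses the later deposits by [upd_notin]. *)
Lemma step_Prog C D : (m < #|` C|)%N -> step C D -> Prog R d m #|` C| D.
Proof.
move=> mC sCD; have cD := step_card sCD; split => //; first by rewrite cD.
case: sCD cD => s vs [s2m ->] cD.
have sz : size (drop m s) == m by rewrite size_drop s2m mul2n -addnn addnK.
exists (Tuple sz).
have [ss ud] : {subset drop m s <= upd C s} /\ uniq (drop m s).
  split=> [x xs|]; first by rewrite in_upd xs orbT.
  elim: vs => {s s2m cD sz}[//|s y vs IH yC _].
  have [sm|sm] := leqP m (size s); last by rewrite drop_oversize// size_rcons.
  rewrite drop_rcons// rcons_uniq IH andbT.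
  move: yC; rewrite chs_ge// => /in_bdry[+ _]; rewrite in_upd negb_or => /andP[_ ->//].
split=> // j; rewrite (tnth_nth 0)/= nth_drop.
have jm := ltn_ord j.
pose t := take (m + j) s; pose r := drop (m + j) s.
have sE : s = t ++ r by rewrite cat_take_drop.
have [vt yC] : cvalid C t /\ nth 0 s (m + j) \in chs C t.
  apply/cvalid_rcons; rewrite -take_nth; last by lia.
  by apply: (@cpath_cat _ _ _ (drop (m + j).+1 s)); rewrite cat_take_drop.
have st : size t = (m + j)%N by rewrite size_takel//; lia.
have mjs : (m + j < size s)%N by rewrite s2m; lia.
have yr : nth 0 s (m + j) \in r by rewrite /r (drop_nth 0 mjs) mem_head.
move: yC; rewrite chs_ge ?st ?leq_addr// => /in_bdry[yU [z zU yz]].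
split; first by case=> _ yd; apply: yd; rewrite /= drop_drop [(j + m)%N]addnC.
exists z => //; split; first by rewrite /= sE upd_sub// st leq_addr.
rewrite /= drop_drop [(j + m)%N]addnC => zr.
by move: vs; rewrite sE => /upd_notin/(_ _ zU)/negP; apply => //; rewrite st leq_addr.
Qed.

(** * Translation invariance of one step *)

Definition tr (z : lattice d) s := [seq x + z | x <- s].

Lemma mem_tr z s x : (x \in tr z s) = (x - z \in s).
Proof.
apply/mapP/idP => [[y yC ->]|xC]; first by rewrite addrK.
by exists (x - z); rewrite ?subrK.
Qed.

Lemma upd_translate C s z : upd (translate C z) (tr z s) = translate (upd C s) z.
Proof.
apply/fsetP => x; rewrite mem_translate !in_upd mem_translate.
by rewrite -map_take -map_drop !mem_tr.
Qed.

Lemma bdry_translate C z : bdry R (translate C z) = translate (bdry R C) z.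
Proof.
apply/fsetP => x; rewrite mem_translate; apply/idP/idP.
  move=> /in_bdry[xC [y yC xy]]; apply/in_bdry; rewrite -mem_translate; split => //.
  by exists (y - z); rewrite -?mem_translate// opprB addrA subrK.
move=> /in_bdry[xC [y yC xy]]; apply/in_bdry; rewrite mem_translate; split => //.
exists (y + z); first by rewrite mem_translate addrK.
by rewrite opprD addrA addrAC.
Qed.

Lemma chs_translate C s z : chs (translate C z) (tr z s) = translate (chs C s) z.
Proof.
have [sm|sm] := ltnP (size s) m.
  by apply/fsetP => x; rewrite mem_translate !in_chs_lt ?size_map// mem_translate mem_tr.
by rewrite !chs_ge ?size_map// upd_translate bdry_translate.
Qed.

Lemma big_translate C z (F : lattice d -> R) :
  \sum_(x <- translate C z) F x = \sum_(x <- C) F (x + z).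
Proof. by rewrite big_imfset//= => x y _ _; exact: addIr. Qed.

Lemma wt_translate s y z : wt (tr z s) (y + z) = wt s y.
Proof. by case: s => [|x s] /=; [|rewrite /= (last_map (fun u => u + z)) phi_translate]. Qed.

Lemma prb_translate C s y z : prb (translate C z) (tr z s) (y + z) = prb C s y.
Proof.
rewrite !prbE chs_translate mem_translate addrK big_translate wt_translate.
by case: ifP => // _; congr (_ / _); apply: eq_bigr => x _; rewrite wt_translate.
Qed.

Lemma Ex_translate C k s h z :
  Ex (translate C z) k (tr z s) h = Ex C k s (fun t => h (tr z t)).
Proof.
elim: k s => [//|k IH] s /=.
rewrite chs_translate big_translate; apply: eq_bigr => y _.
by rewrite prb_translate -IH /tr map_rcons.
Qed.

Lemma U_translate C h z : U h (translate C z) = U (fun D => h (translate D z)) C.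
Proof.
rewrite /U (_ : [::] = tr z [::])// Ex_translate.
by congr Ex; apply/funext => t; rewrite upd_translate.
Qed.

(** * The kernel as an operator on functions *)

Lemma esumZl (T : choiceType) (S : set T) (c : R) (a : T -> \bar R) : 0 <= c ->
  (forall i, 0 <= a i)%E ->
  (\esum_(i in S) (c%:E * a i) = c%:E * \esum_(i in S) a i)%E.
Proof.
move=> c0 a0; rewrite /esum -ereal_supZl//; last first.
  by apply/set0P; exists (\sum_(x \in set0) a x)%E; exists set0 => //; exact: fsets_set0.
congr ereal_sup; apply/seteqP; split => _ [A SA <-] /=.
  by exists (\sum_(x \in A) a x)%E; [exists A|rewrite ge0_mule_fsumr].
by case: SA => B SB <-; exists B => //; rewrite ge0_mule_fsumr.
Qed.

Lemma esum_chs C s (F : lattice d -> R) : (forall y, 0 <= F y) ->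
  (\esum_(y in [set: lattice d]) (prb C s y * F y)%:E = (\sum_(y <- chs C s) prb C s y * F y)%:E)%E.
Proof.
move=> F0; rewrite (esumID [set` chs C s])// => [|y _]; last first.
  by rewrite lee_fin mulr_ge0// prb_ge0.
rewrite !setTI [X in (_ + X)%E]esum1 ?adde0 => [|y /= /negP yC]; last first.
  by rewrite prbE (negPf yC) mul0r.
rewrite esum_fset => [| |y _]; last 2 first.
- exact: finite_fset.
- by rewrite lee_fin mulr_ge0// prb_ge0.
by rewrite fsbig_finite ?finite_fset//= set_fsetK sumEFin.
Qed.

(** Splitting off the first entry of a tuple matches the outermost sum of [Ex], so the infinite sum
    over tuples becomes an iterated finite one. *)
Lemma esum_path C k s (h : seq (lattice d) -> R) : (forall t, 0 <= h t) ->
  (\esum_(x in [set: k.-tuple (lattice d)])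
     ((\prod_(l < k) prb C (s ++ take l x) (tnth x l)) * h (s ++ x))%:E
  = (Ex C k s h)%:E)%E.
Proof.
move=> h0; elim: k s => [|k IH] s.
  rewrite (_ : setT = [set [tuple]]); last first.
    by apply/seteqP; split => // t _; rewrite /= (tuple0 t).
  by rewrite esum_set1 ?big_ord0 ?mul1r ?cats0 ?lee_fin.
pose e (p : lattice d * k.-tuple (lattice d)) : k.+1.-tuple (lattice d) := [tuple of p.1 :: p.2].
rewrite (@reindex_esum _ _ _ ([set: lattice d] `*`` (fun=> [set: k.-tuple (lattice d)])) _ e); last first.
  split => //.
    move=> [x t] [y u] _ _ /(congr1 val)/= [-> tu]; congr (_, _); exact: val_inj.
  by move=> t _; exists (thead t, [tuple of behead t]) => //; rewrite /e/= -tuple_eta.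
rewrite -(@esum_esum _ _ _ setT (fun=> setT) (fun y t =>
  ((\prod_(l < k.+1) prb C (s ++ take l (e (y, t))) (tnth (e (y, t)) l)) * h (s ++ e (y, t)))%:E)) => [|y t _ _]; last first.
  by rewrite lee_fin mulr_ge0//; apply: prodr_ge0 => l _; exact: prb_ge0.
rewrite /= -esum_chs => [|y]; last exact: Ex_ge0.
apply: eq_esum => y _; rewrite EFinM -IH -esumZl ?prb_ge0// => [|t]; last first.
  by rewrite lee_fin mulr_ge0//; apply: prodr_ge0 => l _; exact: prb_ge0.
apply: eq_esum => t _; rewrite -EFinM mulrA cat_rcons big_ord_recl/= cats0.
congr (_ * _ * _)%:E; apply: eq_bigr => l _.
by rewrite cat_rcons tnthS.
Qed.

Lemma esum_Ex (T : choiceType) (S : set T) C k s (f : T -> seq (lattice d) -> R) g :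
  (forall i t, 0 <= f i t) ->
  (forall t, \esum_(i in S) (f i t)%:E = (g t)%:E)%E ->
  (\esum_(i in S) (Ex C k s (f i))%:E = (Ex C k s g)%:E)%E.
Proof.
move=> f0 fg; elim: k s => [//|k IH] s /=.
under eq_esum => i _ do rewrite -sumEFin.
rewrite esum_sum => [|i y _ _]; last by rewrite lee_fin mulr_ge0 ?prb_ge0 ?Ex_ge0.
rewrite -sumEFin; apply: eq_bigr => y _; rewrite EFinM -IH -esumZl ?prb_ge0// => i.
by rewrite lee_fin Ex_ge0.
Qed.

Lemma U_ext C h h' : h =1 h' -> U h C = U h' C.
Proof. by move=> /funext ->. Qed.

Lemma Ex_scale C k s (a : R) h : Ex C k s (fun t => a * h t) = a * Ex C k s h.
Proof.
elim: k s => [//|k IH] s /=; rewrite mulr_sumr; apply: eq_bigr => y _.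
by rewrite IH mulrCA.
Qed.

Lemma U_scale C (a : R) h : U (fun D => a * h D) C = a * U h C.
Proof. exact: Ex_scale. Qed.

Lemma cat_kernelE C D : cat_kernel beta m C D = (U (fun E => (E == D)%:R) C)%:E.
Proof.
rewrite /U -esum_path// /cat_kernel esum_mkcond; apply: eq_esum => x _ /=.
have [xD|xD] := eqVneq (upd C x) D; first by rewrite ifT ?mulr1//; exact/mem_set.
by rewrite ifF ?mulr0//; apply/negbTE/negP => /set_mem; exact/eqP.
Qed.

Lemma kernel_esum C (S : set (config d)) h : (forall D, 0 <= h D) ->
  (\esum_(D in S) (cat_kernel beta m C D * (h D)%:E) =
   (U (fun D => if D \in S then h D else 0) C)%:E)%E.
Proof.
move=> h0.
under eq_esum => D _ do rewrite cat_kernelE -EFinM mulrC -Ex_scale.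
apply: esum_Ex => [D t|t]; first by rewrite mulr_ge0.
have [tS|tS] := boolP (upd C t \in S).
  rewrite (esumID [set upd C t]) => [|D _]; last by rewrite lee_fin mulr_ge0.
  rewrite [X in (_ + X)%E]esum1 ?adde0 => [|D [_ /= /eqP]]; last first.
    by rewrite eq_sym => /negPf ->; rewrite mulr0.
  rewrite (_ : _ `&` _ = [set upd C t]); last first.
    by apply/seteqP; split => D /= => [[]//|->]; split => //; rewrite inE in tS.
  by rewrite esum_set1 ?eqxx ?mulr1// lee_fin.
rewrite esum1// => D SD; case: eqP => [tD|_]; last by rewrite mulr0.
by case/negP: tS; rewrite tD; exact/mem_set.
Qed.

(** A lower bound c on the k-step transition probability from C to D, tested on nonnegative
    functions so that such bounds compose through [iter] without sums over paths. *)
Definition reach k (c : R) C D := forall h, (forall E, 0 <= h E) -> c * h D <= iter k U h C.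

Lemma iterU_ge0 k C h : (forall E, 0 <= h E) -> 0 <= iter k U h C.
Proof. by move=> h0; elim: k C => [//|k IH] C /=; apply: U_ge0. Qed.

Lemma iterU_le k (C : config d) h h' : (forall D, #|` D| = #|` C| -> h D <= h' D) ->
  iter k U h C <= iter k U h' C.
Proof.
elim: k C => [|k IH] C hh /=; first exact: hh.
by apply: U_le => D /step_card sD; apply: IH => E; rewrite sD; exact: hh.
Qed.


Lemma reach_trans k l (a b : R) C D E : 0 <= a -> reach k a C D -> reach l b D E ->
  reach (k + l) (a * b) C E.
Proof.
move=> a0 CD DE h h0; rewrite iterD -mulrA.
apply: le_trans (CD _ _); first by rewrite ler_wpM2l// DE.
by move=> F; exact: iterU_ge0.
Qed.

Lemma reach_le k (a b : R) C D : a <= b -> reach k b C D -> reach k a C D.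
Proof. by move=> ab CD h h0; apply: le_trans (CD h h0); rewrite ler_wpM2r. Qed.

Lemma reach_path (ok : seq (lattice d) -> lattice d -> Prop) C (c : R) s : 0 <= c ->
  (forall t y, cvalid C t -> y \in chs C t -> (size t < 2 * m)%N -> ok t y -> c <= prb C t y) ->
  cpath ok C s -> size s = (2 * m)%N -> reach 1 (c ^+ (2 * m)) C (upd C s).
Proof.
move=> c0 hc ps s2m h h0; rewrite /= /U -s2m.
apply: Ex_ge_path ps _ _ => //; first by rewrite s2m.
Qed.

(** * Greedy paths and collapse *)

(** The first point is unconstrained because it is uniform in C; [collapse_step] uses this freedom
    to activate a point of its choice. *)
Definition nearest s y C := if s is x :: s' then
  forall z, z \in chs C s -> enorm R (last x s' - y) <= enorm R (last x s' - z) else True.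

Hypothesis beta_gt0 : 0 < beta.

(** A nearest site has maximal weight among the admissible ones, so the bound does not depend on the
    diameter of C. *)
Lemma reach_nearest C s : (m < #|` C|)%N ->
  cpath (fun t y => nearest t y C) C s -> size s = (2 * m)%N ->
  reach 1 ((3 ^ d * #|` C|)%:R^-1 ^+ (2 * m)) C (upd C s).
Proof.
move=> mC ps s2m; apply: reach_path ps s2m; first by rewrite invr_ge0.
move=> t y vt yt t2m yn; rewrite -[X in X^-1]mul1r.
apply: prb_ge => // [|z zt]; first exact: ltnW.
case: t yn zt {vt yt t2m} => [_ _|x t yn zt]; rewrite mul1r//=.
exact/phi_nearest/yn.
Qed.

Lemma nearest_ex C s (i0 : 'I_d) : (m < #|` C|)%N -> cvalid C s ->
  exists2 y, y \in chs C s & nearest s y C.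
Proof.
move=> mC vs; have [y0 y0C] := chs_neq0 i0 vs mC.
case: s vs y0C => [_|x s vs] y0C; first by exists y0.
pose f (y : chs C (x :: s)) := enorm R (last x s - val y).
exists (val [arg min_(y < [` y0C]%fset) f y]%O).
  by case: arg_minP => // i _ _; exact: fsvalP.
by case: arg_minP => // i _ hi z zC; exact: (hi [` zC]%fset).
Qed.

Lemma nearest_extend C s k (i0 : 'I_d) : (m < #|` C|)%N ->
  cpath (fun t y => nearest t y C) C s ->
  exists2 t, size t = k & cpath (fun t y => nearest t y C) C (s ++ t).
Proof.
move=> mC ps; elim: k => [|k [t st pt]]; first by exists [::] => //; rewrite cats0.
have [y yC yn] := nearest_ex i0 mC (cpath_cvalid pt).
by exists (rcons t y); rewrite ?size_rcons ?st// -rcons_cat; exact: cpath_rcons.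
Qed.

(** If the current point is within b of p and some admissible site is within B of p, the greedy
    choice is within d (b + B) of the current point; the factor d comes from choosing by Euclidean
    distance while measuring in the sup norm. *)
Definition spread (B : nat) k := iter k (fun b => b + d * (b + B))%N B.

Lemma spread_mono (B k l : nat) : (k <= l)%N -> (spread B k <= spread B l)%N.
Proof.
move=> /subnKC <-; elim: (l - k)%N => [|j IH]; first by rewrite addn0.
by rewrite addnS /= (leq_trans IH)// leq_addr.
Qed.

Lemma nearest_nth C s k z : cpath (fun t y => nearest t y C) C s -> (k.+1 < size s)%N ->
  z \in chs C (take k.+1 s) -> (nm (nth 0 s k - nth 0 s k.+1)%R <= d * nm (nth 0 s k - z)%R)%N.
Proof.
move=> ps ks zC; apply: (@nm_nearest R).
have : cpath (fun t y => nearest t y C) C (rcons (take k.+1 s) (nth 0 s k.+1)).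
  rewrite -take_nth//.
  by apply: (@cpath_cat _ _ _ (drop k.+2 s)); rewrite cat_take_drop.
case/cpath_rconsP => _ _; case: s ks zC {ps} => // x s ks zC /= /(_ z zC).
have -> : last x (take k s) = nth 0 (x :: s) k; last by [].
rewrite (last_nth 0) size_takel; last by move: ks => /=; lia.
case: k {zC} ks => [//|k] ks.
by rewrite /= nth_take.
Qed.

Lemma nearest_spread C s (B : nat) (p : lattice d) l :
  cpath (fun t y => nearest t y C) C s ->
  (forall k, (l < k < size s)%N -> exists2 z, z \in chs C (take k s) & (nm (z - p) <= B)%N) ->
  (nm (nth 0 s l - p)%R <= B)%N ->
  forall k, (l <= k < size s)%N -> (nm (nth 0 s k - p)%R <= spread B (k - l))%N.
Proof.
move=> ps hz hl; elim=> [|k IH].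
  by rewrite leqn0 => /andP[/eqP l0 _]; rewrite l0 in hl *.
rewrite leq_eqVlt => /andP[/predU1P[<- _|lk ks]]; first by rewrite subnn.
have {}IH : (nm (nth 0 s k - p)%R <= spread B (k - l))%N by apply: IH; lia.
rewrite subSn//=.
have [|z zC zp] := hz k.+1; first by rewrite lk.
have := nearest_nth ps ks zC.
have := nm_dist_trans (nth 0 s k) (nth 0 s k.+1) p.
have := nm_dist_trans p (nth 0 s k) z.
rewrite [nm (nth 0 s k.+1 - nth 0 s k)]nm_distC [nm (p - z)]nm_distC.
move=> h1 h2 h3.
apply: (leq_trans h2); rewrite addnC leq_add//; apply: (leq_trans h3).
by rewrite leq_mul2l (leq_trans h1) ?orbT// leq_add.
Qed.


Lemma card_upd_le C s : cvalid C s -> (size s <= 2 * m)%N -> (#|` upd C s| <= #|` C|)%N.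
Proof. by move=> /card_upd; move: (#|` _|) (#|` _|) (size s) => a b c; lia. Qed.

(** W is a tight subset with more than m points. The path starts at a point x1 outside W, if there
    is one, and continues greedily. Some w0 in W is not activated, so there are always admissible
    sites near it, and all deposits land near W. Replacing the activated points of W by the deposits
    gives W', and x1 has left the set of remote points. *)
Lemma collapse_step (B : nat) (i0 : 'I_d) : (0 < m)%N ->
  exists B' : nat, forall C W, (W `<=` C)%fset -> (m < #|` W|)%N -> (#|` C| <= 2 * m + 1)%N ->
    diam_le B W ->
    exists D W', [/\ reach 1 ((3 ^ d * (2 * m + 1))%:R^-1 ^+ (2 * m)) C D, #|` D| = #|` C|,
      (W' `<=` D)%fset, (#|` (D `\` W')%fset| <= #|` (C `\` W)%fset| - 1)%N & diam_le B' W'].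
Proof.
(* The extra 1 pays for a step from W to its boundary, and 2m+1 for the distance from w0 to a
   boundary site given by [near_bdry]. *)
move=> m0; have [Bo B1o Bmo] : exists2 Bo, (B.+1 <= Bo)%N & (2 * m + 1 <= Bo)%N.
  by exists (B.+1 + (2 * m + 1))%N; lia.
have Bo_ge := ltnW B1o; pose B1 := spread Bo (2 * m).
exists (2 * (B1 + Bo))%N => C W WC mW C2m dW.
have mC : (m < #|` C|)%N by rewrite (leq_trans mW)// fsubset_leq_card.
have [x1 x1C hx1] : exists2 x1, x1 \in C & (C `\` W)%fset != fset0 -> x1 \in (C `\` W)%fset.
  have [->|/fset0Pn[x xCW]] := eqVneq (C `\` W)%fset fset0.
    have /fset0Pn[x xC] : C != fset0 by rewrite -cardfs_gt0; lia.
    by exists x => //; rewrite eqxx.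
  by exists x => //; move: xCW; rewrite inE => /andP[].
have p1 : cpath (fun t y => nearest t y C) C [:: x1].
  apply: (@cpath_rcons _ _ [::]) => //; first exact: cpath_nil.
  by rewrite in_chs_lt ?x1C.
have [t st pt] := nearest_extend (2 * m - 1)%N i0 mC p1.
set s := [:: x1] ++ t in pt.
have s2m : size s = (2 * m)%N by rewrite /s/= st; lia.
have vs := cpath_cvalid pt.
have [us sC] := cvalid_take vs.
have stm : size (take m s) = m by rewrite size_takel// s2m; lia.
have x1s : x1 \in take m s by rewrite /s; case: (m) m0 => // k _; rewrite /= mem_head.
exists (upd C s).
pose W' := ([fset w in W | w \notin take m s] `|` [fset x in drop m s])%fset.
exists W'.
have W'P x : x \in W' = (x \in W) && (x \notin take m s) || (x \in drop m s).
  by rewrite !inE.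
have [w0 w0W w0s] : exists2 w, w \in W & w \notin take m s.
  apply: contrapT => nw; have : (size W <= size (take m s))%N.
    apply: uniq_leq_size => // w wW; apply: contraT => ws.
    by case: nw; exists w.
  by rewrite stm leqNgt mW.
have w0C : w0 \in C by exact: (fsubsetP WC).
have near k : (0 < k < size s)%N -> exists2 z, z \in chs C (take k s) & (nm (z - w0) <= Bo)%N.
  move=> /andP[k0 ks]; have sk : size (take k s) = k by rewrite size_takel// ltnW.
  have [km|mk] := ltnP k m.
    exists w0; last by rewrite subrr nm0.
    rewrite in_chs_lt ?sk// w0C; apply: contra w0s.
    by rewrite -(take_takel _ (ltnW km)); exact: mem_take.
  have w0U : w0 \in upd C (take k s) by rewrite in_upd take_takel// w0C w0s.
  have [z zb zw] := near_bdry R i0 w0U.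
  exists z; first by rewrite chs_ge ?sk.
  have vk : cvalid C (take k s) by apply: (@cpath_cat _ _ _ (drop k s)); rewrite cat_take_drop.
  apply: (leq_trans zw); apply: leq_trans Bmo; apply: leq_trans C2m.
  by apply: card_upd_le; rewrite // sk ltnW// -s2m.
(* The path is near W at some index l at most m. Otherwise all m activated points lie outside W;
   there are at most m such points, so exactly W remains, and the first deposit is adjacent to W. *)
have [l lm hl] : exists2 l, (l <= m)%N & (nm (nth 0 s l - w0)%R <= Bo)%N.
  have [[l lm xW]|nW] := pselect (exists2 l, (l < m)%N & nth 0 s l \in W).
    by exists l; [exact: ltnW|apply: leq_trans (dW _ _ xW w0W) _].
  exists m => //.
  have tW : {subset take m s <= (C `\` W)%fset}.
    move=> x xs; rewrite inE sC// andbT; apply/negP => xW; apply: nW.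
    have ix : (index x (take m s) < m)%N by rewrite -[X in (_ < X)%N]stm index_mem.
    by exists (index x (take m s)) => //; rewrite -(nth_take 0 ix) nth_index.
  have Wt : {subset (C `\` W)%fset <= take m s}.
    move=> x; rewrite (uniq_min_size us tW _).2//.
    have := cardfsID W C; rewrite (fsetIidPr WC) stm /=.
    by move: mW C2m; move: (#|` _|) (#|` _|) (#|` _|) => u v w; clear; lia.
  have : nth 0 s m \in chs C (take m s).
    have ms : (m < size s)%N by rewrite s2m mul2n -addnn -[ltnLHS]addn0 ltn_add2l.
    have : cvalid C (rcons (take m s) (nth 0 s m)).
      rewrite -take_nth//.
      by apply: (@cpath_cat _ _ _ (drop m.+1 s)); rewrite cat_take_drop.
    by case/cvalid_rcons.
  rewrite chs_ge ?stm// => /in_bdry[_ [y yU /nm_enorm1 xy]].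
  have yW : y \in W.
    move: yU; rewrite in_upd_le ?stm// => /andP[yC]; apply: contraNT => yW.
    by apply: Wt; rewrite inE yW.
  apply: leq_trans (nm_dist_trans y _ _) _.
  by apply: leq_trans (leq_add xy (dW _ _ yW w0W)) _.
have near_p x : x \in W' -> (nm (x - w0) <= B1 + Bo)%N.
  rewrite W'P => /orP[/andP[xW _]|xd].
    by apply: leq_trans (dW _ _ xW w0W) _; rewrite (leq_trans Bo_ge)// leq_addl.
  have ix : (index x (drop m s) < m)%N.
    by move: (xd); rewrite -index_mem size_drop s2m mul2n -addnn addnK.
  have -> : x = nth 0 s (m + index x (drop m s)) by rewrite -nth_drop nth_index.
  apply: leq_trans (nearest_spread pt _ hl _) _ => [k kl| |].
  - by apply: near; case/andP: kl => lk ->; rewrite andbT (leq_ltn_trans _ lk).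
  - by rewrite (leq_trans lm) ?leq_addr// s2m mul2n -addnn ltn_add2l.
  - apply: leq_trans (spread_mono _ _) (leq_addr _ _).
    by rewrite (leq_trans (leq_subr _ _))// mul2n -addnn leq_add2l ltnW.
split.
- apply: reach_le (reach_nearest mC pt s2m).
  rewrite lerXn2r ?nnegrE ?invr_ge0//.
  rewrite lef_pV2 ?posrE ?ltr0n ?muln_gt0 ?expn_gt0 ?addn1//=; last exact: leq_ltn_trans mC.
  by rewrite ler_nat leq_mul2l -[(2 * m).+1]addn1 C2m orbT.
- exact: card_upd2m.
- apply/fsubsetP => x; rewrite W'P in_upd => /orP[/andP[xW ->]|->]; last by rewrite orbT.
  by rewrite (fsubsetP WC).
- have sub : (upd C s `\` W' `<=` (C `\` W) `\ x1)%fset.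
    apply/fsubsetP => x; rewrite in_fsetD W'P negb_or => /andP[/andP[xW xd]].
    rewrite in_upd (negPf xd) orbF => /andP[xC xs].
    rewrite !inE xC andbT; move: xW; rewrite xs andbT => ->; rewrite andbT.
    by apply: contraNneq xs => ->.
  apply: leq_trans (fsubset_leq_card sub) _.
  have [->|ne] := eqVneq (C `\` W)%fset fset0; first by rewrite fset0D cardfs0.
  by rewrite (cardfsD1 x1 (C `\` W)%fset) hx1// addKn.
- move=> x y /near_p xp /near_p; rewrite nm_distC => yp.
  by apply: leq_trans (nm_dist_trans w0 _ _) _; rewrite mul2n -addnn leq_add.
Qed.

Lemma cvalid_prefix C s k : cvalid C s -> cvalid C (take k s).
Proof. by move=> vs; apply: (@cpath_cat _ _ _ (drop k s)); rewrite cat_take_drop. Qed.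

Lemma cvalid_nth C s k : cvalid C s -> (k < size s)%N -> nth 0 s k \in chs C (take k s).
Proof.
move=> vs ks; have := cvalid_prefix k.+1 vs; rewrite (take_nth 0)//.
by case/cvalid_rcons.
Qed.

Lemma cvalid_drop_uniq C s : cvalid C s -> uniq (drop m s).
Proof.
elim=> {s}[//|s y vs IH yC _].
have [sm|sm] := leqP m (size s); last by rewrite drop_oversize// size_rcons.
rewrite drop_rcons// rcons_uniq IH andbT.
by move: yC; rewrite chs_ge// => /in_bdry[+ _]; rewrite in_upd negb_or => /andP[_ ->].
Qed.

(** The first deposit is adjacent to a retained point p. As p stays in place, the later deposits
    remain near p, and p together with the m deposits is a tight set of m+1 points. *)
Lemma collapse_start (i0 : 'I_d) : (0 < m)%N ->
  exists B' : nat, forall C, (m < #|` C|)%N -> (#|` C| <= 2 * m + 1)%N ->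
    exists D (W' : config d), [/\ reach 1 ((3 ^ d * (2 * m + 1))%:R^-1 ^+ (2 * m)) C D, #|` D| = #|` C|,
      (W' `<=` D)%fset, (m < #|` W'|)%N & diam_le B' W'].
Proof.
move=> m0; pose Bo := (2 * m + 1)%N; pose B1 := spread Bo m.
exists (2 * B1)%N => C mC C2m.
have [s s2m ps] := nearest_extend (2 * m)%N i0 mC (cpath_nil _ C).
rewrite cat0s in ps; have vs := cpath_cvalid ps.
have ms : (m < size s)%N by rewrite s2m mul2n -addnn -[X in (X < _)%N]addn0 ltn_add2l.
have stm : size (take m s) = m by rewrite size_takel// ltnW.
have := cvalid_nth vs ms; rewrite chs_ge ?stm// => /in_bdry[_ [p pU /nm_enorm1 xp]].
have pk k : (m <= k)%N -> p \in upd C (take k s).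
  move=> mk; rewrite -(cat_take_drop m (take k s)) take_takel// upd_sub// stm//.
have near k : (m < k < size s)%N -> exists2 z, z \in chs C (take k s) & (nm (z - p) <= Bo)%N.
  move=> /andP[mk ks]; have sk : size (take k s) = k by rewrite size_takel// ltnW.
  have [z zb zw] := near_bdry R i0 (pk _ (ltnW mk)).
  exists z; first by rewrite chs_ge ?sk// ltnW.
  apply: (leq_trans zw); apply: leq_trans C2m.
  by apply: card_upd_le; [exact: cvalid_prefix|rewrite sk ltnW// -s2m].
have Bo0 : (1 <= Bo)%N by rewrite /Bo addn1.
have near_p x : x \in (p |` [fset y in drop m s])%fset -> (nm (x - p) <= B1)%N.
  rewrite in_fsetU in_fset1 in_fset => /predU1P[->|xd]; first by rewrite subrr nm0.
  have ix : (index x (drop m s) < m)%N.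
    by move: (xd); rewrite -index_mem size_drop s2m mul2n -addnn addnK.
  have -> : x = nth 0 s (m + index x (drop m s)) by rewrite -nth_drop nth_index.
  apply: leq_trans (nearest_spread ps near (leq_trans xp Bo0) _) _.
    by rewrite leq_addr s2m mul2n -addnn ltn_add2l.
  by rewrite spread_mono// addKn ltnW.
exists (upd C s), (p |` [fset y in drop m s])%fset; split.
- apply: reach_le (reach_nearest mC ps s2m).
  rewrite lerXn2r ?nnegrE ?invr_ge0//.
  rewrite lef_pV2 ?posrE ?ltr0n ?muln_gt0 ?expn_gt0 ?addn1//=; last exact: leq_ltn_trans mC.
  by rewrite ler_nat leq_mul2l -[(2 * m).+1]addn1 C2m orbT.
- exact: card_upd2m.
- apply/fsubsetP => x; rewrite in_fsetU in_fset1 in_fset => /predU1P[->|xd].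
    by rewrite -(cat_take_drop m s) upd_sub ?stm// pk.
  by rewrite in_upd xd orbT.
- rewrite cardfsU1 in_fset card_fseq undup_id ?(cvalid_drop_uniq vs)//.
  rewrite (@upd_notin C (take m s)) ?cat_take_drop ?stm ?pk// size_drop s2m.
  by rewrite mul2n -addnn addnK.
- move=> x y /near_p xp' /near_p; rewrite nm_distC => yp.
  by apply: leq_trans (nm_dist_trans p _ _) _; rewrite mul2n -addnn leq_add.
Qed.

(** The starting step leaves at most (2m+1) - (m+1) = m remote points, and each of m further steps
    absorbs at least one. *)
Lemma collapse_all (i0 : 'I_d) : (0 < m)%N ->
  exists (B : nat) (c : R), 0 < c /\ forall C, (m < #|` C|)%N -> (#|` C| <= 2 * m + 1)%N ->
    exists D, [/\ reach m.+1 c C D, #|` D| = #|` C| & diam_le B D].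
Proof.
move=> m0; pose c0 : R := (3 ^ d * (2 * m + 1))%:R^-1 ^+ (2 * m).
have c00 : 0 < c0 by rewrite exprn_gt0// invr_gt0 ltr0n muln_gt0 expn_gt0 addn1.
suff H j : exists (B : nat), forall C, (m < #|` C|)%N -> (#|` C| <= 2 * m + 1)%N ->
    exists D (W : config d), [/\ reach j.+1 (c0 ^+ j.+1) C D, #|` D| = #|` C|, (W `<=` D)%fset,
      (m < #|` W|)%N /\ (#|` (D `\` W)%fset| <= m - j)%N & diam_le B W].
  have [B hB] := H m; exists B, (c0 ^+ m.+1); split; first by rewrite exprn_gt0.
  move=> C mC C2m; have [D [W [CD cD WD [_ cW] dW]]] := hB C mC C2m.
  exists D; split=> //; rewrite (_ : D = W)//; apply/eqP; rewrite eqEfsubset WD andbT.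
  by rewrite -fsetD_eq0 -cardfs_eq0 -leqn0 (leq_trans cW)// subnn.
elim: j => [|j [B hB]].
  have [B hB] := collapse_start i0 m0; exists B => C mC C2m.
  have [D [W [CD cD WD mW dW]]] := hB C mC C2m.
  exists D, W; split=> //; split=> //; have := cardfsID W D; rewrite (fsetIidPr WD) cD.
  by move: mW C2m; move: (#|` _|) (#|` _|) (#|` _|) => u v w; clear; lia.
have [B' hB'] := collapse_step B i0 m0; exists B' => C mC C2m.
have [D [W [CD cD WD [mW cW] dW]]] := hB C mC C2m.
have C2m' := C2m; rewrite -cD in C2m'.
have [E [V [DE cE VE cV dV]]] := hB' D W WD mW C2m' dW.
exists E, V; split => //; last 2 first.
- by rewrite cE cD.
- have := cardfsID W D; have := cardfsID V E; rewrite (fsetIidPr WD) (fsetIidPr VE) cE.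
  move: cV mW cW; move: (#|` V|) (#|` (E `\` V)%fset|) (#|` W|) (#|` (D `\` W)%fset|) (#|` D|) => a b c e f; lia.
by rewrite exprSr -addn1; apply: reach_trans DE; rewrite ?exprn_ge0 ?ltW.
Qed.

(** All choices stay within m of C, so consecutive ones are at Euclidean distance at most r, and
    every weight lies between r^(-beta) and 1. Hence every admissible path, greedy or not, has
    probability bounded below. *)
Lemma reach_bounded (N B : nat) : exists2 c : R, 0 < c & forall C s,
  (m < #|` C|)%N -> (#|` C| <= N)%N -> diam_le B C -> cvalid C s -> size s = (2 * m)%N ->
  reach 1 c C (upd C s).
Proof.
pose r : R := d%:R * (m + (B + m))%:R + 1.
have r1 : 1 <= r by rewrite lerDr mulr_ge0.
pose c : R := (r `^ (- beta))^-1.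
have r0 := lt_le_trans ltr01 r1.
have c0 : 0 < c by rewrite invr_gt0 powR_gt0.
have N0 : 0 < 3 ^+ d * (N.+1)%:R :> R by rewrite mulr_gt0 ?exprn_gt0.
exists ((c * (3 ^+ d * N.+1%:R))^-1 ^+ (2 * m)); first by rewrite exprn_gt0// invr_gt0 mulr_gt0.
move=> C s mC CN dC vs s2m.
apply: reach_path vs s2m; first by rewrite invr_ge0 ltW// mulr_gt0.
move=> t y vt yt t2m _.
apply: le_trans (prb_ge vt (ltnW t2m) yt c0 _); last first.
  move=> z zt; apply: (@le_trans _ _ 1).
    by case: (t) => // x t'; exact: phi_le1.
  have ct0 : 1 <= c * 1.
    rewrite mulr1 invr_ge1 ?unitfE ?gt_eqF ?powR_gt0//.
    by rewrite -[X in _ <= X](powRr0 r) ler_powR// oppr_le0 ltW.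
  case: t vt yt t2m zt => [//|x t] vt yt t2m zt.
  rewrite -ler_pdivrMl// mulr1 invrK; apply: phi_ge => //.
  have vty : cvalid C (rcons (x :: t) y) by exact/cvalid_rcons.
  have nr := cvalid_near vty.
  have [|a aC xa] := nr (last x t); first by rewrite mem_rcons inE mem_last orbT.
  have [|b bC yb] := nr y; first by rewrite mem_rcons mem_head.
  apply: le_trans (enorm_le_nm _ _) _; rewrite -[leLHS]addr0 lerD// ler_wpM2l// ler_nat.
  have sm : (size (rcons (x :: t) y) - m <= m)%N by rewrite size_rcons leq_subLR addnn -mul2n.
  apply: leq_trans (nm_dist_trans a _ _) _; rewrite leq_add ?(leq_trans xa)//.
  apply: leq_trans (nm_dist_trans b _ _) _; rewrite leq_add ?dC// nm_distC.
  exact: leq_trans yb sm.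
rewrite lef_pV2 ?posrE ?mulr_gt0 ?ltr0n ?muln_gt0 ?expn_gt0 ?(leq_ltn_trans _ mC)//.
by rewrite ler_pM2l// natrM natrX ler_pM2l ?exprn_gt0// ler_nat ltnW.
Qed.

Lemma step_diam (B : nat) C D : diam_le B C -> step C D -> diam_le (m + (B + m)) D.
Proof.
move=> dC /step_near nr x y /nr[a aC xa] /nr[b bC]; rewrite nm_distC => yb.
apply: leq_trans (nm_dist_trans a _ _) _; rewrite leq_add//.
by apply: leq_trans (nm_dist_trans b _ _) _; rewrite leq_add ?dC.
Qed.

(** * Doeblin condition *)

Lemma cvalid_seq C s : uniq s -> {subset s <= C} -> (size s <= m)%N -> cvalid C s.
Proof.
elim/last_ind: s => [_ _ _|s y IH]; first exact: cpath_nil.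
rewrite rcons_uniq size_rcons => /andP[ys us] sC sm; apply/cvalid_rcons; split.
  by apply: IH => //; [move=> x xs; apply: sC; rewrite mem_rcons inE xs orbT|exact: ltnW].
by rewrite in_chs_lt// ys sC// mem_rcons mem_head.
Qed.

(* The points outside K are moved one by one to the ray starting from y. *)
Lemma grow C (K : config d) (i : 'I_d) y : (K `<=` C)%fset -> (#|` K| + m = #|` C|)%N ->
  y \in K -> (forall k, (0 < k <= m)%N -> y + dir i *+ k \notin K) ->
  exists s, [/\ cvalid C s, size s = (2 * m)%N & upd C s = (K `|` ray i y 1 m)%fset].
Proof.
move=> KC cK yK free; pose r : seq (lattice d) := (C `\` K)%fset.
have sr : size r = m.
  have := cardfsID K C; rewrite (fsetIidPr KC) -cK => /eqP; rewrite eqn_add2l => /eqP <-.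
  by [].
have vr : cvalid C r.
  by apply: cvalid_seq; rewrite ?fset_uniq ?sr// => x; rewrite inE => /andP[].
have H j : (j <= m)%N -> cvalid C (r ++ [seq y + dir i *+ k | k <- iota 1 j]) /\
    upd C (r ++ [seq y + dir i *+ k | k <- iota 1 j]) = (K `|` ray i y 1 j)%fset.
  elim: j => [_|j IH jm].
    rewrite cats0; split => //; apply/fsetP => x; rewrite in_upd_le ?sr// in_fsetD in_fsetU.
    rewrite negb_and negbK andb_orr andbN orbF.
    have -> : (x \in ray i y 1 0) = false by apply/negP => /rayP[k]; lia.
    rewrite orbF; apply/andP/idP => [[]//|xK]; split=> //; exact: (fsubsetP KC).
  have [v E] := IH (ltnW jm).
  have -> : iota 1 j.+1 = rcons (iota 1 j) j.+1 by rewrite -cats1 -(addn1 j) iotaD /= add1n addn1.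
  rewrite map_rcons -rcons_cat.
  have yU : y + dir i *+ j.+1 \in bdry R (K `|` ray i y 1 j)%fset.
    rewrite mulrSr addrA; apply: bdry_dir.
      rewrite in_fsetU; case: j {IH E v jm} => [|j]; first by rewrite mulr0n addr0 yK.
      by apply/orP; right; apply/rayP; exists j.+1 => //; lia.
    rewrite -addrA -mulrSr in_fsetU negb_or free//=.
    by apply/negP => /rayP[k kj /dir_inj jk]; lia.
  split.
    by apply/cvalid_rcons; split=> //; rewrite chs_ge ?size_cat ?sr ?leq_addr// E.
  have -> : ray i y 1 j.+1 = (ray i y 1 j `|` ray i y (1 + j) 1)%fset by rewrite rayU addn1.
  rewrite upd_rcons ?size_cat ?sr ?leq_addr// E [RHS]fsetUA [RHS]fsetUC; congr fsetU.
  apply/fsetP => x; rewrite in_fset1; apply/eqP/rayP => [->|[k kj ->]].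
    by exists j.+1 => //; lia.
  by have -> : k = j.+1 by lia.
have [v E] := H m (leqnn m).
exists (r ++ [seq y + dir i *+ k | k <- iota 1 m]); split=> //.
by rewrite size_cat size_map size_iota sr mul2n addnn.
Qed.

Lemma subset_containing C y : y \in C -> (m < #|` C|)%N ->
  exists K : config d, [/\ (K `<=` C)%fset, (#|` K| + m = #|` C|)%N & y \in K].
Proof.
move=> yC mC; pose r := take m (C `\ y)%fset.
have cy : #|` C| = (#|` (C `\ y)%fset|).+1 by rewrite (cardfsD1 y) yC.
have sr : size r = m by rewrite size_takel// -ltnS -cy.
have ur : uniq r by apply: take_uniq; exact: fset_uniq.
have rC x : x \in r -> x != y /\ x \in C by move=> /mem_take; rewrite in_fsetD1 => /andP[].
exists (C `\` [fset x in r])%fset; split.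
- exact: fsubsetDl.
- have := cardfsID [fset x in r]%fset C; rewrite (fsetIidPr _).
    by rewrite card_fseq undup_id// sr addnC.
  by apply/fsubsetP => x; rewrite in_fset => /rC[].
- by rewrite in_fsetD in_fset yC andbT; apply/negP => /rC[]; rewrite eqxx.
Qed.

(** The first step grows m points in front of y, which gives a segment of m+1 points. The second
    keeps its last #|C| - m points, starting at offset 2m+1 - #|C|, and moves all others to its
    front end. *)
Lemma reach_line2 (i0 : 'I_d) (N B : nat) : exists2 c : R, 0 < c & forall C y, (m < #|` C|)%N ->
  (#|` C| <= 2 * m + 1)%N -> diam_le B C -> y \in C ->
  (forall k, (0 < k <= m)%N -> y + dir i0 *+ k \notin C) ->
  reach 2 c C (line i0 (y + dir i0 *+ (2 * m + 1 - #|` C|)) #|` C|).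
Proof.
have [c1 c10 h1] := reach_bounded (2 * m + 1) B.
have [c2 c20 h2] := reach_bounded (2 * m + 1) (m + (B + m)).
exists (c1 * c2) => [|C y mC C2m dC yC free]; first exact: mulr_gt0.
have [K [KC cK yK]] := subset_containing yC mC.
have [|s [vs s2m Es]] := @grow C K i0 y KC cK yK.
  by move=> k km; apply: contra (free _ km); exact: (fsubsetP KC).
set C1 := (K `|` ray i0 y 1 m)%fset in Es.
have sC : step C C1 by exists s; rewrite ?Es.
have cC1 := step_card sC.
set a := (2 * m + 1 - #|` C|)%N; set j := #|` C| in cC1 mC C2m cK a *.
have KC1 : (ray i0 y a (j - m) `<=` C1)%fset.
  apply/fsubsetP => x /rayP[k kj ->]; rewrite in_fsetU; case: k kj => [|k] kj.
    by rewrite mulr0n addr0 yK.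
  by apply/orP; right; apply/rayP; exists k.+1 => //; lia.
have := @grow C1 (ray i0 y a (j - m)) i0 (y + dir i0 *+ m) KC1 _ _ _.
rewrite card_ray cC1 subnK ?(ltnW mC)// => /(_ erefl).
case.
- by apply/rayP; exists m => //; lia.
- by move=> k km; apply/negP => /rayP[l lj]; rewrite -addrA -mulrnDr => /dir_inj; lia.
move=> t [vt t2m Et].
have -> : line i0 (y + dir i0 *+ a) j = upd C1 t.
  rewrite Et /line !rayD addn0; have -> : (m + 1 = a + (j - m))%N by lia.
  by rewrite rayU subnK// ltnW.
rewrite -[2%N]/(1 + 1)%N; apply: (@reach_trans _ _ _ _ _ C1); first exact: ltW.
  by rewrite -Es; exact: h1.
by apply: h2; rewrite ?cC1//; exact: step_diam sC.
Qed.

(** Keep #|C| - m consecutive points of the segment, starting at offset r, and regrow the m others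
    in front of them. *)
Lemma reach_slide (i0 : 'I_d) : exists2 c : R, 0 < c & forall p j r, (m < j)%N ->
  (j <= 2 * m + 1)%N -> (r <= m)%N ->
  reach 1 c (line i0 p j) (line i0 (p + dir i0 *+ r) j).
Proof.
have [c c0 h] := reach_bounded (2 * m + 1) (2 * m + 1).
exists c => // p j r mj j2m rm.
have := @grow (line i0 p j) (ray i0 p r (j - m)) i0 (p + dir i0 *+ (j - m + r - 1)) _ _ _ _.
rewrite !card_ray subnK ?(ltnW mj)// => /(_ _ erefl); case.
- by apply/fsubsetP => x /rayP[k kj ->]; apply/rayP; exists k => //; lia.
- by apply/rayP; exists (j - m + r - 1)%N => //; lia.
- by move=> k km; apply/negP => /rayP[l lj]; rewrite -addrA -mulrnDr => /dir_inj; lia.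
move=> t [vt t2m Et].
have -> : line i0 (p + dir i0 *+ r) j = upd (line i0 p j) t.
  rewrite Et /line !rayD addn0; have -> : (j - m + r - 1 + 1 = r + (j - m))%N by lia.
  by rewrite rayU subnK// ltnW.
apply: h => //; rewrite ?card_ray//.
by move=> x y xl yl; apply: leq_trans (diam_ray xl yl) _.
Qed.

(** Both values of r must take the same number of steps and end with the same offset along i0. For r
    = 1, grow m points in direction i and then straighten from the first of them; for r = 0, slide
    by that offset and then twice by zero. *)
Lemma reach_shift (i0 i : 'I_d) : (0 < m)%N -> i != i0 -> exists2 c : R, 0 < c &
  forall p j (r : bool), (m < j)%N -> (j <= 2 * m + 1)%N ->
  reach 3 c (line i0 p j) (line i0 (p + dir i *+ r + dir i0 *+ (2 * m + 1 - j)) j).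
Proof.
move=> m0 ii0; have [c1 c10 h1] := reach_slide i0.
have [c2 c20 h2] := reach_line2 i0 (2 * m + 1) (m + ((2 * m + 1) + m)).
have [c3 c30 h3] := reach_bounded (2 * m + 1) (2 * m + 1).
exists (Num.min (c1 * (c1 * c1)) (c3 * c2)); first by rewrite lt_min !mulr_gt0.
move=> p j r mj j2m; have dl : diam_le (2 * m + 1) (line i0 p j).
  by move=> x y xl yl; apply: leq_trans (diam_ray xl yl) _.
case: r; last first.
  apply: (@reach_le _ _ (c1 * (c1 * c1))); first by rewrite ge_min lexx.
  rewrite mulr0n addr0; rewrite -[3%N]/(1 + (1 + 1))%N.
  apply: (reach_trans (ltW c10) (h1 p j (2 * m + 1 - j)%N _ _ _)) => //; first by lia.
  set q := (p + _); have := h1 q j 0%N mj j2m (leq0n _); rewrite mulr0n addr0 => hq.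
  exact (reach_trans (ltW c10) hq hq).
apply: (@reach_le _ _ (c3 * c2)); first by rewrite ge_min lexx orbT.
have := @grow (line i0 p j) (line i0 p (j - m)) i p _ _ _ _.
rewrite !card_ray subnK ?(ltnW mj)// => /(_ _ erefl); case.
- by apply/fsubsetP => x /rayP[k kj ->]; apply/rayP; exists k => //; lia.
- by apply/rayP; exists 0%N; [lia|rewrite mulr0n addr0].
- move=> k km; apply/negP => /rayP[l lj] /addrI/rowP/(_ i); rewrite !dirE eqxx (negPf ii0); lia.
move=> t [vt t2m Et].
set C1 := (_ `|` _)%fset in Et.
have sC : step (line i0 p j) C1 by exists t; rewrite ?Et.
have cC1 : #|` C1| = j by rewrite (step_card sC) card_ray.
rewrite -[3%N]/(1 + 2)%N; apply: (@reach_trans _ _ _ _ _ C1); first exact: ltW.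
  by rewrite -Et; apply: h3; rewrite ?card_ray.
have := h2 C1 (p + dir i *+ true); rewrite cC1; apply => //.
- exact: step_diam sC.
- by rewrite in_fsetU; apply/orP; right; apply/rayP; exists 1%N => //; lia.
move=> k km; rewrite in_fsetU negb_or; apply/andP; split; apply/negP => /rayP[l lj];
  rewrite -addrA => /addrI/rowP E.
  by have := E i; rewrite mxE !dirE eqxx (negPf ii0); lia.
by have := E i0; rewrite mxE !dirE eqxx eq_sym (negPf ii0); lia.
Qed.

(** m+1 steps to collapse, 2 to straighten, 3 for each of the shifts along i1 and i2, and 1 for the
    slide along i0. *)
Definition mixing_time := (m + 10)%N.

Lemma doeblin (i0 i1 i2 : 'I_d) : (0 < m)%N -> i1 != i0 -> i2 != i0 ->
  exists2 c : R, 0 < c & forall C, (m < #|` C|)%N -> (#|` C| <= 2 * m + 1)%N ->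
  exists p, forall r0 r1 r2 : bool, reach mixing_time c C
    (line i0 (p + dir i0 *+ r0 + dir i1 *+ r1 + dir i2 *+ r2) #|` C|).
Proof.
move=> m0 i10 i20.
have [B [c0 [c00 h0]]] := collapse_all i0 m0.
have [c1 c10 h1] := reach_line2 i0 (2 * m + 1) B.
have [c2 c20 h2] := reach_shift m0 i10.
have [c3 c30 h3] := reach_shift m0 i20.
have [c4 c40 h4] := reach_slide i0.
exists (c0 * (c1 * (c2 * (c3 * c4)))) => [|C mC C2m]; first by rewrite !mulr_gt0.
have [D [CD cD dD]] := h0 C mC C2m.
(* A point with maximal coordinate along i0 has a free ray in front of it, as [reach_line2]
   requires. *)
have [y yD ymax] : exists2 y, y \in D & forall x, x \in D -> x 0 i0 <= y 0 i0.
  have /fset0Pn[y0 y0D] : D != fset0 by rewrite -cardfs_gt0 cD (leq_ltn_trans _ mC).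
  pose f (x : D) := (val x) 0 i0.
  exists (val [arg max_(y > [` y0D]%fset) f y]%O).
    by case: arg_maxP => // i _ _; exact: fsvalP.
  by case: arg_maxP => // i _ hi z zC; exact: (hi [` zC]%fset).
have := h1 D y; rewrite cD => /(_ mC C2m dD yD) DL.
set q := (2 * m + 1 - #|` C|)%N in DL *.
(* One offset q comes from [reach_line2] and one from each use of [reach_shift]. *)
exists (y + dir i0 *+ q + dir i0 *+ q + dir i0 *+ q) => r0 r1 r2.
have -> : (mixing_time = m.+1 + (2 + (3 + (3 + 1))))%N by rewrite /mixing_time; clear; lia.
apply: (reach_trans (ltW c00) CD).
apply: (reach_trans (ltW c10)).
  apply: DL => k km; apply/negP => /ymax; rewrite mxE dirE eqxx mul1n gerDl; lia.
apply: (reach_trans (ltW c20) (h2 _ _ r1 mC C2m)).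
apply: (reach_trans (ltW c30) (h3 _ _ r2 mC C2m)).
have := h4 (y + dir i0 *+ q + dir i1 *+ r1 + dir i0 *+ q + dir i2 *+ r2 + dir i0 *+ q) _ r0 mC C2m.
rewrite (leq_trans (leq_b1 _))// => /(_ isT).
congr (reach _ _ _ (line _ _ _)).
move: (dir i0 *+ q) (dir i0 *+ r0) (dir i1 *+ r1) (dir i2 *+ r2) => a b c e.
by apply/rowP => l; rewrite !mxE; ring.
Qed.

(** * Convergence for small configurations *)

Lemma in_hat C : hat C C.
Proof. by exists 0; rewrite translate0. Qed.

Lemma hat_translate C z : hat (translate C z) = hat C.
Proof.
apply/seteqP; split => D [x xE].
  by exists (x - z); rewrite -translateD -xE translateD subrr translate0.
by exists (x + z); rewrite -translateD -xE.
Qed.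

Lemma hat_eqP C D : hat C = hat D <-> exists x, D = translate C x.
Proof.
split=> [CD|[x ->]]; last by rewrite hat_translate.
have := in_hat D; rewrite -CD => -[x ->].
by exists (- x); rewrite translateD subrr translate0.
Qed.

Lemma iterU_lin k C (a : R) h h' :
  iter k U (fun D => a * h D + h' D) C = a * iter k U h C + iter k U h' C.
Proof.
elim: k C => [//|k IH] C /=; rewrite -U_lin; apply: U_ext => D; exact: IH.
Qed.

Lemma iterU_eq k C h h' : (forall D, #|` D| = #|` C| -> h D = h' D) ->
  iter k U h C = iter k U h' C.
Proof.
by move=> hh; apply/eqP; rewrite eq_le !iterU_le// => D DC; rewrite hh.
Qed.

Lemma U_cst C (a : R) (i0 : 'I_d) : (m < #|` C|)%N -> U (fun=> a) C = a.
Proof.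
move=> mC; rewrite (@U_ext _ _ (fun=> a * 1)) => [|D]; last by rewrite mulr1.
by rewrite /U Ex_scale (Ex1 _ i0) ?mulr1//; exact: cpath_nil.
Qed.

Lemma iterU_cst k C (a : R) (i0 : 'I_d) : (m < #|` C|)%N -> iter k U (fun=> a) C = a.
Proof.
elim: k C => [//|k IH] C mC /=; rewrite -[RHS](U_cst a i0 mC).
by apply/eqP; rewrite eq_le !U_le// => D /step_card DC; rewrite IH// DC.
Qed.

Lemma iterU_sum k C (T : choiceType) (r : seq T) (f : T -> config d -> R) (i0 : 'I_d) :
  (m < #|` C|)%N ->
  iter k U (fun D => \sum_(i <- r) f i D) C = \sum_(i <- r) iter k U (f i) C.
Proof.
move=> mC; elim: r => [|x r IH].
  rewrite big_nil -[RHS](iterU_cst k 0 i0 mC).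
  by apply: iterU_eq => D _; rewrite big_nil.
rewrite big_cons -IH -[iter k U (f x) C]mul1r -iterU_lin.
by apply: iterU_eq => D _; rewrite big_cons mul1r.
Qed.

Definition hat_inv (h : config d -> R) := forall C z, h (translate C z) = h C.

Lemma hat_invE h C D : hat_inv h -> hat C = hat D -> h C = h D.
Proof. by move=> hi /hat_eqP[x ->]. Qed.

Lemma iterU_hat_inv k h : hat_inv h -> hat_inv (iter k U h).
Proof.
move=> hi; elim: k => [//|k IH] C z /=; rewrite U_translate.
by apply: U_ext => D; exact: IH.
Qed.

Lemma esum_iterU (T : choiceType) (S : set T) k C (f : T -> config d -> R) g :
  (forall i D, 0 <= f i D) ->
  (forall D, \esum_(i in S) (f i D)%:E = (g D)%:E)%E ->
  (\esum_(i in S) (iter k U (f i) C)%:E = (iter k U g C)%:E)%E.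
Proof.
move=> f0 fg; elim: k C => [//|k IH] C /=.
by apply: esum_Ex => [i t|t]; [exact: iterU_ge0|exact: IH].
Qed.

Section Ergodic.
Variables (n : nat) (c : R) (i0 : 'I_d).
Hypothesis mn : (m < n)%N.
Hypothesis c01 : 0 < c <= 1.
Hypothesis reach_line : forall C, #|` C| = n ->
  exists p, reach mixing_time c C (line i0 p n).

Let rho := 1 - c.
Let N := mixing_time.
Let rho0 : 0 <= rho. Proof. by rewrite subr_ge0; case/andP: c01. Qed.
Let rho1 : rho < 1. Proof. by rewrite ltrBlDr ltrDl; case/andP: c01. Qed.

(** Apply the reachability bound to h - a and to b - h. Both conclusions contain the same term c
    h(line), independent of C because h is translation invariant, so the length of the enclosing
    interval shrinks by the factor 1 - c. *)
Lemma contract h (a b : R) : hat_inv h -> (forall D, #|` D| = n -> a <= h D <= b) ->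
  forall C, #|` C| = n ->
  rho * a + c * h (line i0 0 n) <= iter N U h C <= rho * b + c * h (line i0 0 n).
Proof.
move=> hi hab C cC; have [p /= rp] := reach_line cC.
have mC : (m < #|` C|)%N by rewrite cC.
have hL : h (line i0 p n) = h (line i0 0 n) by rewrite line_translate hi.
have cL : #|` line i0 p n| = n by rewrite card_ray.
have key (s : R) (e : R) : (forall D, #|` D| = n -> 0 <= s * h D + e) ->
    c * (s * h (line i0 0 n) + e) <= s * iter N U h C + e.
  move=> h0; have := rp (fun D => if #|` D| == n then s * h D + e else 0) _.
  rewrite cL eqxx hL => /(_ _)/le_trans; apply.
    by move=> D; case: eqP => // /h0.
  rewrite (@iterU_eq _ _ _ (fun D => s * h D + e)) => [|D]; last by rewrite cC => ->; rewrite eqxx.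
  by rewrite iterU_lin iterU_cst.
have k1 := key 1 (- a); have k2 := key (- 1) b.
apply/andP; split.
  have := k1 _; rewrite !mul1r => /(_ _)k1'; rewrite /rho.
  suff : c * (h (line i0 0 n) - a) <= iter N U h C - a by lra.
  by apply: k1' => D /hab/andP[+ _]; rewrite mul1r subr_ge0.
suff : c * (- 1 * h (line i0 0 n) + b) <= - 1 * iter N U h C + b by rewrite /rho; lra.
by apply: k2 => D /hab/andP[_]; rewrite mulN1r addrC subr_ge0.
Qed.

Lemma contract_iter h k : hat_inv h -> (forall D, #|` D| = n -> 0 <= h D <= 1) ->
  exists a b, b - a = rho ^+ k /\
    forall t C, (k * N <= t)%N -> #|` C| = n -> a <= iter t U h C <= b.
Proof.
move=> hi h01; elim: k => [|k [a [b [ba H]]]].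
  exists 0, 1; split; first by rewrite subr0 expr0.
  move=> t C _ cC; have mC : (m < #|` C|)%N by rewrite cC.
  apply/andP; split.
    rewrite -(iterU_cst t 0 i0 mC); apply: iterU_le => D; rewrite cC => /h01.
    by case/andP.
  rewrite -[leRHS](iterU_cst t 1 i0 mC); apply: iterU_le => D; rewrite cC => /h01.
  by case/andP.
pose h' := iter (k * N) U h; have hi' : hat_inv h' by exact: iterU_hat_inv.
pose v := h' (line i0 0 n).
exists (rho * a + c * v), (rho * b + c * v); split.
  by rewrite exprS -ba; ring.
move=> t C kt cC; have mC : (m < #|` C|)%N by rewrite cC.
have H' D : #|` D| = n -> rho * a + c * v <= iter N U h' D <= rho * b + c * v.
  by apply: contract => // E cE; exact: H.
have -> : iter t U h C = iter (t - k.+1 * N) U (iter N U h') C.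
  by rewrite -!iterD; congr (iter _ _ _ _); rewrite mulSn in kt *; lia.
apply/andP; split.
  rewrite -[leLHS](iterU_cst (t - k.+1 * N) _ i0 mC); apply: iterU_le => D; rewrite cC => /H'.
  by case/andP.
rewrite -[leRHS](iterU_cst (t - k.+1 * N) _ i0 mC); apply: iterU_le => D; rewrite cC => /H'.
by case/andP.
Qed.

Lemma osc_le h k (t s : nat) C D : hat_inv h -> (forall D, #|` D| = n -> 0 <= h D <= 1) ->
  (k * N <= t)%N -> (k * N <= s)%N -> #|` C| = n -> #|` D| = n ->
  `|iter t U h C - iter s U h D| <= rho ^+ k.
Proof.
move=> hi h01 kt ks cC cD; have [a [b [<- H]]] := contract_iter k hi h01.
have := H _ _ kt cC; have := H _ _ ks cD; rewrite ler_norml; lra.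
Qed.

Lemma le_geom (x y A : R) : (forall j, x <= y + A * rho ^+ j) -> x <= y.
Proof.
move=> h; have cv : (fun j => y + A * rho ^+ j) @ \oo --> y + A * 0.
  apply: cvgD; first exact: cvg_cst.
  by apply: cvgM; [exact: cvg_cst|apply: cvg_expr; rewrite ger0_norm].
rewrite -[leRHS]addr0 -(mulr0 A) -(cvg_lim _ cv)//.
apply: limr_ge; first by apply/cvg_ex; eexists; exact: cv.
by near=> j; exact: h.
Unshelve. all: by end_near. Qed.

Local Notation E := (classes d n).
Local Notation L := (line i0 0 n).

Definition pcl (w : set (config d)) D : R := (hat D == w)%:R.
Definition rep (w : set (config d)) : config d := xget fset0 w.

(** The probability that the chain started from C is in the class w at time t. *)
Let q t C w := iter t U (pcl w) C.

Lemma pcl_inv w : hat_inv (pcl w).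
Proof. by move=> C z; rewrite /pcl hat_translate. Qed.

Lemma pcl01 w D : 0 <= pcl w D <= 1.
Proof. by rewrite /pcl; case: eqP => _; rewrite lexx ?ler01. Qed.

Lemma sum_pcl r D : uniq r -> \sum_(w <- r) pcl w D = (hat D \in r)%:R.
Proof.
elim: r => [|v r IH] /=; first by rewrite big_nil.
move=> /andP[yr ur]; rewrite big_cons IH// inE /pcl; case: eqP => [->|_]; last by rewrite add0r.
by rewrite (negPf yr) addr0.
Qed.

Lemma cardL : #|` L| = n. Proof. exact: card_ray. Qed.

Lemma iter_sum_pcl t C r : #|` C| = n -> \sum_(w <- r) q t C w = iter t U (fun D => \sum_(w <- r) pcl w D) C.
Proof. by move=> cC; rewrite (iterU_sum _ _ _ i0)// cC. Qed.

Lemma q_ge0 t C w : 0 <= q t C w.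
Proof. by apply: iterU_ge0 => D; case/andP: (pcl01 w D). Qed.

Lemma q_osc k (t s : nat) C D w : (k * N <= t)%N -> (k * N <= s)%N -> #|` C| = n -> #|` D| = n ->
  `|q t C w - q s D w| <= rho ^+ k.
Proof.
by move=> *; apply: osc_le => //; [exact: pcl_inv|move=> G _; exact: pcl01].
Qed.

Lemma q_cvg w : cvgn (fun t => q t L w).
Proof.
apply: cauchy_cvg; apply: cauchy_exP => e e0.
have [k ke] : exists k, rho ^+ k < e.
  have : rho ^+ k @[k --> \oo] --> 0 by apply: cvg_expr; rewrite ger0_norm.
  move=> /cvgrPdist_lt/(_ e e0)[k _ /(_ k (leqnn k))].
  by rewrite sub0r normrN ger0_norm ?exprn_ge0// => ?; exists k.
exists (q (k * N) L w); exists (k * N)%N => // t /= kt.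
apply: le_lt_trans ke; apply: q_osc => //; exact: cardL.
Qed.

Definition mu w : R := limn (fun t => q t L w).

Lemma q_mu k t C w : (k * N <= t)%N -> #|` C| = n -> `|q t C w - mu w| <= rho ^+ k.
Proof.
move=> kt cC; have cv : `|q t C w - q s L w| @[s --> \oo] --> `|q t C w - mu w|.
  by apply: cvg_norm; apply: cvgB; [exact: cvg_cst|exact: q_cvg].
rewrite -(cvg_lim _ cv)//; apply: limr_le; first by apply/cvg_ex; eexists; exact: cv.
near=> s; apply: q_osc => //; last exact: cardL.
by near: s; exists (k * N)%N.
Unshelve. all: by end_near. Qed.

(** Split the classes by the sign of the difference of the two laws. Each part is an oscillation of
    the indicator of a union of classes, and [osc_le] bounds it by rho^k without regard to the
    number of classes. *)
Lemma tv_q k (t s : nat) C r : (k * N <= t)%N -> (k * N <= s)%N -> #|` C| = n -> uniq r ->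
  \sum_(w <- r) `|q t C w - q s L w| <= 2 * rho ^+ k.
Proof.
move=> kt ks cC ur.
have H r' : uniq r' -> `|\sum_(w <- r') (q t C w - q s L w)| <= rho ^+ k.
  move=> ur'; rewrite sumrB !iter_sum_pcl ?cardL//; apply: osc_le => //; last exact: cardL.
    by move=> D z; apply: eq_bigr => w _; exact: pcl_inv.
  by move=> D _; rewrite sum_pcl//; case: (_ \in _); rewrite lexx ?ler01.
rewrite (bigID (fun w => 0 <= q t C w - q s L w))/= mulr_natl mulr2n lerD//.
  rewrite -big_filter; apply: le_trans (H _ (filter_uniq _ ur)).
  apply: le_trans (ler_norm _); rewrite !big_filter.
  by apply: ler_sum => w x0; rewrite ger0_norm.
rewrite -big_filter; apply: le_trans (H _ (filter_uniq _ ur)).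
rewrite -normrN -sumrN; apply: le_trans (ler_norm _); rewrite !big_filter.
by apply: ler_sum => w; rewrite -ltNge => x0; rewrite ltr0_norm.
Qed.

(** For a finite list r, replace mu by the law at a late time s; the error is at most size r times
    rho^j with j arbitrary. *)
Lemma tv_mu k t C r : (k * N <= t)%N -> #|` C| = n -> uniq r ->
  \sum_(w <- r) `|q t C w - mu w| <= 2 * rho ^+ k.
Proof.
move=> kt cC ur; apply: (@le_geom _ _ (size r)%:R) => j.
pose s := (maxn k j * N)%N.
apply: (@le_trans _ _ (\sum_(w <- r) (`|q t C w - q s L w| + `|q s L w - mu w|))).
  apply: ler_sum => w _; apply: le_trans (ler_normD _ _).
  by rewrite addrA subrK.
rewrite big_split lerD//.
  by apply: tv_q => //; rewrite leq_mul2r leq_maxl orbT.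
apply: (@le_trans _ _ (\sum_(w <- r) rho ^+ j)).
  by apply: ler_sum => w _; apply: q_mu; rewrite ?cardL// leq_mul2r leq_maxr orbT.
by rewrite big_const_seq count_predT iter_addr_0 mulr_natl.
Qed.

Lemma tv_esum k t C : (k * N <= t)%N -> #|` C| = n ->
  (\esum_(w in E) `|(q t C w)%:E - (mu w)%:E| <= (2 * rho ^+ k)%:E)%E.
Proof.
move=> kt cC; apply: ub_ereal_sup => _ [A [fA _] <-].
rewrite fsbig_finite//=; rewrite (eq_bigr (fun w => (`|q t C w - mu w|)%:E))//.
by rewrite sumEFin lee_fin tv_mu// fset_uniq.
Qed.

Lemma mu_ge0 w : 0 <= mu w.
Proof.
apply: limr_ge; first exact: q_cvg.
by near=> t; exact: q_ge0.
Unshelve. all: by end_near. Qed.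

Lemma esum_pcl (F : set (config d) -> R) D : (forall w, 0 <= F w) ->
  (\esum_(w in E) (pcl w D * F w)%:E = (if hat D \in E then F (hat D) else 0)%:E)%E.
Proof.
move=> F0; case: ifPn => [/set_mem DE|/negP DE].
  rewrite (esumID [set hat D]) => [|w _]; last by rewrite lee_fin mulr_ge0.
  rewrite [X in (_ + X)%E]esum1 ?adde0 => [|w [_ /= /eqP]]; last first.
    by rewrite /pcl eq_sym => /negPf ->; rewrite mul0r.
  rewrite (_ : _ `&` _ = [set hat D]); last by apply/seteqP; split => w /= => [[]//|->].
  by rewrite esum_set1 /pcl ?eqxx ?mul1r// lee_fin.
rewrite esum1// => w Ex'; rewrite /pcl; case: eqP => [Dx|_]; last by rewrite mul0r.
by case: DE; rewrite Dx; exact/mem_set.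
Qed.

Lemma classesP w : E w -> #|` rep w| = n /\ hat (rep w) = w.
Proof.
move=> [C cC <-]; have /= : hat C (rep (hat C)) by apply: xgetPex; exists C; exact: in_hat.
have cC' : #|` C| = n := cC.
move=> [z Cz]; split; last by rewrite [in RHS]Cz hat_translate.
by rewrite -cC' [in RHS]Cz card_translate.
Qed.

Lemma hat_classes C : #|` C| = n -> E (hat C).
Proof. by move=> cC; exists C. Qed.

Lemma esum_q t C F : (forall w, 0 <= F w) -> #|` C| = n ->
  (\esum_(w in E) (q t C w * F w)%:E = (iter t U (fun D => F (hat D)) C)%:E)%E.
Proof.
move=> F0 cC.
have -> : iter t U (fun D => F (hat D)) C = iter t U (fun D => if hat D \in E then F (hat D) else 0) C.
  by apply: iterU_eq => D; rewrite cC => cD; rewrite ifT//; apply/mem_set/hat_classes.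
rewrite -(@esum_iterU _ E t C (fun w D => pcl w D * F w)) => [|w D|D].
- apply: eq_esum => w _; have := iterU_lin t C (F w) (pcl w) (fun=> 0).
  rewrite (iterU_cst _ _ i0) ?cC// addr0 mulrC => <-; congr _%:E.
  by apply: iterU_eq => D _; rewrite addr0 mulrC.
- by rewrite mulr_ge0//; case/andP: (pcl01 w D).
- exact: esum_pcl.
Qed.

(** Total variation convergence carries limits in t through infinite sums against bounded functions;
    the total mass of mu and its stationarity are both instances. *)
Lemma esum_mu F (Q : nat -> R) l : (forall w, 0 <= F w <= 1) ->
  (forall t, \esum_(w in E) (q t L w * F w)%:E = (Q t)%:E)%E -> Q t @[t --> \oo] --> l ->
  (\esum_(w in E) (mu w * F w)%:E = l%:E)%E.
Proof.
move=> F01 QE Ql.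
have F0 w : 0 <= F w by case/andP: (F01 w).
have F1 w : F w <= 1 by case/andP: (F01 w).
set M := esum _ _.
have M1 k t : (k * N <= t)%N -> (M <= (Q t + 2 * rho ^+ k)%:E)%E.
  move=> kt; rewrite EFinD; apply: le_trans (leeD (lexx _) (tv_esum kt cardL)).
  rewrite -QE -esumD => [|w _|w _]; last 2 first.
  - by rewrite lee_fin mulr_ge0 ?q_ge0.
  - exact: abse_ge0.
  apply: le_esum => w _; rewrite -EFinB abse_EFin -EFinD lee_fin.
  apply: (@le_trans _ _ (q t L w * F w + `|q t L w - mu w| * F w)).
    rewrite -mulrDl ler_wpM2r//; have := ler_norm (mu w - q t L w).
    by rewrite distrC; lra.
  by rewrite lerD// ler_piMr.
have M2 k t : (k * N <= t)%N -> ((Q t)%:E <= M + (2 * rho ^+ k)%:E)%E.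
  move=> kt; apply: le_trans (leeD (lexx _) (tv_esum kt cardL)).
  rewrite -QE -esumD => [|w _|w _]; last 2 first.
  - by rewrite lee_fin mulr_ge0 ?mu_ge0.
  - exact: abse_ge0.
  apply: le_esum => w _; rewrite -EFinB abse_EFin -EFinD lee_fin.
  apply: (@le_trans _ _ (mu w * F w + `|q t L w - mu w| * F w)).
    rewrite -mulrDl ler_wpM2r//; have := ler_norm (q t L w - mu w); lra.
  by rewrite lerD// ler_piMr.
have Mfin : M \is a fin_num.
  rewrite ge0_fin_numE; last by apply: esum_ge0 => w _; rewrite lee_fin mulr_ge0 ?mu_ge0.
  by apply: le_lt_trans (M1 0%N 0%N _) _; rewrite ?ltry.
move: M1 M2; rewrite -(fineK Mfin); move: (fine M) => r M1 M2.
congr _%:E; apply/eqP; rewrite -subr_eq0 -normr_le0; apply: (@le_geom _ _ 2) => k.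
have cv : `|r - Q t| @[t --> \oo] --> `|r - l|.
  by apply: cvg_norm; apply: cvgB => //; exact: cvg_cst.
rewrite -(cvg_lim _ cv)// add0r; apply: limr_le; first by apply/cvg_ex; eexists; exact: cv.
near=> t; have kt : (k * N <= t)%N by near: t; exists (k * N)%N.
have := M1 _ _ kt; have := M2 _ _ kt; rewrite -EFinD !lee_fin ler_norml; lra.
Unshelve. all: by end_near. Qed.

Lemma mu_distribution : distribution_on E mu.
Proof.
split=> [w|w nE|]; first exact: mu_ge0.
  rewrite /mu (_ : (fun t => q t L w) = fun=> 0) ?lim_cst//; apply/funext => t.
  rewrite -(iterU_cst t 0 i0 (C := L)) ?cardL//; apply: iterU_eq => D; rewrite cardL => cD.
  by rewrite /pcl; case: eqP => // Dx; case: nE; rewrite -Dx; exact: hat_classes.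
rewrite -(@esum_mu (fun=> 1) (fun=> 1) 1) => [|w|t|].
- by apply: eq_esum => w _; rewrite mulr1.
- by rewrite ler01 lexx.
- by rewrite esum_q// ?cardL// (iterU_cst _ _ i0) ?cardL.
- exact: cvg_cst.
Qed.

Lemma hat_kernelE w v : E w -> E v -> hat_kernel beta m w v = (U (pcl v) (rep w))%:E.
Proof.
move=> Ex' [C cC <-]; have := @kernel_esum (rep w) (hat C) (fun=> 1) (fun=> ler01).
rewrite /hat_kernel; under eq_esum => D _ do rewrite mule1.
move=> ->; congr _%:E; apply: U_ext => D; rewrite /pcl.
have [DC|DC] := eqVneq (hat D) (hat C).
  by rewrite ifT//; apply/mem_set; rewrite -DC; exact: in_hat.
rewrite ifF//; apply/negbTE; apply: contra DC => /set_mem[z ->].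
by rewrite hat_translate.
Qed.

Lemma U_pcl01 v C : #|` C| = n -> 0 <= U (pcl v) C <= 1.
Proof.
move=> cC; apply/andP; split; first by apply: U_ge0 => D; case/andP: (pcl01 v D).
rewrite -[leRHS](U1 i0 (C := C)) ?cC//; apply: U_le => D _; by case/andP: (pcl01 v D).
Qed.

Lemma mu_stationary : stationary_distribution E (hat_kernel beta m) mu.
Proof.
split; first exact: mu_distribution.
move=> v Ey; pose F w := if w \in E then U (pcl v) (rep w) else 0.
rewrite -(@esum_mu F (fun t => q t.+1 L v)) => [|w|t|].
- by apply: eq_esum => w Ex'; rewrite hat_kernelE// -EFinM /F ifT//; exact/mem_set.
- rewrite /F; case: ifPn => [/set_mem/classesP[cx _]|_]; first exact: U_pcl01.
  by rewrite lexx ler01.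
- rewrite esum_q ?cardL// => [|w]; last first.
    by rewrite /F; case: ifPn => // /set_mem/classesP[/(U_pcl01 v)/andP[]].
  congr _%:E; rewrite /q iterSr; apply: iterU_eq => D; rewrite cardL => cD.
  have DE := hat_classes cD; rewrite /F ifT; last exact/mem_set.
  have [_ /hat_invE hD] := classesP DE; apply: hD.
  exact: (@iterU_hat_inv 1 _ (pcl_inv v)).
- by rewrite (cvg_shiftS (fun t => q t L v)); exact: q_cvg.
Qed.

Lemma esum_swap (S T : choiceType) (A : set S) (B : set T) (f : S -> T -> \bar R) :
  (forall i j, A i -> B j -> 0 <= f i j)%E ->
  (\esum_(i in A) \esum_(j in B) f i j = \esum_(j in B) \esum_(i in A) f i j)%E.
Proof.
move=> f0; rewrite !esum_esum//; last by move=> i j *; exact: f0.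
rewrite (@reindex_esum _ _ _ (B `*`` (fun=> A)) _ (fun p => (p.2, p.1)))//.
split => [[i j] [] //|[i j] [k l] _ _ [-> ->]//|[i j] []/= Ai Bj].
by exists (j, i).
Qed.

(** By stationarity mu' v is, for every t, the mu'-average of the transition probabilities
    [q t (rep w) v], and these tend to mu v uniformly in w. *)
Lemma mu_unique mu' : stationary_distribution E (hat_kernel beta m) mu' -> mu' = mu.
Proof.
move=> [[mu'0 mu'E mu'1] st]; apply/funext => v.
have [Ev|nE] := pselect (E v); last first.
  by rewrite mu'E//; case: mu_distribution => _ /(_ v nE) ->.
have H t : (\esum_(w in E) (mu' w * q t (rep w) v)%:E = (mu' v)%:E)%E.
  elim: t => [|t IH].
    transitivity (\esum_(w in [set v]) (mu' w)%:E)%E; last by rewrite esum_set1 ?lee_fin.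
    rewrite (esumID [set v])/= => [|w _]; last by rewrite lee_fin mulr_ge0 ?q_ge0.
    rewrite [X in (_ + X)%E]esum1 ?adde0 => [|w [Ew /eqP wv]]; last first.
      by rewrite /q /= /pcl (classesP Ew).2 (negPf wv) mulr0.
    rewrite (_ : _ `&` _ = [set v]); last by apply/seteqP; split => w /= => [[]//|->].
    by apply: eq_esum => w /= ->; rewrite /q /= /pcl (classesP Ev).2 eqxx mulr1.
  rewrite -IH; transitivity (\esum_(w in E) \esum_(u in E)
      ((mu' w)%:E * hat_kernel beta m w u * (q t (rep u) v)%:E))%E.
    apply: eq_esum => w Ew; have [cw _] := classesP Ew.
    have := @esum_q 1%N (rep w) (fun u => if u \in E then q t (rep u) v else 0) _ cw.
    rewrite EFinM => /(_ _)/= Hq; transitivity ((mu' w)%:E * (U (q t ^~ v) (rep w))%:E)%E => //.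
    have -> : U (q t ^~ v) (rep w) = iter 1 U (fun D => if hat D \in E then q t (rep (hat D)) v else 0) (rep w).
      apply: (@iterU_eq 1%N) => D; rewrite cw => cD; have DE := hat_classes cD.
      rewrite ifT; last exact/mem_set.
      exact: (hat_invE (iterU_hat_inv t (pcl_inv v)) (esym (classesP DE).2)).
    rewrite -Hq => [|u]; last by case: ifP => // _; exact: q_ge0.
    rewrite -esumZl// => [|u]; last first.
      rewrite lee_fin; apply: mulr_ge0; first exact: (q_ge0 1%N).
      by case: ifP => // _; exact: q_ge0.
    apply: eq_esum => u Eu; rewrite hat_kernelE// ifT; last exact/mem_set.
    by rewrite EFinM muleA.
  rewrite esum_swap => [|w u Ew Eu]; last first.
    by rewrite hat_kernelE// !mule_ge0 ?lee_fin ?q_ge0// (q_ge0 1%N).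
  apply: eq_esum => u Eu; rewrite EFinM -(st u Eu) muleC -esumZl ?q_ge0// => [|w].
    by apply: eq_esum => w _; rewrite muleC.
  apply: mule_ge0; first by rewrite lee_fin.
  by apply: esum_ge0 => D _; rewrite cat_kernelE lee_fin; apply: U_ge0.
apply/eqP; rewrite -subr_eq0 -normr_le0; apply: (@le_geom _ _ 1) => k; rewrite add0r mul1r.
have Hk := H (k * N)%N.
have B1 : ((mu' v)%:E <= (mu v + rho ^+ k)%:E)%E.
  rewrite -Hk -[leRHS]mule1 -mu'1 -esumZl => [|//|w]; last 2 first.
  - by rewrite addr_ge0 ?mu_ge0// exprn_ge0.
  - by rewrite lee_fin.
  apply: le_esum => w Ew; rewrite -EFinM lee_fin mulrC ler_wpM2r//.
  have := q_mu v (leqnn (k * N)) (classesP Ew).1; rewrite ler_norml; lra.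
have B2 : ((mu v)%:E <= (mu' v + rho ^+ k)%:E)%E.
  rewrite EFinD -Hk -[(rho ^+ k)%:E]mule1 -mu'1 -esumZl => [|//|w]; last 2 first.
  - by rewrite exprn_ge0.
  - by rewrite lee_fin.
  rewrite -esumD => [|w _|w _]; last 2 first.
  - by rewrite lee_fin mulr_ge0 ?q_ge0.
  - by rewrite -EFinM lee_fin mulr_ge0 ?exprn_ge0.
  rewrite -[leLHS]mule1 -mu'1 -esumZl ?mu_ge0//.
  apply: le_esum => w Ew; rewrite -!EFinM -EFinD lee_fin [mu v * _]mulrC [_ ^+ _ * _]mulrC -mulrDr ler_wpM2l//.
  have := q_mu v (leqnn (k * N)) (classesP Ew).1; rewrite ler_norml; lra.
by move: B1 B2; rewrite !lee_fin ler_norml; lra.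
Qed.

(** After one step every configuration has a progressive boundary, so the laws whose limit is mu
    vanish at w from time 1 on. *)
Lemma mu_Prog w : ~ hat_Prog R d m n w -> mu w = 0.
Proof.
move=> nP; rewrite /mu; apply: cvg_lim => //; rewrite -(cvg_shiftS (fun t => q t L w)).
rewrite (_ : (fun t => q t.+1 L w) = fun=> 0); first exact: cvg_cst.
apply/funext => t; rewrite /q iterSr -(iterU_cst t 0 i0 (C := L)) ?cardL//.
apply: iterU_eq => D; rewrite cardL => cD.
have -> : U (pcl w) D = U (fun=> 0) D; last by rewrite (U_cst _ i0)// cD.
apply/eqP; rewrite eq_le !U_le// => G DG; rewrite /pcl; case: eqP => // GL; case: nP.
  by rewrite -GL; exists G => //; rewrite -cD; apply: step_Prog; rewrite ?cD.
Qed.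

Lemma tv_cvg C : #|` C| = n ->
  (\esum_(w in E) `|(q t.+1 C w)%:E - (mu w)%:E| @[t --> \oo] --> 0)%E.
Proof.
move=> cC.
have g0 : (2 * rho ^+ (t %/ N))%:E @[t --> \oo] --> (2 * 0)%:E.
  apply: cvg_EFin; first by near=> t.
  apply: cvgM; first exact: cvg_cst.
  have N0 : (0 < N)%N by rewrite addn_gt0 orbT.
  have rk : rho ^+ k @[k --> \oo] --> 0 by apply: cvg_expr; rewrite ger0_norm.
  by have := cvg_comp _ _ (cvg_divnr _ N0) rk; exact.
rewrite mulr0 in g0.
apply: (@squeeze_cvge _ _ _ _ (fun=> 0%E) _ (fun t => (2 * rho ^+ (t %/ N))%:E)) => //.
  near=> t; apply/andP; split; first by apply: esum_ge0 => w _; exact: abse_ge0.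
  by apply: tv_esum => //; rewrite (leq_trans (leq_divM _ _)).
exact: cvg_cst.
Unshelve. all: by end_near. Qed.

End Ergodic.

Lemma measure_countable_bigcup disp (Omega : measurableType disp)
    (P : {measure set Omega -> \bar R}) (T : countType) (B : set T) (F : T -> set Omega) :
  (forall i, measurable (F i)) -> trivIset B F ->
  (P (\bigcup_(i in B) F i) = \esum_(i in B) P (F i))%E.
Proof.
move=> mF tF; pose D := [set choice.pickle i | i in B].
pose G k := if choice.unpickle k is Some i then F i else set0.
have -> : \bigcup_(i in B) F i = \bigcup_(k in D) G k.
  apply/seteqP; split => w /= [i Bi Fi].
    by exists (choice.pickle i); [exists i|rewrite /G choice.pickleK].
  by case: Bi Fi => j Bj <-; rewrite /G choice.pickleK => Fj; exists j.
rewrite measure_bigcup; last 2 first.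
- by move=> k _; rewrite /G; case: choice.unpickle.
- move=> k l [i Bi <-] [j Bj <-]; rewrite /G !choice.pickleK => /(tF _ _ Bi Bj) ->//.
rewrite nneseries_esum// (@reindex_esum _ _ _ B _ choice.pickle).
  by apply: eq_esum => i _; rewrite /G choice.pickleK.
split.
- by move=> i Bi /=; rewrite inE; exists i.
- by move=> i j _ _ /(pcan_inj choice.pickleK).
- by move=> k /=; rewrite inE.
Qed.

(** * Probabilities of path events *)

Section Chain.
Variables (disp : measure_display) (Omega : measurableType disp) (P : probability Omega R).
Variables (X : nat -> Omega -> config d) (C0 : config d).
Hypothesis MC : markov_chain (cat_kernel beta m) C0 P X.

Lemma measurable_chain (t : nat) (A : set (config d)) : measurable (X t @^-1` A).
Proof.
case: MC => mX _ _.
rewrite (_ : X t @^-1` A = \bigcup_D (if D \in A then [set w | X t w = D] else set0)).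
  by apply: countable_bigcupT_measurable => // D; case: ifP.
apply/seteqP; split => w /= => [Aw|[D _]].
  by exists (X t w) => //; rewrite ifT//; exact/mem_set.
by case: ifPn => [/set_mem AD XD|_ []]; have -> : X t w = D := XD.
Qed.

(** The probability, given C at time t, that the next k states lie in their prescribed sets; time t
    itself is not tested. The sets depend on time so that the same formula yields the law at a fixed
    time and the avoidance of a class. *)
Fixpoint surv (B : nat -> set (config d)) k (t : nat) (C : config d) : R :=
  if k is k'.+1 then U (fun D => if D \in B t.+1 then surv B k' t.+1 D else 0) C else 1.

Lemma surv_ge0 B k t C : 0 <= surv B k t C.
Proof. by elim: k t C => [|k IH] t C //=; apply: U_ge0 => D; case: ifP. Qed.

Definition prefix_event (t : nat) (g : nat -> config d) : set Omega :=
  [set w | forall i, (i <= t)%N -> X i w = g i].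

Lemma measurable_prefix t g : measurable (prefix_event t g).
Proof.
rewrite (_ : prefix_event t g = \bigcap_(i in [set i | (i <= t)%N]) (X i @^-1` [set g i])).
  by apply: bigcap_measurableType => i _; exact: measurable_chain.
by [].
Qed.

Lemma measurable_future (B : nat -> set (config d)) (t k : nat) :
  measurable [set w | forall i, (t < i <= t + k)%N -> B i (X i w)].
Proof.
rewrite (_ : [set _ | _] = \bigcap_(i in [set i | (t < i <= t + k)%N]) (X i @^-1` B i)) //.
by apply: bigcap_measurableType => i _; exact: measurable_chain.
Qed.

(** Induction on k: split the event by the value D of the chain at time t+1 and extend the
    prescribed past by D. *)
Lemma prob_surv (B : nat -> set (config d)) k t (g : nat -> config d) :
  (P (prefix_event t g `&` [set w | forall i, (t < i <= t + k)%N -> B i (X i w)]) =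
   P (prefix_event t g) * (surv B k t (g t))%:E)%E.
Proof.
elim: k t g => [|k IH] t g.
  rewrite mule1; congr (P _); apply/seteqP; split => w /=; first by case.
  by move=> ?; split=> // i; rewrite addn0; lia.
pose g' (D : config d) i := if i == t.+1 then D else g i.
pose F D := prefix_event t.+1 (g' D) `&` [set w | forall i, (t.+1 < i <= t.+1 + k)%N -> B i (X i w)].
have -> : prefix_event t g `&` [set w | forall i, (t < i <= t + k.+1)%N -> B i (X i w)] =
    \bigcup_(D in B t.+1) F D.
  apply/seteqP; split => w /=.
    move=> [px fx]; exists (X t.+1 w); first by apply: fx; lia.
    split=> i; last by move=> ?; apply: fx; lia.
    by rewrite /g' leq_eqVlt ltnS; case: eqP => [->//|_] /=; exact: px.
  move=> [D BD [px fx]]; split=> i it.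
    have := px i (leq_trans it (leqnSn _)); rewrite /g' ifN//.
    by rewrite neq_ltn ltnS it.
  have [->|ne] := eqVneq i t.+1; last by apply: fx; lia.
  by have := px _ (leqnn _); rewrite /g' eqxx => ->.
have F0 D : measurable (F D) by apply: measurableI; [exact: measurable_prefix|exact: measurable_future].
have tF : trivIset (B t.+1) F.
  move=> D D' _ _ [w [[/(_ _ (leqnn _)) + _] [/(_ _ (leqnn _)) + _]]].
  by rewrite /g' eqxx => -> ->.
rewrite measure_countable_bigcup//.
have [_ _ MS] := MC.
transitivity (\esum_(D in B t.+1) (P (prefix_event t g) *
   (cat_kernel beta m (g t) D * (surv B k t.+1 D)%:E)))%E.
  apply: eq_esum => D _; rewrite [LHS](IH t.+1 (g' D)).
  rewrite muleA; congr (_ * _)%E; last by rewrite /g' eqxx.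
  rewrite {1}/prefix_event MS /g' eqxx ifN ?neq_ltn ?ltnSn//; congr (P _ * _)%E.
  apply/seteqP; split => w /= h i it; have := h i it; rewrite ifN//.
    by rewrite neq_ltn ltnS it.
  by rewrite neq_ltn ltnS it.
have Pfin : P (prefix_event t g) = (fine (P (prefix_event t g)))%:E.
  by rewrite fineK// fin_num_measure//; exact: measurable_prefix.
rewrite Pfin esumZl => [||D]; last 2 first.
- by rewrite fine_ge0.
- by rewrite mule_ge0// ?lee_fin ?surv_ge0// cat_kernelE lee_fin; apply: U_ge0.
by congr (_ * _)%E; rewrite kernel_esum// => D; exact: surv_ge0.
Qed.

Lemma prob_surv0 (B : nat -> set (config d)) k :
  (P [set w | forall i, (0 < i <= k)%N -> B i (X i w)] = (surv B k 0 C0)%:E)%E.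
Proof.
have [mX X0 _] := MC.
have px : prefix_event 0 (fun=> C0) = [set w | X 0%N w = C0].
  apply/seteqP; split => w /=; first exact.
  by move=> h i; rewrite leqn0 => /eqP ->.
have := prob_surv B k 0 (fun=> C0); rewrite px X0 mul1e add0n => <-.
have mF := measurable_future B 0 k; rewrite add0n in mF.
have mX0 : measurable [set w | X 0%N w = C0] by exact: mX.
rewrite [LHS](measureDI P mF mX0) setIC.
rewrite [X in (X + _)%E](_ : _ = 0%E) ?add0e//.
apply: (@subset_measure0 _ _ _ P _ (~` [set w | X 0%N w = C0])).
- exact: measurableD.
- exact: measurableC.
- by move=> w [].
- by have := probability_setC P mX0; rewrite X0 subee.
Qed.

End Chain.

Lemma part_i n (i0 i1 i2 : 'I_d) : (0 < m)%N -> i1 != i0 -> i2 != i0 ->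
  (m < n)%N -> (n <= 2 * m + 1)%N ->
  exists mu : set (config d) -> R,
     [/\ stationary_distribution (classes d n) (hat_kernel beta m) mu,
         forall mu' : set (config d) -> R,
           stationary_distribution (classes d n) (hat_kernel beta m) mu' ->
           mu' = mu,
         forall c, ~ hat_Prog R d m n c -> mu c = 0
       & forall (C : config d) (disp : measure_display)
           (Omega : measurableType disp) (P : probability Omega R)
           (X : nat -> Omega -> config d),
           #|` C| = n -> markov_chain (cat_kernel beta m) C P X ->
           law_converges (classes d n) P (fun t w => hat (X t w)) mu].
Proof.
move=> m0 i10 i20 mn n2m; have [c c0 hc] := doeblin m0 i10 i20.
pose c' := Num.min c 1.
have c01 : 0 < c' <= 1 by rewrite lt_min c0 ltr01 ge_min lexx orbT.
have rl C : #|` C| = n -> exists p, reach mixing_time c' C (line i0 p n).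
  move=> cC; have [|| p hp] := hc C; rewrite ?cC//; exists p.
  have := hp false false false; rewrite !mulr0n !addr0 cC.
  by apply: reach_le; rewrite ge_min lexx.
exists (mu n i0); split.
- exact: mu_stationary mn c01 rl.
- exact: mu_unique mn c01 rl.
- exact: (mu_Prog i0 mn).
move=> C disp Omega P X cC MC.
rewrite /law_converges -(cvg_shiftS (fun t => \esum_(c in classes d n) `|P [set w | hat (X t w) = c] - (mu n i0 c)%:E|)%E).
apply: cvg_trans (tv_cvg mn c01 rl cC).
apply: near_eq_cvg; near=> t; apply: eq_esum => x _.
congr (`|_ - _|)%E.
(* Only time t+1 is constrained, so this survival probability is the law of the class at that
   time. *)
pose B i := if i == t.+1 then [set D : config d | hat D = x] else setT.
transitivity (P [set w | forall i, (0 < i <= t.+1)%N -> B i (X i w)]).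
  rewrite (prob_surv0 MC); congr _%:E.
  have H k : (k <= t)%N -> surv B k.+1 (t - k) =1 iter k.+1 U (pcl x).
    elim: k => [_ D|k IH kt D].
      rewrite subn0 /=; apply: U_ext => G; rewrite /B eqxx /pcl.
      by case: eqP => [Gx|Gx]; [rewrite ifT|rewrite ifF]; rewrite ?inE//; apply/negbTE/negP; rewrite inE.
    rewrite -[surv _ _ _]/(surv B (k.+1).+1 (t - k.+1)) /=; apply: U_ext => G.
    have -> : ((t - k.+1).+1 = t - k)%N by lia.
    have := IH (ltnW kt) G; rewrite /= => ->; rewrite ifT// /B ifN ?in_setT//.
    by apply/eqP; lia.
  by have := H t (leqnn t) C; rewrite subnn => ->.
congr (P _); apply/seteqP; split => w /=.
  by move=> /(_ t.+1); rewrite /B eqxx leqnn; apply.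
by move=> h i _; rewrite /B; case: eqP => [->|].
Unshelve. all: by end_near. Qed.

End Step.

(** * Green function bound in three directions *)

Section Coin.
Variable R : realType.
Implicit Types (f g : int -> R) (z : int).

Definition coin (f : int -> R) (z : int) : R := (f z + f (z + 1)) / 2.

Lemma coin_le f g : (forall z, f z <= g z) -> forall z, coin f z <= coin g z.
Proof. by move=> fg z; rewrite ler_pM2r// lerD. Qed.

Lemma iter_coin_le k f g : (forall z, f z <= g z) -> forall z, iter k coin f z <= iter k coin g z.
Proof. by elim: k => // k IH fg; apply: coin_le; exact: IH. Qed.

Lemma iter_coin_lin k (a : R) f g z :
  iter k coin (fun z => a * f z + g z) z = a * iter k coin f z + iter k coin g z.
Proof. by elim: k z => //= k IH z; rewrite /coin !IH; field. Qed.

Lemma iter_coin_cst k (a : R) z : iter k coin (fun=> a) z = a.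
Proof. by elim: k z => //= k IH z; rewrite /coin !IH; field. Qed.

Lemma iter_coin_sum k (r : seq nat) (F : nat -> int -> R) z :
  iter k coin (fun z => \sum_(a <- r) F a z) z = \sum_(a <- r) iter k coin (F a) z.
Proof.
elim: r z => [|a r IH] z.
  rewrite big_nil -[RHS](iter_coin_cst k 0 z); congr (iter _ _ _ _).
  by apply/funext => y; rewrite big_nil.
rewrite big_cons -IH -[iter k coin (F a) z]mul1r -iter_coin_lin; congr (iter _ _ _ _).
by apply/funext => y; rewrite big_cons mul1r.
Qed.

Lemma iter_coin_delta k (a z : int) : iter k coin (fun y => (y == a)%:R) z =
  (if z <= a then 'C(k, absz (a - z))%:R else 0) / 2 ^+ k.
Proof.
elim: k z => [|k IH] z /=.
  rewrite expr0 divr1 bin0n absz_eq0 subr_eq0 eq_sym.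
  by case: eqP => [->|_]; rewrite ?lexx//; case: ifP.
rewrite /coin !IH -mulrDl -mulrA -invfM -exprSr; congr (_ / _).
case: (ltrgtP z a) => [za|za|->].
- have -> : (z + 1 <= a) by lia.
  have -> : absz (a - z)%R = (absz (a - (z + 1))%R).+1 by lia.
  by rewrite binS natrD.
- by rewrite ifF ?addr0//; lia.
- by rewrite ifF ?addr0 ?subrr ?bin0//; lia.
Qed.

Lemma bin_central_max k l : ('C(2 * k, l) <= 'C(2 * k, k))%N.
Proof.
have mono l' : (l' <= k)%N -> ('C(2 * k, l') <= 'C(2 * k, k))%N.
  move=> lk; rewrite -(subKn lk); elim: (k - l')%N (leq_subr l' k) => [|j IH] jk.
    by rewrite subn0.
  apply: leq_trans (IH (ltnW jk)).
  rewrite -(leq_pmul2l (ltn0Sn (k - j.+1))).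
  rewrite (_ : (k - j)%N = (k - j.+1).+1); last by lia.
  rewrite mul_bin_left.
  rewrite leq_mul2r; apply/orP; right; lia.
have [lk|kl] := leqP l k; first exact: mono.
have [l2k|k2l] := leqP l (2 * k); last by rewrite bin_small.
by rewrite -bin_sub// mono//; lia.
Qed.

(** An elementary form of the bound of order 4^k / sqrt(k) for the central binomial coefficient,
    squared to stay among integers; the induction uses (k+1) C(2k+2,k+1) = 2 (2k+1) C(2k,k). *)
Lemma bin_central_bound k : ('C(2 * k, k) ^ 2 * (2 * k + 1) <= 16 ^ k)%N.
Proof.
elim: k => [|k IH]; first by rewrite bin0.
set c := 'C(2 * k, k) in IH; set c' := 'C(2 * k.+1, k.+1).
have E : (k.+1 * c' = 2 * (2 * k + 1) * c)%N.
  rewrite /c' mulnS -[(2 + 2 * k)%N]/((2 * k).+2) -mul_bin_diag /=.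
  have -> : 'C((2 * k).+1, k) = 'C((2 * k).+1, k.+1).
    by rewrite -bin_sub; [congr 'C(_, _); lia|lia].
  have := mul_bin_diag (2 * k).+1 k; rewrite /= -/c; nia.
rewrite -(@leq_pmul2l (k.+1 ^ 2)) ?expn_gt0// mulnA -expnMn E [(16 ^ _)%N]expnS.
move: (16 ^ k)%N IH => N; nia.
Qed.

(** The largest point probability of a binomial law decays like the inverse square root of time; the
    times 2 * 4^i make this a power of 2. *)
Lemma coin_delta_bound i (a z : int) :
  iter (2 * 4 ^ i) coin (fun y => (y == a)%:R) z <= (2 ^+ i)^-1.
Proof.
rewrite iter_coin_delta; apply: (@le_trans _ _ ('C(2 * 4 ^ i, 4 ^ i)%:R / 2 ^+ (2 * 4 ^ i))).
  rewrite ler_pM2r ?invr_gt0 ?exprn_gt0//; case: ifP => // _.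
  by rewrite ler_nat bin_central_max.
rewrite ler_pdivrMr ?exprn_gt0// mulrC -[leRHS]/(_ * _) ler_pdivlMr ?exprn_gt0//.
rewrite -!natrX -natrM ler_nat -leq_sqr expnMn.
have := bin_central_bound (4 ^ i); set N := (4 ^ i)%N.
have -> : ((2 ^ i) ^ 2 = N)%N by rewrite -expnM mulnC expnM.
have -> : ((2 ^ (2 * N)) ^ 2 = 16 ^ N)%N by rewrite -expnM mulnC mulnA expnM.
by apply: leq_trans; rewrite leq_mul2l; apply/orP; right; lia.
Qed.

(** The 6 * 4^I indices from 2 * 4^I up to 2 * 4^(I+1) contribute at most y^I each, which leaves a
    geometric series of ratio 4y; the 2 accounts for the indices 0 and 1. *)
Lemma sum_tail (y : R) J : 0 <= y -> 4 * y < 1 ->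
  \sum_(k <- iota 0 J) y ^+ trunc_log 4 k./2 <= 2 + 6 / (1 - 4 * y).
Proof.
move=> y0 y4; have y1 : 0 < 1 - 4 * y by rewrite subr_gt0.
have nn k : 0 <= y ^+ trunc_log 4 k./2 by rewrite exprn_ge0.
have H I : \sum_(k <- iota 0 (2 * 4 ^ I)) y ^+ trunc_log 4 k./2 <= 2 + 6 * (1 - (4 * y) ^+ I) / (1 - 4 * y).
  elim: I => [|I IH].
    by rewrite expn0 muln1 /= !big_cons big_nil /= trunc_log0 !expr0 subrr mulr0 mul0r; lra.
  have -> : (2 * 4 ^ I.+1 = 2 * 4 ^ I + 6 * 4 ^ I)%N by rewrite expnS; lia.
  rewrite iotaD big_cat /=.
  have : \sum_(k <- iota (0 + 2 * 4 ^ I) (6 * 4 ^ I)) y ^+ trunc_log 4 k./2 <= 6 * (4 * y) ^+ I.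
    apply: (@le_trans _ _ (\sum_(k <- iota (0 + 2 * 4 ^ I) (6 * 4 ^ I)) y ^+ I)).
      rewrite !big_seq; apply: ler_sum => k; rewrite mem_iota add0n => /andP[ik _].
      rewrite ler_wiXn2l//; first by lra.
      by rewrite trunc_log_max//; lia.
    rewrite big_const_seq count_predT size_iota iter_addr_0 -[leLHS]mulr_natl natrM natrX exprMn.
    by rewrite mulrA.
  move: IH; rewrite exprS; set v := (4 * y) ^+ I => h1 h2.
  apply: le_trans (lerD h1 h2) _; rewrite le_eqVlt; apply/orP; left; apply/eqP.
  by field; rewrite gt_eqF.
apply: (@le_trans _ _ (\sum_(k <- iota 0 (2 * 4 ^ J)) y ^+ trunc_log 4 k./2)).
  have -> : (2 * 4 ^ J = J + (2 * 4 ^ J - J))%N by rewrite subnKC//; have := ltn_expl J (isT : 1 < 4)%N; lia.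
  by rewrite iotaD big_cat /= lerDl sumr_ge0.
apply: le_trans (H J) _; rewrite lerD2l ler_pdivrMr// divfK ?gt_eqF//.
have : 0 <= (4 * y) ^+ J by rewrite exprn_ge0// mulr_ge0.
lra.
Qed.

Variable q : R.
Hypothesis q_gt : 1 < 2 * q.
Hypothesis q_lt : 4 * q ^+ 3 < 1.

Let q0 : 0 < q. Proof. by move: q_gt; lra. Qed.
Let q1 : q < 1.
Proof.
rewrite ltNge; apply/negP => q1; have q3 : 1 <= q ^+ 3 by exact: exprn_ege1.
move: q_lt; lra. Qed.

(* With q = 2^(-b/3), a dyadic form of (1 + |z|)^(-b/3): the kernel in three
   dimensions is dominated by a product of such weights. *)
Definition wgt (z : int) : R := q ^+ trunc_log 2 (absz z).+1.
Definition wcst : R := 3 + 2 / (2 * q - 1).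

(** Cut at the scale 2^i: inside, the weight is a combination of point masses, to which
    [coin_delta_bound] applies; outside, it is at most q^i. *)
Lemma wgt_bound i z : wgt z <= \sum_(a <- iota 0 (2 ^ i))
  q ^+ trunc_log 2 a.+1 * ((z == a%:Z)%:R + (z == - a%:Z)%:R) + q ^+ i.
Proof.
have F0 a : 0 <= q ^+ trunc_log 2 a.+1 * ((z == a%:Z)%:R + (z == - a%:Z)%:R).
  by rewrite mulr_ge0 ?addr_ge0// exprn_ge0// ltW.
have [zi|iz] := ltnP (absz z) (2 ^ i).
  rewrite (bigD1_seq (absz z)) ?iota_uniq ?mem_iota//= -addrA -[leLHS]addr0 lerD//.
    rewrite /wgt -[leLHS]mulr1 ler_wpM2l ?exprn_ge0 ?(ltW q0)//.
    have [->|->] : z == (absz z)%:Z \/ z == - (absz z)%:Z by lia.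
      by rewrite lerDl.
    by rewrite lerDr.
  by rewrite addr_ge0 ?sumr_ge0// exprn_ge0// ltW.
rewrite -[leLHS]add0r lerD ?sumr_ge0//.
rewrite /wgt ler_wiXn2l ?ltW//.
by rewrite trunc_log_max// (leq_trans iz).
Qed.

Lemma wgt_sum i : \sum_(a <- iota 0 (2 ^ i)) q ^+ trunc_log 2 a.+1 <= 1 + (2 * q) ^+ i / (2 * q - 1).
Proof.
have q21 : 0 < 2 * q - 1 by rewrite subr_gt0.
elim: i => [|i IH].
  by rewrite expn0 /= big_seq1 trunc_log1 !expr0 lerDl divr_ge0// ltW.
rewrite expnS mul2n -addnn iotaD big_cat/=.
have : \sum_(a <- iota (0 + 2 ^ i) (2 ^ i)) q ^+ trunc_log 2 a.+1 <= (2 * q) ^+ i.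
  apply: (@le_trans _ _ (\sum_(a <- iota (0 + 2 ^ i) (2 ^ i)) q ^+ i)).
    rewrite !big_seq; apply: ler_sum => a; rewrite mem_iota => /andP[ia _].
    by rewrite ler_wiXn2l ?ltW// trunc_log_max// ltnW.
  by rewrite big_const_seq count_predT size_iota iter_addr_0 exprMn -natrX mulr_natl.
move: IH; rewrite exprS; set y := (2 * q) ^+ i; move=> h1 h2.
apply: le_trans (lerD h1 h2) _; rewrite le_eqVlt; apply/orP; left; apply/eqP.
by field; rewrite gt_eqF.
Qed.

(** The point masses have total weight at most 1 + (2q)^i / (2q-1), each sign spreads to 2^(-i), and
    2^(-i) is at most q^i; collecting terms gives [wcst]. *)
Lemma iter_coin_wgt i z : iter (2 * 4 ^ i) coin wgt z <= wcst * q ^+ i.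
Proof.
have q21 : 0 < 2 * q - 1 by rewrite subr_gt0.
apply: le_trans (iter_coin_le _ (wgt_bound i) z) _.
set F := fun a y => q ^+ trunc_log 2 a.+1 * (((y == a%:Z)%:R : R) + (y == - a%:Z)%:R).
have -> : (fun z => \sum_(a <- iota 0 (2 ^ i)) q ^+ trunc_log 2 a.+1 * ((z == a%:Z)%:R + (z == - a%:Z)%:R) + q ^+ i)
   = (fun z => 1 * (\sum_(a <- iota 0 (2 ^ i)) F a z) + q ^+ i).
  by apply/funext => y; rewrite mul1r.
rewrite iter_coin_lin mul1r iter_coin_cst iter_coin_sum.
have H : \sum_(a <- iota 0 (2 ^ i)) iter (2 * 4 ^ i) coin (F a) z <=
    (\sum_(a <- iota 0 (2 ^ i)) q ^+ trunc_log 2 a.+1) * (2 / 2 ^+ i).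
  rewrite mulr_suml; apply: ler_sum => a _.
  have -> : F a = (fun y => q ^+ trunc_log 2 a.+1 * (1 * (y == a%:Z)%:R + (y == - a%:Z)%:R) + 0).
    by apply/funext => y; rewrite /F mul1r addr0.
  rewrite (iter_coin_lin _ _ (fun y => 1 * (y == a%:Z)%:R + (y == - a%:Z)%:R) (fun=> 0)).
  rewrite iter_coin_lin mul1r iter_coin_cst addr0 ler_wpM2l ?exprn_ge0 ?(ltW q0)//.
  by rewrite mulr_natl mulr2n lerD//; exact: coin_delta_bound.
apply: le_trans (lerD (le_trans H _) (lexx _)) _.
  by apply: (ler_wpM2r _ (wgt_sum i)); rewrite divr_ge0// exprn_ge0.
have i2 : (2 ^+ i)^-1 <= q ^+ i.
  have Q0 : 0 < 2 ^+ i :> R by rewrite exprn_gt0.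
  rewrite -[leLHS]mul1r ler_pdivrMr// -exprMn; apply: exprn_ege1.
  by rewrite mulrC ltW.
have -> : (1 + (2 * q) ^+ i / (2 * q - 1)) * (2 / 2 ^+ i) = 2 * (2 ^+ i)^-1 + 2 / (2 * q - 1) * q ^+ i.
  rewrite exprMn; field; rewrite gt_eqF//= gt_eqF// exprn_gt0//.
rewrite /wcst; have : 0 <= 2 / (2 * q - 1) * q ^+ i by rewrite mulr_ge0 ?divr_ge0 ?exprn_ge0 ?(ltW q0) ?(ltW q21).
move: i2; set u := (2 ^+ i)^-1; set v := q ^+ i; lra.
Qed.

Lemma iter_coin_wgt_tail k z : iter k coin wgt z <= wcst * q ^+ trunc_log 4 k./2.
Proof.
have q21 : 0 < 2 * q - 1 by rewrite subr_gt0.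
set i := trunc_log 4 k./2.
have [k0|k0] := posnP k./2.
  have -> : i = 0%N by rewrite /i k0 trunc_log0.
  rewrite expr0 mulr1; apply: (@le_trans _ _ (iter k coin (fun=> 1) z)).
    by apply: iter_coin_le => y; rewrite /wgt exprn_ile1 ?(ltW q0) ?(ltW q1).
  rewrite iter_coin_cst /wcst; have : 0 <= 2 / (2 * q - 1) by rewrite divr_ge0// ltW.
  lra.
have ik : (2 * 4 ^ i <= k)%N by have := trunc_logP (isT : 1 < 4)%N k0; rewrite -/i; lia.
rewrite -(subnK ik) iterD -[leRHS](iter_coin_cst (k - 2 * 4 ^ i) _ z).
apply: iter_coin_le; exact: iter_coin_wgt.
Qed.

End Coin.

Section Green.
Variables (R : realType) (d : nat) (i0 i1 i2 : 'I_d).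
Hypotheses (i01 : i0 != i1) (i02 : i0 != i2) (i12 : i1 != i2).
Implicit Types (h : lattice d -> R) (x : lattice d).

Definition shift3 (r : bool * bool * bool) : lattice d :=
  dir i0 *+ r.1.1 + dir i1 *+ r.1.2 + dir i2 *+ r.2.

Definition T h x : R := 8^-1 * \sum_(r : bool * bool * bool) h (x + shift3 r).

Lemma T_prod (u0 u1 u2 : int -> R) :
  T (fun x => u0 (x 0 i0) * u1 (x 0 i1) * u2 (x 0 i2)) =
  (fun x => coin u0 (x 0 i0) * coin u1 (x 0 i1) * coin u2 (x 0 i2)).
Proof.
apply/funext => x; rewrite /T.
have E0 r : (x + shift3 r) 0 i0 = x 0 i0 + r.1.1%:Z.
  by rewrite mxE /shift3 2!mxE !dirE eqxx (negPf i01) (negPf i02) mul1n !addr0.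
have E1 r : (x + shift3 r) 0 i1 = x 0 i1 + r.1.2%:Z.
  by rewrite mxE /shift3 2!mxE !dirE eqxx [i1 == i0]eq_sym (negPf i01) (negPf i12) mul1n addr0 add0r.
have E2 r : (x + shift3 r) 0 i2 = x 0 i2 + r.2%:Z.
  by rewrite mxE /shift3 2!mxE !dirE eqxx [i2 == i0]eq_sym [i2 == i1]eq_sym (negPf i02) (negPf i12) mul1n !add0r.
under eq_bigr => r _ do rewrite E0 E1 E2.
rewrite -(pair_bigA _ (fun (p : bool * bool) (r2 : bool) =>
  u0 (x 0 i0 + p.1%:Z) * u1 (x 0 i1 + p.2%:Z) * u2 (x 0 i2 + r2%:Z))) /=.
rewrite -(pair_bigA _ (fun r0 r1 : bool => \sum_(r2 : bool)
  u0 (x 0 i0 + r0%:Z) * u1 (x 0 i1 + r1%:Z) * u2 (x 0 i2 + r2%:Z))) /=.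
by rewrite !big_bool /= !addr0 /coin; field.
Qed.

Lemma iter_T_prod k (u0 u1 u2 : int -> R) :
  iter k T (fun x => u0 (x 0 i0) * u1 (x 0 i1) * u2 (x 0 i2)) =
  (fun x => iter k (@coin R) u0 (x 0 i0) * iter k (@coin R) u1 (x 0 i1) * iter k (@coin R) u2 (x 0 i2)).
Proof. by elim: k => // k IH; rewrite iterS IH T_prod. Qed.

Lemma T_le h h' : (forall x, h x <= h' x) -> forall x, T h x <= T h' x.
Proof.
move=> hh x; rewrite ler_pM2l ?invr_gt0//.
by apply: ler_sum => r _; exact: hh.
Qed.

Lemma iter_T_le k h h' : (forall x, h x <= h' x) -> forall x, iter k T h x <= iter k T h' x.
Proof. by elim: k => // k IH hh; apply: T_le; exact: IH. Qed.

Definition gker (b : R) (D0 : nat) x : R := ((nm x + D0)%N%:R : R) `^ (- b).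

Lemma powR2_gt1 (s : R) : 0 < s -> 1 < 2 `^ s.
Proof.
move=> s0; have := @gt0_ltr_powR R s s0 1 2; rewrite powR1; apply; rewrite ?nnegrE//.
by rewrite ltr1n.
Qed.

(** Take q = 2^(-b/3), so that each coordinate carries a third of the exponent and the walk factors
    over the three coordinates. Then b < 3 means 2q > 1, which bounds each factor by a multiple of
    q^i at time 2 * 4^i, and b > 2 means 4 q^3 < 1, which makes the product summable in time. *)
Lemma green (b : R) (D0 : nat) : 2 < b -> b < 3 -> (0 < D0)%N ->
  exists B : nat -> R, [/\ forall j, 0 <= B j, forall j x, iter j T (gker b D0) x <= B j &
    exists K, forall J, \sum_(j <- iota 0 J) B j <= K].
Proof.
move=> b2 b3 D00; pose q : R := 2 `^ (- (b / 3)).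
have q3 : q ^+ 3 = 2 `^ (- b).
  rewrite -powR_mulrn ?powR_ge0// -powRrM; congr (_ `^ _); by field.
have q_lt : 4 * q ^+ 3 < 1.
  have -> : 4 = 2 `^ 2 :> R by rewrite (powR_mulrn 2)//; ring.
  rewrite q3 -powRD; last by apply/implyP.
  rewrite (_ : 2 - b = - (b - 2)); last by ring.
  by rewrite powRN invf_lt1 ?powR_gt0// powR2_gt1// subr_gt0.
have q_gt : 1 < 2 * q.
  rewrite -[X in X * _](powRr1 (_ : 0 <= 2))// -powRD; last by apply/implyP.
  by apply: powR2_gt1; lra.
have q0 : 0 < q by rewrite powR_gt0.
have W0 : 0 <= wcst q by rewrite addr_ge0// divr_ge0//; lra.
exists (fun j => wcst q ^+ 3 * (q ^+ 3) ^+ trunc_log 4 j./2); split.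
- by move=> j; rewrite mulr_ge0 ?exprn_ge0// ltW.
- move=> j x; pose w := wgt q.
  apply: (@le_trans _ _ (iter j T (fun x => w (x 0 i0) * w (x 0 i1) * w (x 0 i2)) x)).
    apply: iter_T_le => {}x.
    have H i : (((nm x + D0)%N%:R : R) `^ (- (b / 3))) <= w (x 0 i).
      rewrite /w /wgt; set t := trunc_log 2 _.
      have -> : q ^+ t = (2 ^+ t) `^ (- (b / 3)).
        by rewrite -powR_mulrn ?powR_ge0// /q -powRrM [X in _ `^ X]mulrC powRrM powR_mulrn.
      apply: ler_powRN; rewrite ?exprn_gt0//; first by lra.
      rewrite -natrX ler_nat; apply: leq_trans (trunc_logP _ _) _ => //.
      by rewrite -addn1 leq_add// leq_nm.
    rewrite /gker (_ : - b = - (b / 3) * 3); last by field.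
    rewrite powRrM powR_mulrn ?powR_ge0// 2!exprS expr1 mulrA.
    by rewrite !ler_pM ?mulr_ge0 ?powR_ge0.
  rewrite iter_T_prod.
  have -> : (wcst q ^+ 3 * (q ^+ 3) ^+ trunc_log 4 j./2) = (wcst q * q ^+ trunc_log 4 j./2) ^+ 3.
    rewrite [RHS]exprMn; congr (_ * _).
    by rewrite -!exprM mulnC.
  rewrite [leRHS]exprS expr2 mulrA.
  have p0 z : 0 <= iter j (@coin R) (wgt q) z.
    rewrite -(iter_coin_cst j 0 z); apply: iter_coin_le => y.
    by rewrite exprn_ge0// ltW.
  by rewrite !ler_pM ?mulr_ge0//; exact: iter_coin_wgt_tail.
- exists (wcst q ^+ 3 * (2 + 6 / (1 - 4 * q ^+ 3))) => J.
  rewrite -mulr_sumr ler_wpM2l ?exprn_ge0//.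
  by apply: sum_tail; rewrite ?exprn_ge0 ?(ltW q0).
Qed.

End Green.

(** * Interacting and independent clusters *)

Section SumMem.
Variable R : realType.

Lemma ler_big_mem (I : eqType) (r : seq I) (P : pred I) (f : I -> R) x :
  (forall y, 0 <= f y) -> P x -> x \in r -> f x <= \sum_(y <- r | P y) f y.
Proof.
move=> f0 Px; elim: r => // y r IH; rewrite inE big_cons => /predU1P[<-|/IH{}IH].
  by rewrite Px lerDl sumr_ge0.
by case: ifP => // _; rewrite (le_trans IH)// lerDr.
Qed.

Lemma sum_fsubset (T : choiceType) (A B : {fset T}) (f : T -> R) : (A `<=` B)%fset ->
  \sum_(x <- B | x \in A) f x = \sum_(x <- A) f x.
Proof.
move=> /fsubsetP AB; rewrite -big_filter; apply: perm_big; apply: uniq_perm => [||x].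
- exact/filter_uniq/fset_uniq.
- exact: fset_uniq.
by rewrite mem_filter; case xA: (x \in A) => //; rewrite AB.
Qed.

End SumMem.

(** * One cluster in the presence of distant points *)

Section Compare.
Variables (R : realType) (beta b : R) (d m : nat) (A O : config d) (D1 D L : nat).
Hypothesis mA : (m < #|` A|)%N.
Hypothesis dA : diam_le D1 A.
Hypothesis D1D : (D1 + (2 * m + 2) <= D)%N.
Hypothesis far : forall x y, x \in A -> y \in O -> (L <= nm (x - y)%R)%N.
Hypothesis DL : (2 * d * D <= L)%N.
Hypothesis d_gt0 : (0 < d)%N.
Hypothesis beta_gt0 : 0 < beta.
Hypothesis b_beta : b <= beta.

Local Notation upd := (cat_update m).
Local Notation prb := (cat_choice_prob beta m).
Local Notation wt := (cat_weight beta).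
Local Notation chs := (@chs R d m).
Local Notation cvalid := (@cvalid R d m).
Local Notation Ex := (Ex beta m).
Local Notation C := (A `|` O)%fset.

Lemma L_ge : (2 * D <= L)%N.
Proof. by apply: leq_trans DL; rewrite leq_mul2r leq_pmulr// orbT. Qed.

Lemma D_ge : (2 * m + 2 <= D)%N.
Proof. by apply: leq_trans D1D; rewrite leq_addl. Qed.

Lemma far_near x y z a : x \in A -> y \in O -> (nm (z - x)%R <= m + 1)%N -> (nm (a - y)%R <= 1)%N ->
  (L <= 2 * nm (z - a)%R)%N.
Proof.
move=> xA yO zx ay; have := far xA yO.
have := nm_dist_trans z x y; have := nm_dist_trans a z y; rewrite nm_distC in zx.
have := L_ge; have := D_ge.
by move: zx ay; do 5!move: (nm _) => ?; lia.
Qed.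

Lemma disjAO x : x \in A -> x \notin O.
Proof.
move=> xA; apply/negP => xO; have := far xA xO; rewrite subrr nm0 leqn0 => /eqP L0.
by have := L_ge; have := D_ge; rewrite L0; lia.
Qed.

Lemma near_notinO z a : a \in A -> (nm (z - a)%R <= m + 1)%N -> z \notin O.
Proof.
move=> aA za; apply/negP => zO.
have := @far_near a z z z aA zO za; rewrite !subrr !nm0 => /(_ isT); rewrite leqn0 => /eqP L0.
by have := L_ge; have := D_ge; rewrite L0; lia.
Qed.

Lemma upd_cup s : cvalid A s -> upd C s = (upd A s `|` O)%fset.
Proof.
move=> /cvalid_take[_ tA]; apply/fsetP => x; rewrite inE !in_upd inE.
have [xO|xO] := boolP (x \in O); last by rewrite !orbF.
rewrite !orbT/=; case: (boolP (x \in take m s)) => // /tA/disjAO; by rewrite xO.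
Qed.

Lemma chs_near s y : cvalid A s -> (size s < 2 * m)%N -> y \in chs A s ->
  exists2 a, a \in A & (nm (y - a)%R <= m + 1)%N.
Proof.
move=> vs s2m yA; have v' : cvalid A (rcons s y) by apply/cvalid_rcons.
have [|a aA ya] := @cvalid_near R d m A _ v' y; first by rewrite mem_rcons inE eqxx.
exists a => //; apply: leq_trans ya _; rewrite size_rcons leq_subLR.
by rewrite addnA addnn -mul2n addn1 ltnW.
Qed.

Lemma chs_sub s y : cvalid A s -> (size s < 2 * m)%N -> y \in chs A s -> y \in chs C s.
Proof.
move=> vs s2m yA; have [a aA ya] := chs_near vs s2m yA.
have [sm|sm] := ltnP (size s) m.
  by move: yA; rewrite !in_chs_lt// inE => /andP[-> ->].
move: yA; rewrite !chs_ge// => /in_bdry[yu [x xu xy]]; apply/in_bdry; rewrite upd_cup//.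
split; first by rewrite inE negb_or yu (near_notinO aA ya).
by exists x => //; rewrite inE xu.
Qed.

Lemma cvalid_cup s : cvalid A s -> (size s <= 2 * m)%N -> cvalid C s.
Proof.
elim/last_ind: s => [_ _|s x IH]; first exact: cpath_nil.
rewrite size_rcons => /cvalid_rcons[vs xs] s2m; apply/cvalid_rcons; split; first exact/IH/ltnW.
exact: chs_sub.
Qed.

Lemma extra_near s y : cvalid A s -> y \in chs C s -> y \notin chs A s ->
  exists2 o, o \in O & (nm (y - o)%R <= 1)%N.
Proof.
move=> vs; have [sm|sm] := ltnP (size s) m.
  rewrite !in_chs_lt// inE => /andP[/orP[->|yO] ->] //= _.
  by exists y => //; rewrite subrr nm0.
rewrite !chs_ge// upd_cup// => /in_bdry[yu [x xu xy]] /negP yn.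
exists x; last exact: nm_enorm1 xy.
move: xu; rewrite inE => /orP[xu|//]; case: yn; apply/in_bdry.
by split; [move: yu; rewrite inE negb_or => /andP[]|exists x].
Qed.

(** Compares a weight at Euclidean distance at most d D with one at distance at least L/2. By [DL]
    the base is at most 1, so the exponent beta may be lowered to b. *)
Definition ratio : R := ((2 * d * D)%:R / L%:R) `^ b.

Lemma wt_extra s y z : (0 < size s)%N -> cvalid A s -> (size s < 2 * m)%N -> y \in chs A s ->
  z \in chs C s -> z \notin chs A s -> wt s z <= ratio * wt s y.
Proof.
case/lastP: s => // s x _ vs s2m yA zC zA; rewrite !wt_rcons.
have [w wO zw] := extra_near vs zC zA.
have [a aA ya] := chs_near vs s2m yA.
have [x' x'A xx'] : exists2 a, a \in A & (nm (x - a)%R <= m + 1)%N.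
  have [|e eA xe] := @cvalid_near R d m A _ vs x; first by rewrite mem_rcons inE eqxx.
  exists e => //; apply: leq_trans xe _; rewrite leq_subLR addnA addnn -mul2n addn1 ltnW//.
  exact: leqW.
have D0 : (0 < D)%N by apply: leq_trans D_ge; rewrite addn2.
have L0 : (0 < L)%N by apply: leq_trans L_ge; rewrite muln_gt0.
have xy : (nm (x - y)%R <= D)%N.
  have := dA x'A aA; have := nm_dist_trans x' x y; have := nm_dist_trans a x' y.
  rewrite nm_distC in ya.
  by have := D1D; move: xx' ya; do 5!move: (nm _) => ?; lia.
have xz : (L <= 2 * nm (x - z)%R)%N := far_near x'A wO xx' zw.
have h1 : (d * D)%:R `^ (- beta) <= phi beta x y.
  apply: phi_ge => //; first by rewrite ler1n muln_gt0 d_gt0.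
  by apply: le_trans (enorm_le_nm R _) _; rewrite natrM ler_wpM2l ?ler_nat.
have h2 : phi beta x z <= (L%:R / 2) `^ (- beta).
  apply: phi_le => //; first by rewrite divr_gt0 ?ltr0n.
  apply: le_trans (nm_le_enorm R _); rewrite ler_pdivrMr// -natrM ler_nat mulnC //.
apply: le_trans h2 _; apply: (@le_trans _ _ (ratio * (d * D)%:R `^ (- beta))); last first.
  by rewrite ler_wpM2l ?powR_ge0.
have dD0 : 0 < (d * D)%:R :> R by rewrite ltr0n muln_gt0 d_gt0.
rewrite !powRN ler_pdivlMr ?powR_gt0// mulrC ler_pdivrMr ?powR_gt0 ?divr_gt0 ?ltr0n//.
have -> : (d * D)%:R `^ beta = ((2 * d * D)%:R / L%:R) `^ beta * (L%:R / 2) `^ beta :> R.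
  rewrite -powRM ?divr_ge0//; congr (_ `^ _); rewrite !natrM; field.
  by rewrite pnatr_eq0 -lt0n.
rewrite ler_pM2r ?powR_gt0 ?divr_gt0 ?ltr0n//.
apply: ger_powR => //; rewrite divr_gt0 ?ltr0n ?muln_gt0 ?d_gt0//=.
by rewrite ler_pdivrMr ?ltr0n// mul1r ler_nat.
Qed.

Definition eta : R := (3 ^ d * #|` C|)%:R * ratio.

(** The other points add at most 3^d #|C| admissible sites, each of weight at most [ratio] times the
    normaliser for A. So the normaliser grows by at most the factor 1 + eta, and (1 - eta)(1 + eta)
    is at most 1. *)
Lemma prb_cmp s y : (0 < size s)%N -> cvalid A s -> (size s < 2 * m)%N -> y \in chs A s ->
  (1 - eta) * prb A s y <= prb C s y.
Proof.
move=> s0 vs s2m yA; have vC := cvalid_cup vs (ltnW s2m).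
rewrite !prbE yA chs_sub//.
set ZA := \sum_(z <- chs A s) _; set ZC := \sum_(z <- chs C s) _.
have ZA0 : 0 < ZA := sum_wt_gt0 beta yA.
have ZC0 : 0 < ZC by apply: (sum_wt_gt0 beta (y := y)); exact: chs_sub.
have w0 := ltW (wt_gt0 beta s y).
have wZ : wt s y <= ZA.
  exact: (@ler_big_mem R _ (enum_fset (chs A s)) xpredT (wt s) y (fun z => ltW (wt_gt0 beta s z)) isT yA).
have r0 : 0 <= ratio := powR_ge0 _ _.
have ZCA : ZC <= (1 + eta) * ZA.
  rewrite /ZC (bigID (mem (chs A s)))/= mulrDl mul1r; apply: lerD.
    by rewrite sum_fsubset//; apply/fsubsetP => z; exact: chs_sub.
  apply: (@le_trans _ _ (\sum_(z <- chs C s) ratio * ZA)).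
    rewrite big_mkcond big_seq [leRHS]big_seq; apply: ler_sum => z zC.
    case: ifPn => zA; last by rewrite mulr_ge0 ?(ltW ZA0).
    by rewrite (le_trans (wt_extra s0 vs s2m yA zC zA))// ler_wpM2l.
  rewrite big_const_seq count_predT iter_addr_0 -[_ *+ size _]mulr_natl mulrA.
  rewrite ler_wpM2r ?(ltW ZA0)// ler_wpM2r// ler_nat; apply: card_chs vC _; exact: ltnW.
have e0 : 0 <= eta by rewrite mulr_ge0.
rewrite mulrCA ler_wpM2l// ler_pdivrMr// [leRHS]mulrC ler_pdivlMr//.
have h1 : (1 - eta) * ZC <= (1 - eta) * (1 + eta) * ZA \/ (1 - eta) * ZC <= 0.
  have [e1|/ltW e1] := lerP eta 1; [left|right].
    by rewrite -mulrA ler_wpM2l// subr_ge0.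
  by rewrite mulr_le0_ge0 ?(ltW ZC0)// subr_le0.
have h2 : 0 <= eta * eta * ZA by rewrite !mulr_ge0 ?(ltW ZA0).
case: h1 => h1; lra.
Qed.

(** Only paths staying with the cluster A are kept. The path s is nonempty because the first point
    is uniform, not weighted by distance; [U_first] treats it separately. *)
Lemma Ex_cmp j s h : eta <= 1 -> (0 < size s)%N -> cvalid A s -> (size s + j <= 2 * m)%N ->
  (forall t, 0 <= h t) -> (1 - eta) ^+ j * Ex A j s h <= Ex C j s h.
Proof.
move=> e1 s0 vs sj h0; elim: j s s0 vs sj => [|j IH] s s0 vs sj /=; first by rewrite mul1r.
have s2m : (size s < 2 * m)%N by apply: leq_trans sj; rewrite addnS ltnS leq_addr.
apply: (@le_trans _ _ (\sum_(y <- chs A s) prb C s y * Ex C j (rcons s y) h)); last first.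
  rewrite [leRHS](bigID (mem (chs A s)))/= sum_fsubset ?lerDl; last first.
    by apply/fsubsetP => z; exact: chs_sub.
  by apply: sumr_ge0 => z _; rewrite mulr_ge0 ?prb_ge0 ?Ex_ge0.
rewrite mulr_sumr big_seq [leRHS]big_seq; apply: ler_sum => y yA.
rewrite exprS mulrACA; apply: ler_pM.
- by rewrite mulr_ge0 ?prb_ge0 ?subr_ge0.
- by rewrite mulr_ge0 ?exprn_ge0 ?subr_ge0 ?Ex_ge0.
- exact: prb_cmp.
apply: IH; rewrite ?size_rcons// ?addSnnS//.
exact/cvalid_rcons.
Qed.

End Compare.

(** * Independent clusters *)

Section Clusters.
Variables (R : realType) (beta : R) (d m : nat).
Variables (k : nat) (sz : nat -> nat).
Hypothesis sz_gt : forall i, (i < k)%N -> (m < sz i)%N.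
Hypothesis k_gt0 : (0 < k)%N.
Implicit Types (s : nat -> config d) (h : (nat -> config d) -> R).

Local Notation U := (U beta m).
Local Notation step := (step R m).
Local Notation reach := (reach beta m).

Definition total := \sum_(i < k) sz i.

Definition upd1 s (i : nat) (A : config d) : nat -> config d :=
  fun j => if j == i then A else s j.

Lemma upd1_id s i A : upd1 s i A i = A. Proof. by rewrite /upd1 eqxx. Qed.

Lemma upd1_upd1 s i A B : upd1 (upd1 s i A) i B = upd1 s i B.
Proof. by apply/funext => j; rewrite /upd1; case: eqP. Qed.

Lemma upd1_ne s i j A : j != i -> upd1 s i A j = s j.
Proof. by rewrite /upd1 => /negPf ->. Qed.

Definition cvld s := forall i, (i < k)%N -> #|` s i| = sz i.

(* The clusters evolve as independent CAT chains, one of them at a time. *)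
Definition Pt h s : R :=
  \sum_(i < k) (sz i)%:R / total%:R * U (fun A => h (upd1 s i A)) (s i).

Lemma total_gt0 : (0 < total)%N.
Proof.
rewrite /total (bigD1 (Ordinal k_gt0))//= addn_gt0.
by rewrite (leq_ltn_trans (leq0n m) (sz_gt k_gt0)).
Qed.

Lemma prob_ge0 i : 0 <= (sz i)%:R / total%:R :> R.
Proof. by rewrite divr_ge0. Qed.

Lemma Pt_le h h' s : (forall i A, (i < k)%N -> step (s i) A -> h (upd1 s i A) <= h' (upd1 s i A)) ->
  Pt h s <= Pt h' s.
Proof.
move=> hh; apply: ler_sum => i _; rewrite ler_wpM2l ?prob_ge0//.
by apply: U_le => A; exact: hh.
Qed.

Lemma Pt_lin (a : R) h h' s : Pt (fun s => a * h s + h' s) s = a * Pt h s + Pt h' s.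
Proof.
rewrite /Pt mulr_sumr -big_split/=; apply: eq_bigr => i _.
by rewrite U_lin; ring.
Qed.

(** What the dynamics can do deterministically in a bounded time. It confines comparisons of
    expectations to reachable families and makes the functionals below vary slowly. *)
Definition close_to (c : nat) s s' := forall i, (i < k)%N ->
  #|` s' i| = #|` s i| /\ forall x, x \in s' i -> exists2 y, y \in s i & (nm (x - y) <= c)%N.

Lemma close_refl s : close_to 0 s s.
Proof. by move=> i ik; split => // x xs; exists x; rewrite ?subrr ?nm0. Qed.

Lemma close_trans c c' s s' s'' : close_to c s s' -> close_to c' s' s'' -> close_to (c + c') s s''.
Proof.
move=> n1 n2 i ik; have [c1 h1] := n1 i ik; have [c2 h2] := n2 i ik.
split=> [|x /h2[y /h1[z zs yz] xy]]; first by rewrite c2.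
exists z => //; apply: leq_trans (nm_dist_trans y _ _) _.
by rewrite addnC leq_add.
Qed.

Lemma close_cvld c s s' : close_to c s s' -> cvld s -> cvld s'.
Proof. by move=> n1 cs i ik; rewrite (n1 i ik).1 cs. Qed.

Lemma close_step s i A : step (s i) A -> close_to m s (upd1 s i A).
Proof.
move=> sA j jk; have [->|ji] := eqVneq j i.
  by rewrite upd1_id (step_card sA); split => //; exact: step_near sA.
by rewrite upd1_ne//; split => // x xs; exists x; rewrite ?subrr ?nm0.
Qed.

Lemma iterPt_le t h h' s : (forall s', close_to (t * m) s s' -> h s' <= h' s') ->
  iter t Pt h s <= iter t Pt h' s.
Proof.
elim: t s => [|t IH] s hh /=; first exact/hh/close_refl.
apply: Pt_le => i A ik sA; apply: IH => s' ns'; apply: hh.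
by rewrite mulSn; apply: close_trans ns'; exact: close_step.
Qed.

Lemma iterPt_lin t (a : R) h h' s :
  iter t Pt (fun s => a * h s + h' s) s = a * iter t Pt h s + iter t Pt h' s.
Proof.
elim: t s => [//|t IH] s /=; rewrite -Pt_lin; congr Pt.
by apply/funext => s'; exact: IH.
Qed.

Lemma iterPt_ge0 t h s : (forall s, 0 <= h s) -> 0 <= iter t Pt h s.
Proof.
move=> h0; elim: t s => [//|t IH] s /=; apply: sumr_ge0 => i _.
by rewrite mulr_ge0 ?prob_ge0//; apply: U_ge0.
Qed.

Lemma iterPt_cst t (a : R) s (i0 : 'I_d) : cvld s -> iter t Pt (fun=> a) s = a.
Proof.
move=> cs; apply/eqP; elim: t s cs => [//|t IH] s cs /=.
have E : Pt (fun=> a) s = a.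
  rewrite /Pt; under eq_bigr => i _ do rewrite (U_cst _ _ i0) ?cs ?sz_gt//.
  rewrite -!mulr_suml -natr_sum divff ?mul1r// pnatr_eq0 -lt0n; exact: total_gt0.
rewrite -[X in _ == X]E eq_le; apply/andP; split; apply: Pt_le => i A ik sA;
  by rewrite (eqP (IH _ _))//; exact: close_cvld (close_step sA) cs.
Qed.

Lemma iterPt_sum t (T : eqType) (r : seq T) (f : T -> (nat -> config d) -> R) s :
  iter t Pt (fun s => \sum_(i <- r) f i s) s = \sum_(i <- r) iter t Pt (f i) s.
Proof.
elim: r => [|x r IH].
  rewrite big_nil; have -> : (fun s => \sum_(i <- [::]) f i s) = (fun=> 0 : R).
    by apply/funext => s'; rewrite big_nil.
  have := iterPt_lin t (- 1) (fun=> 0) (fun=> 0) s.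
  have -> : (fun=> -1 * 0 + 0) = (fun=> 0 : R) :> ((nat -> config d) -> R).
    by apply/funext => s'; rewrite mulr0 addr0.
  by rewrite mulN1r addNr.
rewrite big_cons -IH -[iter t Pt (f x) s]mul1r -iterPt_lin; congr (iter _ _ _ _).
by apply/funext => s'; rewrite big_cons mul1r.
Qed.

Definition trc (i : nat) (z : lattice d) s := upd1 s i (translate (s i) z).

(** Each cluster has a translation invariant law and does not see the others, so moving one of them
    alone commutes with the dynamics. *)
Lemma Pt_trc h i z s : Pt h (trc i z s) = Pt (fun s => h (trc i z s)) s.
Proof.
apply: eq_bigr => j _; congr (_ * _); rewrite /trc.
have [->|ji] := eqVneq (j : nat) i.
  rewrite upd1_id U_translate; apply: U_ext => A.
  by rewrite !upd1_upd1 upd1_id.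
rewrite upd1_ne//; apply: U_ext => A; congr h; apply/funext => l.
rewrite /upd1; have [->|lj] := eqVneq l j; first by rewrite (negPf ji).
by case: ifP => // /eqP li; rewrite eq_sym (negPf ji).
Qed.

Lemma iterPt_trc t h i z s : iter t Pt h (trc i z s) = iter t Pt (fun s => h (trc i z s)) s.
Proof.
elim: t s => [//|t IH] s /=; rewrite Pt_trc; congr Pt.
by apply/funext => s'; exact: IH.
Qed.

(** Keep the event that cluster i is selected every time; each selection has probability at least
    1/total. *)
Lemma iterPt_ge_iterU t i h s : (i < k)%N -> (forall s, 0 <= h s) ->
  total%:R^-1 ^+ t * iter t U (fun A => h (upd1 s i A)) (s i) <= iter t Pt h s.
Proof.
move=> ik h0; have sz1 : (1 <= sz i)%N by rewrite (leq_ltn_trans _ (sz_gt ik)).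
elim: t s => [|t IH] s; first by rewrite /= mul1r /upd1 (_ : (fun j => if _ then _ else _) = s)//;
  apply/funext => j; case: eqP => [->|].
have -> : iter t.+1 Pt h s =
    \sum_(j < k) (sz j)%:R / total%:R * U (fun A => iter t Pt h (upd1 s j A)) (s j) by [].
rewrite (bigD1 (Ordinal ik))//= -[leLHS]addr0 lerD//; last first.
  apply: sumr_ge0 => j _; rewrite mulr_ge0 ?prob_ge0//; apply: U_ge0 => A; exact: iterPt_ge0.
rewrite exprS -mulrA; apply: ler_pM.
- by rewrite invr_ge0.
- by rewrite mulr_ge0 ?exprn_ge0 ?invr_ge0//; apply: U_ge0 => A; exact: iterU_ge0.
- by rewrite -[leLHS]mul1r ler_wpM2r ?invr_ge0// ler1n.
rewrite -U_scale.
apply: U_le => A sA; have := IH (upd1 s i A); rewrite upd1_id.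
by under [X in iter t U X]eq_fun do rewrite upd1_upd1.
Qed.

Variables (i0 i1 i2 : 'I_d).
Local Notation N := (mixing_time m).
Local Notation line := (@line d i0).
Local Notation T := (@T R d i0 i1 i2).
Local Notation shift3 := (@shift3 d i0 i1 i2).
Variable c : R.
Hypothesis c_gt0 : 0 < c.
Hypothesis doeb : forall i C, (i < k)%N -> #|` C| = sz i ->
  exists p, forall r, reach N c C (line (p + shift3 r) (sz i)).

Definition eps : R := total%:R^-1 ^+ N * c.

Lemma eps_gt0 : 0 < eps.
Proof. by rewrite mulr_gt0// exprn_gt0// invr_gt0 ltr0n total_gt0. Qed.

Lemma block_reach i s : (i < k)%N -> cvld s -> exists p, forall r h,
  (forall s, 0 <= h s) -> eps * h (upd1 s i (line (p + shift3 r) (sz i))) <= iter N Pt h s.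
Proof.
move=> ik cs; have [p hp] := doeb ik (cs i ik); exists p => r h h0.
apply: le_trans (iterPt_ge_iterU N s ik h0); rewrite /eps -mulrA.
rewrite ler_wpM2l ?exprn_ge0 ?invr_ge0//; exact: hp.
Qed.

Lemma sum_bool3 (a : R) : \sum_(r : bool * bool * bool) a = 8 * a.
Proof. by rewrite sumr_const !card_prod card_bool mulr_natl. Qed.

(** Averaging the eight bounds of [block_reach]: with weight eps, a block replaces s by a uniform
    {0,1}^3 shift of cluster i in a family s' that does not depend on h. *)
Lemma block_avg i s : (i < k)%N -> cvld s -> exists2 s', cvld s' & forall h, (forall s, 0 <= h s) ->
  eps * (8^-1 * \sum_(r : bool * bool * bool) h (trc i (shift3 r) s')) <=
    iter N Pt h s.
Proof.
move=> ik cs; have [p hp] := block_reach ik cs.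
exists (upd1 s i (line p (sz i))).
  move=> j jk; have [->|ji] := eqVneq j i; last by rewrite upd1_ne// cs.
  by rewrite upd1_id card_ray.
move=> h h0; rewrite mulrCA ler_pdivrMl// -sum_bool3 mulr_sumr.
apply: ler_sum => r _.
rewrite /trc upd1_id upd1_upd1.
apply: le_trans (hp r h h0); rewrite ler_pM2l ?eps_gt0//.
by rewrite [line (p + _) _]line_translate [line p _]line_translate translateD.
Qed.

Definition fpair (i j : nat) (g : lattice d -> R) s : R :=
  \sum_(a <- s i) \sum_(b <- s j) g (a - b).

(** A uniform shift of cluster i alone is one step of the walk [T] for all differences between
    clusters i and j. *)
Lemma fpair_trc i j g s : i != j ->
  8^-1 * \sum_(r : bool * bool * bool) fpair i j g (trc i (shift3 r) s)
  = fpair i j (T g) s.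
Proof.
move=> ij; rewrite /fpair; under [RHS]eq_bigr => a _ do rewrite /T -mulr_sumr exchange_big.
rewrite -mulr_sumr exchange_big /=; congr (_ * _); apply: eq_bigr => r _.
rewrite /trc upd1_id upd1_ne 1?eq_sym// big_translate.
by apply: eq_bigr => a _; apply: eq_bigr => b _; rewrite addrAC.
Qed.

Lemma fpair_ge0 i j (g : lattice d -> R) s : (forall x, 0 <= g x) -> 0 <= fpair i j g s.
Proof. by move=> g0; do 2 (apply: sumr_ge0 => ? _). Qed.

Lemma fpair_le i j (g : lattice d -> R) s (B : R) : (i < k)%N -> (j < k)%N -> cvld s ->
  (forall x, g x <= B) -> fpair i j g s <= (sz i * sz j)%:R * B.
Proof.
move=> ik jk cs gB.
apply: (@le_trans _ _ (\sum_(a <- s i) \sum_(b <- s j) B)).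
  by apply: ler_sum => a _; apply: ler_sum => b _.
by rewrite !big_const_seq !count_predT !iter_addr_0 cs// cs// mulr_natl -mulrnA mulnC.
Qed.

Section Summation.
Variables (g : lattice d -> R) (B : nat -> R).
Hypothesis g_ge0 : forall x, 0 <= g x.
Hypothesis B_ge0 : forall j, 0 <= B j.
Hypothesis gB : forall j x, iter j T g x <= B j.

(* Each block of N steps moves a given cluster by a uniform shift of {0,1}^3 with
   probability at least eps, and arbitrarily otherwise; M counts the shifts made. *)
Fixpoint mixed n M : R := if n is n'.+1 then eps * mixed n' M.+1 + (1 - eps) * mixed n' M else B M.

Definition block h := iter N Pt h.

Lemma iter_block n h : iter n block h = iter (n * N) Pt h.
Proof. by elim: n => // n IH; rewrite iterS IH mulSn iterD. Qed.

(** By induction A * mixed n M - H is nonnegative, so [block_avg] applies to it. The averaged shift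
    commutes with the remaining n blocks and turns [iter M T g] into [iter M.+1 T g], which yields
    the recursion defining [mixed]. *)
Lemma block_mixed n M i j s : (i < k)%N -> (j < k)%N -> i != j -> cvld s ->
  iter n block (fpair i j (iter M T g)) s <= (sz i * sz j)%:R * mixed n M.
Proof.
move=> ik jk ij; elim: n M s => [|n IH] M s cs /=; first exact: fpair_le.
set A : R := (sz i * sz j)%:R; set H := iter n block _.
(* Set to zero on families of the wrong sizes, since [block_avg] asks for a function that is
   nonnegative everywhere. *)
pose h' s : R := if `[< cvld s >] then A * mixed n M - H s else 0.
have h'0 s' : 0 <= h' s'.
  by rewrite /h'; case: asboolP => // cs'; rewrite subr_ge0; exact: IH.
have [sL csL hL] := block_avg ik cs; have := hL _ h'0.
have -> : iter N Pt h' s = A * mixed n M - block H s.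
  have <- : iter N Pt (fun s => -1 * H s + A * mixed n M) s = A * mixed n M - block H s.
    by rewrite iterPt_lin iterPt_cst// mulN1r addrC.
  apply/eqP; rewrite eq_le; apply/andP; split; apply: iterPt_le => s' /close_cvld/(_ cs) cs';
    by rewrite /h' asboolT// mulN1r addrC.
have -> : 8^-1 * \sum_(r : bool * bool * bool) h' (trc i (shift3 r) sL) =
    A * mixed n M - iter n block (fpair i j (iter M.+1 T g)) sL.
  have ct r : cvld (trc i (shift3 r) sL).
    move=> l lk; rewrite /trc; have [->|li] := eqVneq l i; last by rewrite upd1_ne// csL.
    by rewrite upd1_id card_translate csL.
  under eq_bigr => r _ do rewrite /h' asboolT// addrC.
  rewrite big_split/= sum_bool3 mulrDr.
  have -> : 8^-1 * (8 * (A * mixed n M)) = A * mixed n M by field.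
  rewrite addrC; congr (_ + _).
  rewrite sumrN mulrN; congr (- _).
  have -> : fpair i j (T (iter M T g)) = (fun s => \sum_(r : bool * bool * bool) (8^-1 * fpair i j (iter M T g) (trc i (shift3 r) s))).
    by apply/funext => s'; rewrite -fpair_trc// mulr_sumr.
  rewrite iter_block iterPt_sum mulr_sumr; apply: eq_bigr => r _.
  rewrite /H iter_block iterPt_trc.
  have := iterPt_lin (n * N) 8^-1 (fun s => fpair i j (iter M T g) (trc i (shift3 r) s)) (fun=> 0) sL.
  rewrite iterPt_cst// addr0 => <-; congr (iter _ _ _ _).
  by apply/funext => s'; rewrite addr0.
have := IH M.+1 sL csL; rewrite -/A; move: (iter n block _ sL) => u hu hle.
have e0 := eps_gt0.
have : eps * (A * mixed n M - A * mixed n M.+1) <= A * mixed n M - block H s.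
  by apply: le_trans hle; rewrite ler_wpM2l ?(ltW e0)// lerD2l lerN2.
rewrite /H; lra.
Qed.

Lemma eps_le1 s : cvld s -> eps <= 1.
Proof.
move=> cs; have [p hp] := block_reach k_gt0 cs.
have := hp (false, false, false) (fun=> 1) (fun=> ler01).
by rewrite iterPt_cst// mulr1.
Qed.

Lemma mixed_ge0 n M : eps <= 1 -> 0 <= mixed n M.
Proof.
move=> e1; elim: n M => [|n IH] M //=.
by rewrite addr_ge0 ?mulr_ge0 ?subr_ge0// ltW ?eps_gt0.
Qed.

(** The shift counter stays at each value for a geometric time of mean 1/eps. In the proof,
    splitting off the first block bounds the sum by itself times 1 - eps plus the remaining terms,
    and this is solved for the sum. *)
Lemma sum_mixed n M : eps <= 1 ->
  \sum_(l <- iota 0 n) mixed l M <= eps^-1 * \sum_(j <- iota M n) B j.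
Proof.
move=> e1; have e0 := eps_gt0.
elim: n M => [|n IH] M; first by rewrite !big_nil mulr0.
have E : \sum_(l <- iota 0 n.+1) mixed l M =
    B M + eps * (\sum_(l <- iota 0 n) mixed l M.+1) + (1 - eps) * \sum_(l <- iota 0 n) mixed l M.
  rewrite /= big_cons /= -addrA; congr (_ + _).
  rewrite (iotaDl 1 0) big_map !mulr_sumr -big_split/=.
  by apply: eq_bigr.
have L : \sum_(l <- iota 0 n) mixed l M <= \sum_(l <- iota 0 n.+1) mixed l M.
  by rewrite -[n.+1]addn1 iotaD big_cat /= lerDl big_seq1 mixed_ge0.
have H := IH M.+1.
have -> : \sum_(j <- iota M n.+1) B j = B M + \sum_(j <- iota M.+1 n) B j by rewrite /= big_cons.
set s1 := \sum_(l <- iota 0 n.+1) _ in E L *; set s0 := \sum_(l <- iota 0 n) mixed l M in E L.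
have : eps * s1 <= B M + eps * (eps^-1 * \sum_(j <- iota M.+1 n) B j).
  have h1 : (1 - eps) * s0 <= (1 - eps) * s1 by rewrite ler_wpM2l// subr_ge0.
  have h2 := ler_wpM2l (ltW e0) H; lra.
by rewrite mulrA divff ?gt_eqF// mul1r -ler_pdivlMl.
Qed.

End Summation.

(** * The Lyapunov function and its total expectation *)

Definition diam (A : config d) : nat := \max_(x <- A) \max_(y <- A) nm (x - y).

Lemma diam_ub A x y : x \in A -> y \in A -> (nm (x - y) <= diam A)%N.
Proof.
move=> xA yA; rewrite /diam; apply: leq_trans (leq_bigmax_seq _ xA isT).
by apply: (@bigop.leq_bigmax_seq _ (enum_fset A) xpredT (fun y => nm (x - y))).
Qed.

Lemma diam_leP A B : diam_le B A -> (diam A <= B)%N.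
Proof.
move=> h; apply/bigmax_leqP_seq => x xA _; apply/bigmax_leqP_seq => y yA _; exact: h.
Qed.

Variable D0 : nat.
Hypothesis D0_gt0 : (0 < D0)%N.
Variable b : R.
Hypothesis b23 : 2 < b < 3.

Lemma b_ge0 : 0 <= b.
Proof. by case/andP: b23 => b2 _; lra. Qed.

Definition spreadD s : nat := (D0 + \max_(i < k) diam (s i))%N.

Lemma spreadD_close t s s' : close_to t s s' -> (spreadD s' <= spreadD s + 2 * t)%N.
Proof.
move=> n1; rewrite /spreadD -addnA leq_add2l; apply/bigmax_leqP => i _.
apply: diam_leP => x y xs ys; have [_ hi] := n1 i (ltn_ord i).
have [x' x's xx'] := hi x xs; have [y' y's yy'] := hi y ys.
apply: leq_trans (nm_dist_trans x' _ _) _; apply: leq_trans (leq_add xx' (nm_dist_trans y' _ _)) _.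
rewrite nm_distC in yy'; apply: leq_trans (leq_add (leqnn _) (leq_add (diam_ub x's y's) yy')) _.
rewrite addnCA leq_add//; last by rewrite mul2n addnn.
exact: (leq_bigmax i).
Qed.

Definition diffs s : seq (lattice d) :=
  [seq p.1 - p.2 | p <- flatten [seq flatten [seq [seq (a, b) | a <- s i, b <- s j] | j <- iota 0 k & j != i] | i <- iota 0 k]].

Lemma diffsP s x : reflect (exists i j a b, [/\ (i < k)%N, (j < k)%N, j != i, a \in s i & b \in s j /\ x = a - b])
  (x \in diffs s).
Proof.
apply: (iffP mapP) => [[p /flatten_mapP[i]]|].
  rewrite mem_iota => /andP[_ ik] /flatten_mapP[j]; rewrite mem_filter mem_iota => /and3P[ji _ jk].
  move=> /allpairsP[[a b'] [/= as' bs ->]] ->.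
  by exists i, j, a, b'.
move=> [i [j [a [b' [ik jk ji as' [bs ->]]]]]]; exists (a, b') => //.
apply/flatten_mapP; exists i; first by rewrite mem_iota.
apply/flatten_mapP; exists j; first by rewrite mem_filter ji mem_iota.
by apply/allpairsP; exists (a, b').
Qed.

Definition gk : lattice d -> R := gker b D0.

Lemma gk_gt0 x : 0 < gk x.
Proof. by rewrite powR_gt0// ltr0n addn_gt0 D0_gt0 orbT. Qed.

(** The power -b of the smallest distance between two clusters, offset by [D0]. *)
Definition G s : R := \big[Num.max/0]_(x <- diffs s) gk x.

Lemma G_ge s x : x \in diffs s -> gk x <= G s.
Proof. by move=> xs; exact: (@le_bigmax_seq _ _ _ _ _ x predT gk xs isT). Qed.

Lemma G_ge0 s : 0 <= G s.
Proof. by rewrite /G; elim/big_ind: _ => // [x y x0 y0|x _]; [rewrite le_max x0|exact/ltW/gk_gt0]. Qed.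

Lemma G_le s B : 0 <= B -> (forall x, x \in diffs s -> gk x <= B) -> G s <= B.
Proof.
move=> B0 h; rewrite /G big_seq; elim/big_ind: _ => [//|x y x0 y0|x xs]; last exact: h.
by rewrite ge_max x0.
Qed.

(** The factor by which the power b of a length offset by [D0] can change when the length changes by
    t; it tends to 1 as [D0] grows. *)
Definition rho t : R := (1 + t%:R / D0%:R) `^ b.

Lemma rho_ge1 t : 1 <= rho t.
Proof.
have -> : 1 = 1 `^ b :> R by rewrite powR1.
by apply: (ge0_ler_powR b_ge0); rewrite ?nnegrE ?lerDl ?addr_ge0 ?divr_ge0.
Qed.

Lemma powR_ratio (u v : nat) t : (0 < u)%N -> (D0 <= u)%N -> (v <= u + t)%N -> v%:R <= (1 + t%:R / D0%:R) * u%:R :> R.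
Proof.
move=> u0 Du vu; apply: (@le_trans _ _ (u%:R + t%:R)); first by rewrite -natrD ler_nat.
rewrite mulrDl mul1r lerD2l mulrAC ler_pdivlMr ?ltr0n// -!natrM ler_nat.
by rewrite leq_mul2l Du orbT.
Qed.

Lemma gk_slow x y t : (nm x <= nm y + t)%N -> gk y <= rho t * gk x.
Proof.
move=> xy; have Dp (z : lattice d) : (0 < nm z + D0)%N by rewrite addn_gt0 D0_gt0 orbT.
have h := @powR_ratio (nm y + D0) (nm x + D0) t (Dp y) (leq_addl _ _) _.
have {}h : (nm x + D0)%:R <= (1 + t%:R / D0%:R) * (nm y + D0)%:R :> R by apply: h; lia.
have r0 : 0 < 1 + t%:R / D0%:R :> R by rewrite ltr_pwDl// divr_ge0.
rewrite /gk /gker /rho !powRN -ler_pdivrMr ?invr_gt0 ?powR_gt0 ?ltr0n// invrK mulrC ler_pdivrMr ?powR_gt0 ?ltr0n//.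
rewrite -powRM ?(ltW r0)//.
by apply: (ge0_ler_powR b_ge0); rewrite ?nnegrE ?mulr_ge0 ?(ltW r0).
Qed.

Lemma G_close t s s' : close_to t s s' -> G s' <= rho (2 * t) * G s.
Proof.
move=> n1; have r0 := le_trans ler01 (rho_ge1 (2 * t)).
apply: G_le => [|x /diffsP[i [j [a [b' [ik jk ji as' [bs ->]]]]]]]; first by rewrite mulr_ge0 ?G_ge0.
have [_ /(_ a as')[a' a's aa']] := n1 i ik; have [_ /(_ b' bs)[b'' b's bb']] := n1 j jk.
apply: (@le_trans _ _ (rho (2 * t) * gk (a' - b''))); last first.
  by rewrite ler_wpM2l// G_ge//; apply/diffsP; exists i, j, a', b''.
apply: gk_slow; apply: leq_trans (nm_dist_trans a _ _) _; rewrite nm_distC in aa'.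
apply: leq_trans (leq_add aa' (nm_dist_trans b' _ _)) _.
by rewrite mul2n -addnn addnCA leq_add2l leq_add2l.
Qed.

(* F0 bounds the interaction of the clusters in one step up to the factor cmpC;
   D0 is chosen large enough for it to vary slowly. *)
Definition F0 s : R := (spreadD s)%:R `^ b * G s.

Lemma F0_ge0 s : 0 <= F0 s.
Proof. by rewrite mulr_ge0 ?powR_ge0 ?G_ge0. Qed.

Lemma spreadD_gt0 s : (0 < spreadD s)%N.
Proof. by rewrite addn_gt0 D0_gt0. Qed.

Lemma F0_close t s s' : close_to t s s' -> F0 s' <= rho (2 * t) ^+ 2 * F0 s.
Proof.
move=> n1; rewrite /F0 expr2 mulrACA.
apply: ler_pM; rewrite ?powR_ge0 ?G_ge0 ?G_close//.
rewrite /rho -powRM ?addr_ge0 ?divr_ge0//.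
apply: (ge0_ler_powR b_ge0); rewrite ?nnegrE ?mulr_ge0 ?addr_ge0 ?divr_ge0//.
by apply: powR_ratio (spreadD_gt0 _) (leq_addr _ _) (spreadD_close n1).
Qed.

Hypothesis sz_le : forall i, (i < k)%N -> (sz i <= 2 * m + 1)%N.

Definition K := (k * N)%N.

(** The clusters are straightened one after the other, one block each, so [K] steps and probability
    eps^k suffice. *)
Lemma collapse_block s : cvld s -> exists2 s', (spreadD s' <= D0 + (2 * m + 1))%N &
  forall h, (forall s, 0 <= h s) -> eps ^+ k * h s' <= iter K Pt h s.
Proof.
move=> cs; suff H j : (j <= k)%N -> forall s, cvld s -> exists s', [/\ cvld s',
    forall i, (i < j)%N -> exists p, s' i = line p (sz i),
    forall i, (j <= i)%N -> s' i = s i &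
    forall h, (forall s, 0 <= h s) -> eps ^+ j * h s' <= iter (j * N) Pt h s].
  have [s' [cs' hl _ hr]] := H k (leqnn k) s cs; exists s' => //.
  rewrite leq_add2l; apply/bigmax_leqP => i _; have [p ->] := hl i (ltn_ord i).
  apply: leq_trans (diam_leP (@diam_ray d i0 p 0 (sz i))) _; exact: sz_le.
elim: j => [_ {}s {}cs|j IH jk {}s {}cs].
  by exists s; split=> // h h0; rewrite expr0 mul1r.
have [p hp] := block_reach jk cs.
set s1 := upd1 s j (line (p + shift3 (false, false, false)) (sz j)).
have cs1 : cvld s1.
  move=> i ik; have [->|ij] := eqVneq i j; last by rewrite /s1 upd1_ne// cs.
  by rewrite /s1 upd1_id card_ray.
have [s' [cs' hl he hr]] := IH (ltnW jk) s1 cs1.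
exists s'; split => //.
- move=> i; rewrite ltnS leq_eqVlt => /predU1P[->|/hl//].
  by rewrite he// /s1 upd1_id; eexists.
- by move=> i ji; rewrite he ?(ltnW ji)// /s1 upd1_ne// neq_ltn ji orbT.
move=> h h0; rewrite mulSn iterD exprS -mulrA.
apply: le_trans (hp (false, false, false) _ _); last by move=> s2; exact: iterPt_ge0.
by rewrite ler_pM2l ?eps_gt0//; exact: hr.
Qed.

(** After a collapse, the diameter factor is bounded and only a multiple of [G] remains; otherwise
    [F0] has grown by at most rho^2. The second case has probability at most 1 - eps^k. *)
Lemma F0_block s : cvld s -> iter K Pt F0 s <=
  (1 - eps ^+ k) * rho (2 * (K * m)) ^+ 2 * F0 s +
  (D0 + (2 * m + 1))%:R `^ b * rho (2 * (K * m)) * G s.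
Proof.
move=> cs; set r := rho _; have [s1 ds1 h1] := collapse_block cs.
pose I s : R := (spreadD s <= D0 + (2 * m + 1))%N%:R.
set C1 : R := _ `^ b; have r1 : 1 <= r := rho_ge1 _.
have Ige : eps ^+ k <= iter K Pt I s.
  by have := h1 I (fun s => ler0n _ _); rewrite /I ds1 mulr1.
have Ile : iter K Pt I s <= 1.
  rewrite -[leRHS](iterPt_cst K 1 i0 cs); apply: iterPt_le => s' _.
  by rewrite /I; case: leqP.
have step1 : iter K Pt F0 s <= iter K Pt (fun s' => (C1 * r * G s - r ^+ 2 * F0 s) * I s' + r ^+ 2 * F0 s) s.
  apply: iterPt_le => s' /[dup] cl /F0_close hF; rewrite /I.
  have [le|_] := leqP; last by rewrite mulr0 add0r.
  rewrite mulr1 subrK /F0 -mulrA; apply: ler_pM; rewrite ?powR_ge0 ?G_ge0 ?(G_close cl)//.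
  by apply: (ge0_ler_powR b_ge0); rewrite ?nnegrE ?ler_nat.
apply: le_trans step1 _.
rewrite (iterPt_lin K _ I (fun=> r ^+ 2 * F0 s)) iterPt_cst//.
move: (iter K Pt I s) Ige Ile => u u1 u2.
have a0 : 0 <= C1 * r * G s by rewrite !mulr_ge0 ?powR_ge0 ?G_ge0 ?(le_trans ler01 r1).
have b0 : 0 <= r ^+ 2 * F0 s by rewrite mulr_ge0 ?exprn_ge0 ?F0_ge0 ?(le_trans ler01 r1).
have h2 : (r ^+ 2 * F0 s) * eps ^+ k <= (r ^+ 2 * F0 s) * u by rewrite ler_wpM2l.
have h3 : (C1 * r * G s) * u <= (C1 * r * G s) * 1 by rewrite ler_wpM2l.
rewrite -mulrA; lra.
Qed.

Lemma close_le t t' s s' : (t <= t')%N -> close_to t s s' -> close_to t' s s'.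
Proof.
move=> tt' h i ik; have [-> hx] := h i ik; split => // x /hx[y ys xy].
by exists y => //; apply: leq_trans xy tt'.
Qed.

Lemma small_tail (u : nat -> R) (M e : R) : (forall l, 0 <= u l) ->
  (forall n, \sum_(l <- iota 0 n) u l <= M) -> 0 < e ->
  exists L, forall n, \sum_(l <- iota L n) u l <= e.
Proof.
move=> u0 uM e0; pose S := range (fun n => \sum_(l <- iota 0 n) u l).
have hS : has_sup S.
  split; first by exists 0; exists 0%N; rewrite // big_nil.
  by exists M => _ [n _ <-].
have [_ [L _ <-] hL] := sup_adherent e0 hS; exists L => n.
have : \sum_(l <- iota 0 (L + n)) u l <= sup S by apply: ub_le_sup; [case: hS|exists (L + n)%N].
rewrite iotaD big_cat/= add0n; lra.
Qed.

Lemma sum_iotaS (f : nat -> R) n :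
  \sum_(l <- iota 0 n.+1) f l = \sum_(l <- iota 0 n) f l + f n.
Proof. by rewrite -addn1 iotaD big_cat /= big_seq1. Qed.

Lemma Gsum_bound : i0 != i1 -> i0 != i2 -> i1 != i2 -> forall s, cvld s ->
  exists a : nat -> R, [/\ forall n, 0 <= a n,
    exists M, forall n, \sum_(l <- iota 0 n) a l <= M &
    forall n s, cvld s -> iter (n * N) Pt G s <= a n].
Proof.
move=> i01 i02 i12 s0 cs0; have e1 := eps_le1 cs0; have /andP[b2 b3] := b23.
have [B [B0 gB [M hM]]] := green i01 i02 i12 b2 b3 D0_gt0.
pose A : R := \sum_(i <- iota 0 k) \sum_(j <- iota 0 k | j != i) (sz i * sz j)%:R.
have A0 : 0 <= A by do 2 (apply: sumr_ge0 => ? _).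
exists (fun n => A * mixed B n 0); split.
- by move=> n; rewrite mulr_ge0 ?mixed_ge0.
- exists (A * (eps^-1 * M)) => n; rewrite -mulr_sumr ler_wpM2l//.
  apply: le_trans (sum_mixed B0 n 0 e1) _.
  by rewrite ler_wpM2l ?invr_ge0 ?(ltW eps_gt0).
move=> n s cs.
apply: (@le_trans _ _ (iter (n * N) Pt (fun s => \sum_(i <- iota 0 k) \sum_(j <- iota 0 k | j != i) fpair i j gk s) s)).
  apply: iterPt_le => s' _; apply: G_le => [|x /diffsP[i [j [a [b' [ik jk ji as' [bs ->]]]]]]].
    by do 2 (apply: sumr_ge0 => ? _); apply: fpair_ge0 => x; exact/ltW/gk_gt0.
  have gk0 y := ltW (gk_gt0 y); have f0 i' j' := fun s => @fpair_ge0 i' j' gk s gk0.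
  apply: le_trans (ler_big_mem (x := i) _ _ _); rewrite ?mem_iota//; last first.
    by move=> i'; apply: sumr_ge0.
  apply: le_trans (ler_big_mem (x := j) _ _ _); rewrite ?mem_iota//.
  apply: le_trans (ler_big_mem (x := a) _ _ _) => //; last by move=> y; apply: sumr_ge0.
  exact: (ler_big_mem (f := fun b => gk (a - b))).
rewrite iterPt_sum /A mulr_suml big_seq [leRHS]big_seq; apply: ler_sum => i; rewrite mem_iota => ik.
under eq_fun do rewrite -big_filter.
rewrite iterPt_sum big_filter mulr_suml.
rewrite big_seq_cond [leRHS]big_seq_cond; apply: ler_sum => j /andP[]; rewrite mem_iota => jk ji.
rewrite -iter_block; apply: (@block_mixed gk B gB n 0) => //.
by rewrite eq_sym.
Qed.

(** Summing the recursion of [F0_block] bounds the sum of [F0] by its initial value and the sum of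
    [G] over blocks. The latter is small at late times as the tail of a convergent series, and at
    the finitely many early times because [G] starts below g and varies slowly. *)
Lemma sum_F0 : i0 != i1 -> i0 != i2 -> i1 != i2 ->
  (1 - eps ^+ k) * rho (2 * (K * m)) ^+ 2 < 1 ->
  forall (M : nat) (e : R), 0 < e -> exists2 g, 0 < g & forall s, cvld s ->
    (spreadD s <= M)%N -> G s <= g -> forall n, \sum_(t <- iota 0 n) iter t Pt F0 s <= e.
Proof.
move=> i01 i02 i12; set la := (_ * _) => la1 M e e0.
have [[s0 cs0]|ncs] := pselect (exists s, cvld s); last first.
  by exists 1 => // s cs; case: ncs; exists s.
have [a [a0 [M' aM] aG]] := Gsum_bound i01 i02 i12 cs0.
set C1 : R := (D0 + (2 * m + 1))%:R `^ b * rho (2 * (K * m)).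
have C10 : 0 <= C1 by rewrite mulr_ge0 ?powR_ge0 ?(le_trans ler01 (rho_ge1 _)).
pose r2 := rho (2 * (K * m)) ^+ 2; have r20 : 0 < r2 by rewrite exprn_gt0// (lt_le_trans ltr01 (rho_ge1 _)).
have la0 : 0 <= la.
  have e1 := eps_le1 cs0; rewrite mulr_ge0 ?(ltW r20)// subr_ge0 exprn_ile1// ltW ?eps_gt0//.
have Kg : (0 < K)%N by rewrite muln_gt0 k_gt0 /mixing_time addn_gt0 orbT.
(* The bounds a are indexed by blocks of N steps, while [F0] is followed over K = k N steps. *)
have uM n : \sum_(l <- iota 0 n) a (l * k)%N <= M'.
  apply: le_trans (aM (n * k)%N); elim: n => [|n IH]; first by rewrite !big_nil.
  rewrite sum_iotaS mulSnr iotaD big_cat /= add0n; apply: lerD => //.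
  by apply: ler_big_mem => //; rewrite mem_iota leqnn -[ltnLHS]addn0 ltn_add2l k_gt0.
have [q q0 qE] : exists2 q, 0 < q & K%:R * r2 / (1 - la) = q.
  exists (K%:R * r2 / (1 - la)) => //; apply: divr_gt0; last by rewrite subr_gt0.
  by apply: mulr_gt0 => //; rewrite ltr0n.
have C11 : 0 < C1 + 1 by rewrite ltr_pwDr.
have e'0 : 0 < e / (2 * q * (C1 + 1)) by rewrite divr_gt0// !mulr_gt0.
have [L hL] := small_tail (fun l => a0 (l * k)%N) uM e'0.
pose W := \sum_(l <- iota 0 L) rho (2 * (l * K * m)).
have W0 : 0 <= W by apply: sumr_ge0 => l _; rewrite (le_trans ler01 (rho_ge1 _)).
have MW : 0 < M%:R `^ b + C1 * W + 1 by rewrite ltr_pwDr// addr_ge0 ?powR_ge0 ?(mulr_ge0 C10 W0).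
(* This g makes the contribution of the initial values and early times at most e/2; the choice of L
   does the same for the tail. *)
exists (e / (2 * q * (M%:R `^ b + C1 * W + 1))); first by rewrite divr_gt0// !mulr_gt0.
set g := e / _ => s cs sM sg n.
have g0 : 0 <= g by rewrite ltW// divr_gt0// !mulr_gt0.
pose gl l := iter (l * K) Pt G s; pose f l := iter (l * K) Pt F0 s.
have f_ge0 l : 0 <= f l by apply: iterPt_ge0 => s'; exact: F0_ge0.
have gl_ge0 l : 0 <= gl l by apply: iterPt_ge0 => s'; exact: G_ge0.
have gla l : gl l <= a (l * k)%N by rewrite /gl mulnA; exact: aG.
have glr l : gl l <= rho (2 * (l * K * m)) * g.
  apply: (@le_trans _ _ (rho (2 * (l * K * m)) * G s)); last first.
    by rewrite ler_wpM2l ?(le_trans ler01 (rho_ge1 _)).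
  rewrite -[leRHS](iterPt_cst (l * K) _ i0 cs); apply: iterPt_le => s'; exact: G_close.
have sg_le n' : \sum_(l <- iota 0 n') gl l <= g * W + e / (2 * q * (C1 + 1)).
  apply: (@le_trans _ _ (\sum_(l <- iota 0 (L + n')) gl l)).
    by rewrite addnC iotaD big_cat /= lerDl sumr_ge0.
  rewrite iotaD big_cat /=; apply: lerD; last by apply: le_trans (hL n'); exact: ler_sum.
  by rewrite mulr_sumr; apply: ler_sum => l _; rewrite mulrC.
have rec l : f l.+1 <= la * f l + C1 * gl l.
  rewrite /f mulSn addnC iterD -[C1 * _]mul1r.
  apply: (@le_trans _ _ (iter (l * K) Pt (fun s => la * F0 s + (C1 * G s + 0)) s)).
    by apply: iterPt_le => s' /close_cvld/(_ cs)/F0_block; rewrite addr0.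
  rewrite iterPt_lin; have := iterPt_lin (l * K) C1 G (fun=> 0) s.
  by rewrite iterPt_cst// addr0 mul1r => ->.
have sf n' : \sum_(l <- iota 0 n') f l <= (F0 s + C1 * (g * W + e / (2 * q * (C1 + 1)))) / (1 - la).
  rewrite ler_pdivlMr ?subr_gt0//.
  have h1 : \sum_(l <- iota 0 n') f l <= \sum_(l <- iota 0 n'.+1) f l.
    by rewrite sum_iotaS lerDl.
  have h2 : \sum_(l <- iota 0 n'.+1) f l <= F0 s + (la * (\sum_(l <- iota 0 n') f l) + C1 * \sum_(l <- iota 0 n') gl l).
    rewrite /= big_cons; apply: lerD => //; rewrite (iotaDl 1 0) big_map !mulr_sumr -big_split/=.
    by apply: ler_sum.
  have h3 := ler_wpM2l C10 (sg_le n'); lra.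
have F0s : F0 s <= M%:R `^ b * g.
  by apply: ler_pM; rewrite ?powR_ge0 ?G_ge0//; apply: (ge0_ler_powR b_ge0); rewrite ?nnegrE ?ler_nat.
have step1 : \sum_(t <- iota 0 n) iter t Pt F0 s <= K%:R * r2 * \sum_(l <- iota 0 n) f l.
  apply: (@le_trans _ _ (\sum_(t <- iota 0 (n * K)) iter t Pt F0 s)).
    have nK : (n <= n * K)%N by rewrite leq_pmulr.
    rewrite -(subnK nK) addnC iotaD big_cat /= lerDl; apply: sumr_ge0 => t _.
    by apply: iterPt_ge0 => s'; exact: F0_ge0.
  elim: n => [|n IH]; first by rewrite !big_nil mulr0.
  rewrite sum_iotaS mulSnr iotaD big_cat /= add0n mulrDr; apply: lerD => //.
  apply: (@le_trans _ _ (\sum_(t <- iota (n * K) K) r2 * f n)); last first.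
    by rewrite big_const_seq count_predT size_iota iter_addr_0 -[_ * f n *+ _]mulr_natl mulrA.
  rewrite big_seq [leRHS]big_seq; apply: ler_sum => t; rewrite mem_iota => /andP[t1 t2].
  rewrite -(subnKC t1) iterD -[leRHS]addr0.
  have := iterPt_lin (n * K) r2 F0 (fun=> 0) s; rewrite iterPt_cst// => <-.
  apply: iterPt_le => s' /close_cvld/(_ cs) cs'; rewrite addr0.
  rewrite -[leRHS](iterPt_cst (t - n * K) _ i0 cs'); apply: iterPt_le => s'' cl.
  apply: F0_close; apply: close_le cl.
  by rewrite leq_mul2r; apply/orP; right; rewrite leq_subLR ltnW.
apply: le_trans step1 _.
apply: (@le_trans _ _ (q * (F0 s + C1 * (g * W + e / (2 * q * (C1 + 1)))))).
  rewrite -{1}qE [leRHS]mulrAC -[leRHS]mulrA; apply: ler_wpM2l; last exact: sf.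
  by apply: mulr_ge0 => //; exact: ltW.
apply: (@le_trans _ _ (q * (g * (M%:R `^ b + C1 * W + 1) + (C1 + 1) * (e / (2 * q * (C1 + 1)))))).
  by rewrite ler_pM2l//; have := ltW e'0; nra.
rewrite le_eqVlt; apply/orP; left; apply/eqP; rewrite /g; field.
by rewrite !gt_eqF.
Qed.

(** * Comparison of the chain with independent clusters *)

Hypothesis m_gt0 : (0 < m)%N.
Hypothesis beta_gt0 : 0 < beta.
Hypothesis b_beta : b <= beta.
Hypothesis d_gt0 : (0 < d)%N.
Hypothesis D0_ge : (2 * m + 2 <= D0)%N.

Local Notation upd := (cat_update m).
Local Notation Ex := (Ex beta m).

Definition others (i : nat) s : config d := (\bigcup_(j <- iota 0 k | j != i) s j)%fset.
Definition cup s : config d := (\bigcup_(j <- iota 0 k) s j)%fset.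

Lemma cupP s x : reflect (exists2 i, (i < k)%N & x \in s i) (x \in cup s).
Proof.
rewrite /cup; apply: (iffP (bigfcupP _ _ _ _)) => [[i /andP[]]|[i ik xi]].
  by rewrite mem_iota => ik _ xi; exists i.
by exists i => //; rewrite mem_iota ik.
Qed.

Lemma othersP i s x : reflect (exists j, [/\ (j < k)%N, j != i & x \in s j]) (x \in others i s).
Proof.
rewrite /others; apply: (iffP (bigfcupP _ _ _ _)) => [[j /andP[]]|[j [jk ji xj]]].
  by rewrite mem_iota => jk ji xj; exists j.
by exists j => //; rewrite mem_iota jk.
Qed.

Lemma cup_upd1 s i B : (i < k)%N -> cup (upd1 s i B) = (B `|` others i s)%fset.
Proof.
move=> ik; apply/fsetP => x; rewrite inE; apply/cupP/orP => [[j jk]|].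
  have [->|ji] := eqVneq j i; first by rewrite upd1_id; left.
  by rewrite upd1_ne// => xj; right; apply/othersP; exists j.
move=> [xB|/othersP[j [jk ji xj]]]; first by exists i; rewrite ?upd1_id.
by exists j; rewrite ?upd1_ne.
Qed.

Lemma cupE s i : (i < k)%N -> cup s = (s i `|` others i s)%fset.
Proof.
move=> ik; rewrite -(cup_upd1 _ _ ik); congr cup.
by apply/funext => j; rewrite /upd1; case: eqP => [->|].
Qed.

Lemma sum_cup s (f : lattice d -> R) : (forall i j, (i < k)%N -> (j < k)%N -> j != i ->
    forall x, x \in s i -> x \notin s j) ->
  \sum_(x <- cup s) f x = \sum_(i < k) \sum_(x <- s i) f x.
Proof.
move=> dis; rewrite /cup -(big_mkord xpredT (fun i => \sum_(x <- s i) f x)) /index_iota subn0.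
suff H r : uniq r -> {subset r <= iota 0 k} ->
    \sum_(x <- (\bigcup_(j <- r) s j)%fset) f x = \sum_(i <- r) \sum_(x <- s i) f x.
  exact/H/(fun x => id)/iota_uniq.
elim: r => [|i r IH] /=; first by rewrite !big_nil.
move=> /andP[ir ur] sub; rewrite !big_cons -IH//; last by move=> j jr; rewrite sub// inE jr orbT.
set B := (\bigcup_(j <- r) s j)%fset.
rewrite (bigID (mem (s i)))/= sum_fsubset ?fsubsetUl//; congr (_ + _).
rewrite -big_filter; apply: perm_big; apply: uniq_perm => [||x].
- exact/filter_uniq/fset_uniq.
- exact: fset_uniq.
rewrite mem_filter inE; have [xi /=|_ //] := boolP (x \in s i).
apply/esym/negP => /bigfcupP[j /andP[jr _] xj].
have : x \notin s j.
  have := sub i; have := sub j; rewrite !inE jr eqxx orbT !mem_iota !add0n => /(_ isT) jk /(_ isT) ik.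
  by apply: dis xi => //; apply: contraNneq ir => <-.
by rewrite xj.
Qed.

Lemma U_first A (h : config d -> R) : U h A = \sum_(x <- A) #|` A|%:R^-1 * Ex A (2 * m).-1 [:: x] (fun t => h (upd A t)).
Proof.
rewrite /U; have -> : (2 * m)%N = (2 * m).-1.+1 by rewrite prednK// muln_gt0.
rewrite /=; have -> : chs R m A [::] = A by apply/fsetP => x; rewrite in_chs_lt// andbT.
rewrite big_seq [RHS]big_seq; apply: eq_bigr => x xA; congr (_ * _).
rewrite prbE in_chs_lt// xA/=; have -> : chs R m A [::] = A by apply/fsetP => z; rewrite in_chs_lt// andbT.
by rewrite big_const_seq count_predT iter_addr_0 mul1r.
Qed.

Lemma bernoulli (x : R) j : 0 <= x -> x <= 1 -> 1 - j%:R * x <= (1 - x) ^+ j.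
Proof.
move=> x0 x1; elim: j => [|j IH]; first by rewrite mul0r subr0.
have y0 : 0 <= 1 - x by rewrite subr_ge0.
have j0 : 0 <= j%:R * x * x :> R by rewrite !mulr_ge0.
rewrite exprS; have := ler_wpM2l y0 IH; rewrite -natr1; lra.
Qed.

(** There are 2m choices, each with error [eta]. The factor 4d instead of 2d comes from replacing
    the distance L by L + D0, which is at most 2L. *)
Definition cmpC : R := (2 * m)%:R * ((3 ^ d * total)%:R * (4 * d)%:R `^ b).

Lemma nearest_pair s : (1 < k)%N -> cvld s -> exists2 x, x \in diffs s &
  forall y, y \in diffs s -> (nm x <= nm y)%N.
Proof.
move=> k1 cs; have [y ys] : exists y, y \in diffs s.
  have ne i : (i < k)%N -> exists x, x \in s i.
    move=> ik; apply/fset0Pn; rewrite -cardfs_gt0 cs// (leq_ltn_trans _ (sz_gt ik))//.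
  have [u u0] := ne 0%N k_gt0; have [v v1] := ne 1%N k1.
  by exists (u - v); apply/diffsP; exists 0%N, 1%N, u, v.
have ex : exists v, has (fun x => nm x == v) (diffs s) by exists (nm y); apply/hasP; exists y.
case: (ex_minnP ex) => v /hasP[x xs /eqP xv] vmin; exists x => // z zs.
by rewrite xv vmin//; apply/hasP; exists z.
Qed.

(** The uniform first point selects cluster i with the same probability as in [Pt]. The remaining
    2m-1 choices are compared by [Ex_cmp], and Bernoulli's inequality makes the total error
    linear. *)
Lemma U_ge_Pt s (h : config d -> R) : (1 < k)%N -> cvld s -> (forall A, 0 <= h A) -> cmpC * F0 s <= 1 ->
  (1 - cmpC * F0 s) * Pt (fun s => h (cup s)) s <= U h (cup s).
Proof.
move=> k1 cs h0 F1; have [x xs xmin] := nearest_pair k1 cs.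
set D := spreadD s; pose L := nm x.
have t1 : (1 <= total)%N := total_gt0.
have F00 := F0_ge0 s.
have F4 : (4 * d)%:R `^ b * F0 s <= 1.
  apply: le_trans F1; rewrite ler_wpM2r// /cmpC mulrA ler_peMl ?powR_ge0//.
  by rewrite -natrM ler1n !muln_gt0 m_gt0 expn_gt0.
have gF : D%:R `^ b * gk x <= F0 s by rewrite /F0 ler_wpM2l ?powR_ge0// G_ge.
have D_gt0 : (0 < D)%N := spreadD_gt0 s.
have D0D : (D0 <= D)%N by rewrite leq_addr.
have LD0 : 0 < (L + D0)%:R :> R by rewrite ltr0n addn_gt0 D0_gt0 orbT.
have dD0 : (0 < d * D)%N by rewrite muln_gt0 d_gt0.
have powE : (4 * d)%:R `^ b * (D%:R `^ b * gk x) = ((4 * d * D)%:R / (L + D0)%:R) `^ b.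
  rewrite /gk /gker powRN mulrA -powRM// -natrM.
  by apply/esym/(canRL (mulfK _)); rewrite ?gt_eqF ?powR_gt0// -powRM ?divr_ge0// divfK ?gt_eqF.
have rF : ((4 * d * D)%:R / (L + D0)%:R) `^ b <= (4 * d)%:R `^ b * F0 s.
  by rewrite -powE ler_wpM2l ?powR_ge0.
have b_gt0 : 0 < b by case/andP: b23 => b2 _; apply: lt_trans b2.
(* Smallness of [F0] already forces the separation that the comparison requires: otherwise the error
   bound in [rF] would exceed 1. *)
have L4 : (4 * d * D <= L + D0)%N.
  rewrite leqNgt; apply/negP => lt; have := le_trans rF F4; apply/negP; rewrite -ltNge.
  apply: (@le_lt_trans _ _ (1 `^ b)); first by rewrite powR1.
  apply: gt0_ltr_powR => //; rewrite ?nnegrE ?divr_ge0//.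
  by rewrite ltr_pdivlMr// mul1r ltr_nat.
have L2 : (2 * d * D <= L)%N.
  rewrite -(leq_add2r D0); apply: leq_trans L4.
  rewrite -!mulnA (mulnDl 2%N 2%N) leq_add2l (leq_trans D0D)//.
  by rewrite mulnA leq_pmull// muln_gt0 d_gt0.
have D0L : (D0 <= L)%N.
  apply: leq_trans D0D (leq_trans _ L2); by rewrite leq_pmull// muln_gt0.
have L_gt0 : (0 < L)%N by apply: leq_trans D0L.
pose et : R := (3 ^ d * total)%:R * ((4 * d)%:R `^ b * F0 s).
have et0 : 0 <= et by apply: mulr_ge0 => //; apply: mulr_ge0 => //; exact: powR_ge0.
have etC : (2 * m)%:R * et = cmpC * F0 s by rewrite /et /cmpC !mulrA.
have et1 : et <= 1.
  by rewrite (le_trans _ F1)// -etC ler_peMl// ler1n muln_gt0.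
have far i : (i < k)%N -> forall y z, y \in s i -> z \in others i s -> (L <= nm (y - z)%R)%N.
  move=> ik y z yi /othersP[j [jk ji zj]]; apply: xmin; apply/diffsP.
  by exists i, j, y, z.
have dis i j : (i < k)%N -> (j < k)%N -> j != i -> forall z, z \in s i -> z \notin s j.
  move=> ik jk ji z zi; apply/negP => zj.
  have zo : z \in others i s by apply/othersP; exists j.
  by have := far i ik z z zi zo; rewrite subrr nm0 leqNgt L_gt0.
have cardC : #|` cup s| = total.
  apply/eqP; rewrite -(eqr_nat R); have := sum_cup (fun=> 1) dis.
  rewrite big_const_seq count_predT iter_addr_0 => ->; rewrite natr_sum; apply/eqP; apply: eq_bigr => i _.
  by rewrite big_const_seq count_predT iter_addr_0 cs.
apply: (@le_trans _ _ ((1 - et) ^+ (2 * m).-1 * Pt (fun s => h (cup s)) s)).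
  apply: ler_wpM2r; first by apply: sumr_ge0 => i _; rewrite mulr_ge0 ?prob_ge0 ?U_ge0.
  apply: le_trans (bernoulli (2 * m).-1 et0 et1); rewrite lerD2l lerN2 -etC.
  by rewrite ler_wpM2r// ler_nat leq_pred.
rewrite U_first -big_distrr/= cardC sum_cup// !mulr_sumr; apply: ler_sum => i _.
have ik := ltn_ord i.
rewrite U_first cs// -big_distrr/=.
have si0 : (sz i)%:R != 0 :> R by rewrite pnatr_eq0 -lt0n (leq_ltn_trans _ (sz_gt ik)).
set S := \sum_(x0 <- s i) _.
have -> : (1 - et) ^+ (2 * m).-1 * ((sz i)%:R / total%:R * ((sz i)%:R^-1 * S)) = total%:R^-1 * ((1 - et) ^+ (2 * m).-1 * S).
  by rewrite [RHS]mulrCA; congr (_ * _); rewrite [LHS]mulrA [_ / _ / _]mulrAC divff// mul1r.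
rewrite ler_wpM2l ?invr_ge0// mulr_sumr big_seq [leRHS]big_seq; apply: ler_sum => y yi.
have mA : (m < #|` s i|)%N by rewrite cs ?sz_gt.
have dA : diam_le (\max_(i < k) diam (s i)) (s i).
  by move=> u v us vs; apply: leq_trans (diam_ub us vs) _; exact: (leq_bigmax i).
have D1D : (\max_(i < k) diam (s i) + (2 * m + 2) <= D)%N by rewrite addnC leq_add2r.
have vy : cvalid R m (s i) [:: y].
  by apply/(cvalid_rcons R m _ [::]); split; [exact: cpath_nil|rewrite in_chs_lt// yi].
have Ci := cupE s ik.
have upE t : cvalid R m (s i) t -> upd (cup s) t = cup (upd1 s i (upd (s i) t)).
  move=> vt; rewrite cup_upd1// Ci.
  exact: (upd_cup mA D1D (far i ik) L2 d_gt0 beta_gt0 b_beta vt).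
have etale : eta b (s i) (others i s) D L <= et.
  rewrite /eta -Ci cardC /et ler_wpM2l//; apply: le_trans rF.
  apply: (ge0_ler_powR (ltW b_gt0)); rewrite ?nnegrE ?divr_ge0//.
  rewrite ler_pdivrMr ?ltr0n// mulrAC ler_pdivlMr// -!natrM ler_nat.
  have -> : (4 * d * D = 2 * d * D * 2)%N by rewrite [RHS]mulnC !mulnA.
  by rewrite -(mulnA _ 2%N L) leq_mul2l; apply/orP; right; rewrite mul2n -addnn leq_add2l.
have -> : Ex (s i) (2 * m).-1 [:: y] (fun t => h (cup (upd1 s i (upd (s i) t)))) =
    Ex (s i) (2 * m).-1 [:: y] (fun t => h (upd (cup s) t)).
  by apply/eqP; rewrite eq_le; apply/andP; split; apply: Ex_le => // t vt _; rewrite upE.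
have := @Ex_cmp R beta b d m (s i) (others i s) _ D L mA dA D1D (far i ik) L2 d_gt0 beta_gt0 b_beta
  (2 * m).-1 [:: y] (fun t => h (upd (cup s) t)).
rewrite -Ci => /(_ (le_trans etale et1) isT vy _ (fun=> h0 _)) cmp.
apply: le_trans (cmp _).
  by apply: ler_wpM2r; [exact: Ex_ge0|apply: lerXn2r; rewrite ?nnegrE ?subr_ge0 ?(le_trans etale) ?lerD2l ?lerN2].
by rewrite /= add1n prednK// muln_gt0.
Qed.

Local Notation surv := (surv beta m).

(** Induction on T with (1 - F)(1 - S) >= 1 - F - S: each step loses at most F = CF * F0. Reaching H
    needs no separate treatment, since there F is at least 1 and the bound is trivial. *)
Lemma surv_sum (H : set (config d)) (CF : R) T t s : (1 < k)%N -> cvld s -> 0 <= CF -> cmpC <= CF ->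
  (forall s, cvld s -> H (cup s) -> 1 <= CF * F0 s) ->
  1 - \sum_(l <- iota 0 T.+1) iter l Pt (fun s => CF * F0 s) s <=
    if cup s \in ~` H then surv (fun=> ~` H) T t (cup s) else 0.
Proof.
move=> k1 cs CF0 cCF hit; pose F s := CF * F0 s.
have F_ge0 s' : 0 <= F s' by rewrite mulr_ge0 ?F0_ge0.
have sum_ge0 n s' : 0 <= \sum_(l <- iota 0 n) iter l Pt F s'.
  by apply: sumr_ge0 => l _; exact: iterPt_ge0.
elim: T t s cs => [|T IH] t s cs.
  rewrite big_seq1/=; case: ifPn => [_|]; first by rewrite lerBlDr lerDl F_ge0.
  by rewrite in_setC negbK inE => /(hit _ cs); rewrite subr_le0.
have -> : \sum_(l <- iota 0 T.+2) iter l Pt F s =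
    F s + \sum_(l <- iota 0 T.+1) iter l.+1 Pt F s.
  by rewrite -[T.+2]/(1 + T.+1)%N iotaD big_cat big_seq1 (iotaDl 1 0) big_map.
have S0 : 0 <= \sum_(l <- iota 0 T.+1) iter l.+1 Pt F s.
  by apply: sumr_ge0 => l _; exact: iterPt_ge0.
case: ifPn => [sH|]; last first.
  rewrite in_setC negbK inE => /(hit _ cs) F1; rewrite subr_le0.
  by rewrite (le_trans F1)// lerDl.
have [F1|F1] := ltrP 1 (F s).
  apply: (@le_trans _ _ 0); last exact: surv_ge0.
  by rewrite subr_le0 (le_trans (ltW F1))// lerDl.
rewrite [surv _ _ _ _]/=.
pose a (A : config d) : R := if A \in ~` H then surv (fun=> ~` H) T t.+1 A else 0.
have a0 A : 0 <= a A by rewrite /a; case: ifP => // _; exact: surv_ge0.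
have cF : cmpC * F0 s <= F s by rewrite ler_wpM2r ?F0_ge0.
apply: le_trans (U_ge_Pt k1 cs a0 (le_trans cF F1)).
have P0 : 0 <= Pt (fun s => a (cup s)) s.
  by apply: sumr_ge0 => i _; rewrite mulr_ge0 ?prob_ge0 ?U_ge0.
apply: (@le_trans _ _ ((1 - F s) * Pt (fun s => a (cup s)) s)); last first.
  by rewrite ler_wpM2r// lerD2l lerN2.
set S := \sum_(l <- _) _ in S0 *.
have PS : 1 - S <= Pt (fun s => a (cup s)) s.
  apply: (@le_trans _ _ (Pt (fun s => 1 - \sum_(l <- iota 0 T.+1) iter l Pt F s) s)).
    have := iterPt_lin 1 (-1) (fun s => \sum_(l <- iota 0 T.+1) iter l Pt F s) (fun=> 1) s.
    rewrite iterPt_cst// (iterPt_sum 1) mulN1r addrC /= => <-.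
    by apply: Pt_le => i A _ _; rewrite mulN1r addrC.
  by apply: Pt_le => i A ik sA; apply: IH; exact: close_cvld (close_step sA) cs.
have F10 : 0 <= 1 - F s by rewrite subr_ge0.
have := ler_wpM2l F10 PS; have : 0 <= F s * S by rewrite mulr_ge0.
lra.
Qed.

(** In a translate of U0, two points of different clusters are within diam U0, so [F0] is bounded
    below: a return is paid for by the same functional as the interaction. *)
Lemma F0_hit U0 s : (1 < k)%N -> cvld s -> hat (cup s) = hat U0 ->
  1 <= (diam U0 + D0)%:R `^ b * F0 s.
Proof.
move=> k1 cs /esym/hat_eqP[z cE].
have ne i : (i < k)%N -> exists x, x \in s i.
  by move=> ik; apply/fset0Pn; rewrite -cardfs_gt0 cs// (leq_ltn_trans _ (sz_gt ik)).
have [u u0] := ne 0%N k_gt0; have [v v1] := ne 1%N k1.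
have inU w i : (i < k)%N -> w \in s i -> w - z \in U0.
  by move=> ik wi; rewrite -mem_translate -cE; apply/cupP; exists i.
have uv : (nm (u - v)%R <= diam U0)%N.
  have := diam_ub (inU u 0%N k_gt0 u0) (inU v 1%N k1 v1).
  by rewrite opprB addrA subrK.
have D1 : 1 <= (spreadD s)%:R `^ b :> R.
  by rewrite -[leLHS](powRr0 (spreadD s)%:R) ler_powR ?b_ge0// ler1n spreadD_gt0.
have gG : gk (u - v) <= F0 s.
  have gG : gk (u - v) <= G s by apply: G_ge; apply/diffsP; exists 0%N, 1%N, u, v.
  by rewrite (le_trans gG)// /F0 ler_peMl ?G_ge0.
apply: (@le_trans _ _ ((diam U0 + D0)%:R `^ b * gk (u - v))); last by rewrite ler_wpM2l ?powR_ge0.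
rewrite /gk /gker powRN ler_pdivlMr ?powR_gt0 ?ltr0n ?addn_gt0 ?D0_gt0 ?orbT// mul1r.
by apply: (ge0_ler_powR b_ge0); rewrite ?nnegrE// ler_nat leq_add2r.
Qed.

Lemma clusters_survive U0 (M0 : nat) : i0 != i1 -> i0 != i2 -> i1 != i2 -> (1 < k)%N ->
  (1 - eps ^+ k) * rho (2 * (K * m)) ^+ 2 < 1 ->
  exists S : nat, forall s, cvld s -> (forall i, (i < k)%N -> diam_le M0 (s i)) ->
    (forall i j, (i < k)%N -> (j < k)%N -> j != i -> forall x y, x \in s i -> y \in s j ->
       (S <= nm (x - y)%R)%N) ->
    let H := [set A | hat A = hat U0] in forall T t,
    2^-1 <= if cup s \in ~` H then surv (fun=> ~` H) T t (cup s) else 0.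
Proof.
move=> i01 i02 i12 k1 la1.
pose CF := cmpC + (diam U0 + D0)%:R `^ b.
have cC0 : 0 <= cmpC by rewrite /cmpC !mulr_ge0 ?powR_ge0.
have CF0 : 0 < CF by rewrite /CF ltr_wpDl// powR_gt0// ltr0n addn_gt0 D0_gt0 orbT.
have e0 : 0 < 2^-1 / CF by rewrite divr_gt0.
have [g g0 hg] := sum_F0 i01 i02 i12 la1 (D0 + M0) e0.
(* Since b is at least 1, a distance of at least S > 1/g makes the power -b at most g. *)
pose S := (Num.truncn g^-1).+1; exists S => s cs dm sep H T t.
have h1 : (spreadD s <= D0 + M0)%N.
  by rewrite leq_add2l; apply/bigmax_leqP => i _; apply: diam_leP; exact: dm.
have h2 : G s <= g.
  apply: G_le => [|x /diffsP[i [j [u [v [ik jk ji us [vs ->]]]]]]]; first exact: ltW.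
  rewrite /gk /gker powRN -[leRHS]invrK lef_pV2 ?posrE ?invr_gt0 ?powR_gt0 ?ltr0n ?addn_gt0 ?D0_gt0 ?orbT//.
  have w1 : (1 <= nm (u - v) + D0)%N by rewrite addn_gt0 D0_gt0 orbT.
  apply: (@le_trans _ _ (nm (u - v) + D0)%:R).
    apply: (@le_trans _ _ S%:R); first by rewrite ltW// truncnS_gt// invr_ge0 ltW.
    by rewrite ler_nat (leq_trans (sep i j ik jk ji u v us vs))// leq_addr.
  rewrite -{1}[X in X <= _]powRr1//; apply: ler_powR; rewrite ?ler1n//.
  by case/andP: b23 => b2 _; apply: le_trans (ltW b2); rewrite ler1n.
apply: le_trans (@surv_sum H CF T t s k1 cs (ltW CF0) _ _).
- have -> : \sum_(l <- iota 0 T.+1) iter l Pt (fun s => CF * F0 s) s =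
      CF * \sum_(l <- iota 0 T.+1) iter l Pt F0 s.
    rewrite mulr_sumr; apply: eq_bigr => l _.
    have := iterPt_lin l CF F0 (fun=> 0) s; rewrite iterPt_cst// addr0 => <-.
    by congr (iter _ _ _ _); apply/funext => s'; rewrite addr0.
  have := hg s cs h1 h2 T.+1; rewrite ler_pdivlMr// mulrC => h; lra.
- by rewrite lerDl powR_ge0.
move=> s' cs' hit; apply: le_trans (F0_hit k1 cs' hit) _.
by rewrite ler_wpM2r ?F0_ge0// lerDr.
Qed.

End Clusters.

(** * Escape of separated clusters *)

Section Transience.
Variables (R : realType) (beta : R) (d m : nat).
Hypothesis m_gt0 : (0 < m)%N.
Hypothesis beta_gt2 : 2 < beta.
Variables (i0 i1 i2 : 'I_d).
Hypotheses (i01 : i0 != i1) (i02 : i0 != i2) (i12 : i1 != i2).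
Local Notation U := (U beta m).
Local Notation surv := (surv beta m).

Lemma beta_pos : 0 < beta.
Proof. exact: lt_trans beta_gt2. Qed.

(** As b < 3, rho^2 is at most (1+u)^6, and this is at most 1 + 63u for u <= 1, where 63 = 2^6 - 1.
    With 63u <= e and e <= 1, the product is at most (1-e)(1+e) < 1. *)
Lemma small_rho (e b : R) (t : nat) : 0 < e -> 0 <= b -> b < 3 ->
  exists D0 : nat, [/\ (0 < D0)%N, (2 * m + 2 <= D0)%N & (1 - e) * rho D0 b t ^+ 2 < 1].
Proof.
move=> e0 b0 b3; pose v : R := Num.min e 1.
have v0 : 0 < v by rewrite lt_min e0 ltr01.
pose D0 := (Num.truncn (63 * t%:R / v) + (2 * m + 2)).+1.
exists D0; split; rewrite ?ltnS ?leqW ?leq_addl//.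
set u : R := t%:R / D0%:R.
have D00 : 0 < D0%:R :> R by rewrite ltr0n.
have u0 : 0 <= u by rewrite divr_ge0.
have uv : 63 * u <= v.
  rewrite /u mulrA ler_pdivrMr// -ler_pdivrMl// mulrC.
  apply: le_trans (ltW (truncnS_gt _)) _; rewrite ler_nat ltnS leq_addr//.
have v1 : v <= 1 by rewrite ge_min lexx orbT.
have ve : v <= e by rewrite ge_min lexx.
have r3 : rho D0 b t <= (1 + u) ^+ 3.
  rewrite /rho -/u -powR_mulrn ?addr_ge0// ler_powR ?lerDl//; exact: ltW.
have r0 : 0 <= rho D0 b t by rewrite powR_ge0.
have r2 : rho D0 b t ^+ 2 <= 1 + 63 * u.
  apply: (@le_trans _ _ (((1 + u) ^+ 3) ^+ 2)).
    by rewrite lerXn2r// nnegrE exprn_ge0// addr_ge0.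
  have u1 : u <= 1 by lra.
  have -> : ((1 + u) ^+ 3) ^+ 2 = 1 + 6 * u + 15 * u ^+ 2 + 20 * u ^+ 3 + 15 * u ^+ 4 + 6 * u ^+ 5 + u ^+ 6 by ring.
  have h j : u ^+ j.+1 <= u by rewrite exprS ler_piMr// exprn_ile1.
  have := (h 1%N, h 2%N, h 3%N, h 4%N, h 5%N) => -[[[[]]]]; lra.
have := exprn_ge0 2 r0; move: (rho D0 b t ^+ 2) r2 => r r2 {}r0.
have [e1|e1] := lerP e 1; last first.
  by apply: le_lt_trans ltr01; rewrite mulr_le0_ge0// subr_le0 ltW.
have e10 : 0 <= 1 - e by rewrite subr_ge0.
have h1 := ler_wpM2l e10 r2.
have h2 : (1 - e) * (63 * u) <= (1 - e) * e by rewrite ler_wpM2l// (le_trans uv).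
have : 0 < e * e by rewrite mulr_gt0.
lra.
Qed.

(** Fixes the constants in the order that avoids circularity: the Doeblin constant and [eps] do not
    involve [D0], which is chosen next, and S comes last. *)
Lemma survive_far (k : nat) (sz : nat -> nat) (U0 : config d) (M0 : nat) : (1 < k)%N ->
  (forall i, (i < k)%N -> (m < sz i <= 2 * m + 1)%N) ->
  exists S : nat, forall s, cvld k sz s -> (forall i, (i < k)%N -> diam_le M0 (s i)) ->
    (forall i j, (i < k)%N -> (j < k)%N -> j != i -> forall x y, x \in s i -> y \in s j ->
       (S <= nm (x - y)%R)%N) ->
    let H := [set A | hat A = hat U0] in forall T t,
    2^-1 <= if cup k s \in ~` H then surv (fun=> ~` H) T t (cup k s) else 0.
Proof.
move=> k1 hsz; have i10 : i1 != i0 by rewrite eq_sym.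
have i20 : i2 != i0 by rewrite eq_sym.
have [c c0 hc] := doeblin beta_pos m_gt0 i10 i20.
have k0 := ltnW k1; have d0 : (0 < d)%N by apply: leq_ltn_trans (ltn_ord i0).
have sz_gt i : (i < k)%N -> (m < sz i)%N by move=> /hsz/andP[].
have sz_le i : (i < k)%N -> (sz i <= 2 * m + 1)%N by move=> /hsz/andP[].
have doeb i C : (i < k)%N -> #|` C| = sz i ->
  exists p, forall r, reach beta m (mixing_time m) c C (line i0 (p + shift3 i0 i1 i2 r) (sz i)).
  move=> ik Csz; have [|| p hp] := hc C; rewrite ?Csz ?sz_gt ?sz_le//.
  by exists p => -[[r0 r1] r2]; rewrite /shift3/= !addrA -Csz; exact: hp.
pose b := Num.min beta (5 / 2).
have b23 : 2 < b < 3 by rewrite /b lt_min beta_gt2 gt_min; apply/andP; split; [|apply/orP; right]; lra.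
have b_beta : b <= beta by rewrite ge_min lexx.
have b0 : 0 <= b by case/andP: b23 => ? _; lra.
have e0 : 0 < eps m k sz c ^+ k by rewrite exprn_gt0// eps_gt0.
have [D0 [D00 D0m la1]] := small_rho (2 * (K m k * m)) e0 b0 (proj2 (andP b23)).
exact: (clusters_survive sz_gt k0 c0 doeb D00 b23 sz_le m_gt0 beta_pos b_beta d0 D0m).
Qed.


(** * Splitting a configuration into distant clusters *)

Local Notation step := (step R m).

Inductive conn (C : config d) : config d -> Prop :=
  | conn_refl : conn C C
  | conn_step D E : step C D -> conn D E -> conn C E.

Lemma conn_trans C D E : conn C D -> conn D E -> conn C E.
Proof. by elim=> // C' D' E' st _ IH /IH; exact: conn_step. Qed.

Lemma conn_grow C (K : config d) y : (K `<=` C)%fset -> (#|` K| + m = #|` C|)%N ->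
  y \in K -> (forall k, (0 < k <= m)%N -> y + dir i0 *+ k \notin K) ->
  conn C (K `|` ray i0 y 1 m)%fset.
Proof.
move=> KC cK yK free; have [s [vs s2m E]] := grow beta_pos KC cK yK free.
by apply: conn_step (conn_refl _); exists s.
Qed.

Lemma ray_split y a j : ray i0 y a j.+1 = (ray i0 y a 1 `|` ray i0 y a.+1 j)%fset.
Proof. by rewrite -[in RHS](addn1 a) rayU add1n. Qed.

Lemma card_fsetU_disj (A B : config d) : (forall x, x \in A -> x \notin B) ->
  #|` (A `|` B)%fset| = (#|` A| + #|` B|)%N.
Proof.
move=> dis; rewrite cardfsU (_ : (A `&` B)%fset = fset0) ?cardfs0 ?subn0//.
by apply/fsetP => x; rewrite !inE; apply/negP => /andP[/dis/negP].
Qed.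

(** A segment of m+1 points advances by m in one step: its front point is kept and the m points
    behind it are regrown in front. *)
Lemma walk X y a W : (forall j, (a <= j <= a + m * W + m)%N -> y + dir i0 *+ j \notin X) ->
  conn (X `|` ray i0 y a m.+1)%fset (X `|` ray i0 y (a + m * W) m.+1)%fset.
Proof.
elim: W a => [|W IH] a free; first by rewrite muln0 addn0; exact: conn_refl.
apply: conn_trans (_ : conn _ (X `|` ray i0 y (a + m) m.+1)%fset) _; last first.
  rewrite mulnS addnA; apply: IH => j /andP[aj jW]; apply: free.
  by rewrite mulnS addnA jW (leq_trans (leq_addr _ _) aj).
have dis b l : (a <= b)%N -> (b + l <= a + m * W.+1 + m.+1)%N -> forall x, x \in X -> x \notin ray i0 y b l.
  move=> ab bl x xX; apply/negP => /rayP[j /andP[bj jl] xE].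
  suff : x \notin X by rewrite xX.
  by rewrite xE free// (leq_trans ab bj)/= -ltnS -addnS (leq_trans jl bl).
have m2 : (a + m + 1 <= a + m * W.+1 + m.+1)%N.
  by rewrite mulnS addn1 -addnS leq_add// leq_addr.
have -> : (X `|` ray i0 y (a + m) m.+1 = (X `|` ray i0 y (a + m) 1) `|` ray i0 (y + dir i0 *+ (a + m)) 1 m)%fset.
  by rewrite rayD ray_split fsetUA addn1.
apply: conn_grow.
- by apply: fsetUS; rewrite -[m.+1]addn1 -rayU fsubsetUr.
- rewrite !card_fsetU_disj ?card_ray; first by rewrite -addnA add1n.
    by apply: dis => //; rewrite leq_add// leq_addr.
  by apply: dis; rewrite ?leq_addr.
- by rewrite inE; apply/orP; right; apply/rayP; exists (a + m)%N; rewrite ?leqnn ?addn1 ?ltnSn.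
move=> j /andP[j0 jm]; rewrite -addrA -mulrnDr inE negb_or free/=; last first.
  rewrite (leq_trans (leq_addr m a) (leq_addr _ _))/= mulnS -!addnA leq_add2l leq_add2l.
  by rewrite (leq_trans jm) ?leq_addl.
apply/negP => /rayP[l /andP[_ la] /dir_inj al].
by move: la; rewrite -al addn1 ltnS -[leqRHS]addn0 leq_add2l leqNgt j0.
Qed.

Definition sep (S : nat) (X Y : config d) := forall x y, x \in X -> y \in Y -> (S <= nm (x - y)%R)%N.

Fixpoint seps S (l : seq (config d)) : Prop :=
  if l is X :: l' then (forall Y, Y \in l' -> sep S X Y) /\ seps S l' else True.

Lemma sep_level S (X Y : config d) (t : int) : (forall x, x \in X -> x 0 i0 <= t) ->
  (forall y, y \in Y -> t + S%:Z <= y 0 i0) -> sep S X Y.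
Proof.
move=> hX hY x y /hX xt /hY yt; rewrite nm_distC; apply: leq_trans (leq_nm _ i0).
by rewrite 2!mxE; move: (x 0 i0) (y 0 i0) xt yt => u v; lia.
Qed.


(* Height needed to walk k rays out of A below an obstacle O, one above the other
   and with gaps S. *)
Fixpoint room (S k : nat) : nat := if k is k'.+1 then (m * (room S k' + S) + m + S).+1 else 0.

Lemma top (A : config d) y0 : y0 \in A -> exists2 y, y \in A & forall x, x \in A -> x 0 i0 <= y 0 i0.
Proof.
move=> y0A; pose f (v : A) : int := (val v) 0 i0.
case: (@Order.TotalTheory.arg_maxP _ _ A [` y0A]%fset predT f isT) => y _ hy.
by exists (val y); [exact: valP|move=> x xA; exact: (hy [` xA]%fset)].
Qed.

Lemma ray_coord y j : (y + dir i0 *+ j) 0 i0 = y 0 i0 + j%:Z.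
Proof. by rewrite mxE dirE eqxx mul1n. Qed.

Lemma fsetU_rot (A B C D : config d) :
  ((A `|` B) `|` (C `|` D) = (B `|` C) `|` (A `|` D))%fset.
Proof. by apply/fsetP => x; rewrite !inE; do !case: (x \in _). Qed.

(** The top point y of A and m points taken from elsewhere in A form a segment, which walks up to
    just below O. The rest of A is peeled in the same way with this segment added to the obstacle,
    so later segments stop below earlier ones. *)
Lemma peel S k (A O : config d) (t : int) :
  (forall x, x \in A -> x 0 i0 <= t) -> (forall x, x \in O -> t + (room S k)%:Z <= x 0 i0) ->
  (m.+1 * k + m < #|` A|)%N ->
  exists (A' : config d) (r : seq (config d)),
    [/\ (A' `<=` A)%fset, (#|` A'| + m.+1 * k = #|` A|)%N, size r = k &
    [/\ forall X, X \in r -> #|` X| = m.+1 /\ diam_le m.+1 X, seps S (A' :: r),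
    forall X x, X \in r -> x \in X -> x 0 i0 + S%:Z <= t + (room S k)%:Z &
    conn (A `|` O)%fset (A' `|` ((\bigcup_(X <- r) X) `|` O))%fset]].
Proof.
elim: k A O t => [|k IH] A O t At Ot Ak.
  exists A, [::]; rewrite muln0 addn0; split => //; split => //.
  by rewrite big_nil fset0U; exact: conn_refl.
have [y0 y0A] : exists y, y \in A by apply/fset0Pn; rewrite -cardfs_gt0 (leq_ltn_trans _ Ak).
have [y yA ytop] := top y0A.
have Am : (m < #|` A|)%N by rewrite (leq_ltn_trans _ Ak)// leq_addl.
have [K [KA cK yK]] := subset_containing yA Am.
set A1 := (K `\ y)%fset.
have KE : K = (y |` A1)%fset by rewrite fsetD1K.
have yt : y 0 i0 <= t by exact: At.
have A1K : (A1 `<=` K)%fset := fsubsetDl _ _.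
have A1A : (A1 `<=` A)%fset := fsubset_trans A1K KA.
have yA1 : y \notin A1 by rewrite !inE eqxx.
have A1top x : x \in A1 -> x 0 i0 <= y 0 i0 by move=> /(fsubsetP A1A); exact: ytop.
have cA1 : (#|` A1| + m.+1 = #|` A|)%N by rewrite -cK KE cardfsU1 yA1 add1n addSn addnS.
(* The segment advances by m W, at least W: this leaves the room for the remaining k segments and a
   further gap S. *)
pose W := (room S k + S)%N.
have rE : room S k.+1 = (m * W + m + S).+1 by [].
have freeA j : (0 < j)%N -> y + dir i0 *+ j \notin A.
  move=> j0; apply/negP => /ytop; rewrite ray_coord.
  by move: (y 0 i0) => v; clear -j0; lia.
have freeO j : (j <= m * W + m)%N -> y + dir i0 *+ j \notin O.
  move=> jW; apply/negP => /Ot; rewrite ray_coord rE.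
  by move: (y 0 i0) yt (m * W)%N jW => v vt q jq; clear -vt jq; lia.
pose Y := ray i0 y (0 + m * W) m.+1.
have Yc x : x \in Y -> exists2 j, (m * W <= j < m * W + m.+1)%N & x 0 i0 = y 0 i0 + j%:Z.
  by move=> /rayP[j jW ->]; exists j => //; exact: ray_coord.
have W1 : (W <= m * W)%N by rewrite leq_pmull.
have c1 : conn (A `|` O)%fset (A1 `|` (O `|` Y))%fset.
  have dAO x : x \in A -> x \notin O.
    move=> /At xt; apply/negP => /Ot; rewrite rE.
    by move: (x 0 i0) xt (m * W)%N => v vt q; clear -vt; lia.
  have r1 : ray i0 y 0 1 = [fset y]%fset.
    apply/fsetP => x; rewrite inE; apply/rayP/eqP => [[[|j]//]|->]; first by rewrite mulr0n addr0.
    by exists 0%N; rewrite ?mulr0n ?addr0.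
  have E : ((K `|` O) `|` ray i0 y 1 m = (A1 `|` O) `|` ray i0 y 0 m.+1)%fset.
    by rewrite ray_split r1 KE -[in LHS]fsetUA fsetU_rot.
  apply: (conn_trans (D := ((K `|` O) `|` ray i0 y 1 m)%fset)).
    apply: conn_grow.
    - exact: fsetSU.
    - rewrite !card_fsetU_disj => [|x xA|x /(fsubsetP KA)]; [|exact: dAO|exact: dAO].
      by rewrite addnAC cK.
    - by rewrite inE yK.
    move=> j /andP[j0 jm]; rewrite inE negb_or freeO ?andbT; last by rewrite (leq_trans jm) ?leq_addl.
    by apply: contra (freeA j j0); exact: (fsubsetP KA).
  rewrite E fsetUA; apply: walk => j; rewrite add0n => /andP[_ jW].
  rewrite inE negb_or freeO// andbT; case: (posnP j) => [->|j0]; first by rewrite mulr0n addr0.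
  by apply: contra (freeA j j0); exact: (fsubsetP A1A).
have A1k : (m.+1 * k + m < #|` A1|)%N by rewrite -(ltn_add2r m.+1) cA1 addnAC -mulnSr.
have sepY (X : config d) : (forall x, x \in X -> x 0 i0 + S%:Z <= y 0 i0 + (m * W)%N%:Z) -> sep S X Y.
  move=> hX; apply: (@sep_level _ _ _ (y 0 i0 + (m * W)%N%:Z - S%:Z)) => [x /hX|x /Yc[j /andP[jW _] ->]].
    by rewrite lerBrDr.
  by rewrite subrK lerD2l lez_nat.
have [x|x|A' [r [A'A1 cA' sr [hr sepr rt c2]]]] := IH A1 (O `|` Y)%fset (y 0 i0) _ _ A1k.
- exact: A1top.
- rewrite inE => /orP[/Ot|/Yc[j /andP[jW _] ->]].
    apply: le_trans; rewrite lerD// lez_nat rE ltnW// ltnS.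
    by rewrite (leq_trans (leq_addr S _))// (leq_trans W1)// -addnA leq_addr.
  by rewrite lerD2l lez_nat (leq_trans _ jW)// (leq_trans _ W1)// leq_addr.
exists A', (Y :: r); split => //.
- exact: fsubset_trans A'A1 A1A.
- by rewrite -cA1 -cA' mulnSr addnA.
- by rewrite /= sr.
have [sepA sepr'] := sepr.
have mW0 : (S <= m * W)%N by rewrite (leq_trans _ W1)// leq_addl.
split.
- move=> X; rewrite inE => /predU1P[->|]; last exact: hr.
  by split; [exact: card_ray|exact: diam_ray].
- split=> [X|].
    rewrite inE => /predU1P[->|]; last exact: sepA.
    by apply: sepY => x /(fsubsetP A'A1)/A1top xy; rewrite lerD// lez_nat.
  split=> // X Xr u v uY vX; rewrite nm_distC; apply: (sepY X) => // x xX.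
  have := rt X x Xr xX => /le_trans; apply; by rewrite lerD2l lez_nat (leq_trans _ W1)// leq_addr.
- move=> X x; rewrite inE => /predU1P[->|Xr xX].
    move=> /Yc[j /andP[_ jW] ->]; rewrite rE; move: jW; rewrite addnS ltnS => jW.
    by move: (y 0 i0) yt (m * W)%N jW => v vt q jq; clear -vt jq; lia.
  have := rt X x Xr xX => /le_trans; apply; rewrite lerD// lez_nat rE ltnW// ltnS.
  by rewrite (leq_trans (leq_addr S _))// (leq_trans W1)// -addnA leq_addr.
apply: conn_trans c1 _; rewrite big_cons.
have -> : ((Y `|` \bigcup_(X <- r) X) `|` O = (\bigcup_(X <- r) X) `|` (O `|` Y))%fset.
  by rewrite -fsetUA fsetUC -fsetUA.
exact: c2.
Qed.

(** Here the constant may depend on C, since only one finite path from U0 is followed. *)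
Lemma step_reach (C D : config d) : (m < #|` C|)%N -> step C D -> exists2 c : R, 0 < c & reach beta m 1 c C D.
Proof.
move=> mC [s vs [s2m ->]]; have [c c0 hc] := reach_bounded d m beta_pos #|` C| (diam C).
by exists c => //; apply: hc => // x y; exact: diam_ub.
Qed.

Section Return.
Variable U0 : config d.
Let H : set (config d) := [set A | hat A = hat U0].

(** A positive chance, uniform in the horizon T, of avoiding the class of U0 at all positive
    times. *)
Definition escapes C := exists2 e : R, 0 < e & forall T t, e <= surv (fun=> ~` H) T t C.

Lemma surv_translate T t C z : surv (fun=> ~` H) T t (translate C z) = surv (fun=> ~` H) T t C.
Proof.
elim: T t C => [//|T IH] t C /=; rewrite U_translate; apply: U_ext => D.
rewrite IH (_ : (translate D z \in ~` H) = (D \in ~` H))//.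
by rewrite !in_setC; congr (~~ _); apply/idP/idP; rewrite !inE /H/= hat_translate.
Qed.

Lemma escapes_step C D : (m < #|` C|)%N -> step C D -> hat D <> hat U0 -> escapes D -> escapes C.
Proof.
move=> mC /(step_reach mC)[c c0 hc] DH [e e0 he]; exists (Num.min 1 (c * e)).
  by rewrite lt_min ltr01 mulr_gt0.
case=> [|T] t /=; first by rewrite ge_min lexx.
rewrite ge_min; apply/orP; right.
pose a D : R := if D \in ~` H then surv (fun=> ~` H) T t.+1 D else 0.
have a0 A : 0 <= a A by rewrite /a; case: ifP => // _; exact: surv_ge0.
apply: le_trans (hc a a0); rewrite ler_wpM2l ?(ltW c0)// /a ifT//.
by rewrite in_setC; apply/negP; rewrite inE.
Qed.

(* A path from U0 may pass through translates of U0; the last such translate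
   still escapes, and so does U0 by translation invariance. *)
Lemma escapes_conn C D : conn C D -> (m < #|` C|)%N -> hat D <> hat U0 -> escapes D ->
  escapes C \/ escapes U0.
Proof.
elim=> [{}C|{}C C' E st _ IH] mC EH Ee; first by left.
have mC' : (m < #|` C'|)%N by rewrite (step_card st).
have [|[e e0 he]|] := IH _ EH Ee => //; last by right.
have [hC|hC] := pselect (hat C' = hat U0); last by left; apply: (escapes_step mC st hC); exists e.
right; exists e => // T t; have [z ->] := proj1 (hat_eqP _ _) hC.
by rewrite surv_translate.
Qed.

Lemma sepsP S (l : seq (config d)) i j : seps S l -> (i < size l)%N -> (j < size l)%N -> j != i ->
  sep S (nth fset0 l i) (nth fset0 l j).
Proof.
elim: l i j => // X l IH [|i] [|j] //= [h1 h2] il jl ji.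
- exact/h1/mem_nth.
- by move=> x y xX yX; rewrite nm_distC; exact: (h1 _ (mem_nth fset0 il) y x yX xX).
exact: IH.
Qed.

Lemma escapes_U0 : (2 * m + 2 <= #|` U0|)%N -> escapes U0.
Proof.
move=> n2m; set n := #|` U0| in n2m.
(* With n = q (m+1) + r, q-1 segments of m+1 points are peeled off and m+1+r points remain, at most
   2m+1. Since n >= 2m+2, q >= 2 and there are at least two clusters. *)
pose q := (n %/ m.+1)%N; pose r := (n %% m.+1)%N; have nE : (n = q * m.+1 + r)%N := divn_eq _ _.
have rm : (r < m.+1)%N by rewrite ltn_mod.
have q2 : (2 <= q)%N by rewrite leq_divRL// mulnS addnC.
pose k := q.-1; have qk : q = k.+1 by rewrite prednK// ltnW.
pose sz i := if i == 0%N then (m.+1 + r)%N else m.+1.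
have hsz i : (i < k.+1)%N -> (m < sz i <= 2 * m + 1)%N.
  rewrite /sz; case: eqP => _ _.
    rewrite addSn ltnS leq_addr/= -addSn mul2n -addnn addn1 -addSn leq_add2l//.
  by rewrite leqnn/= mul2n -addnn addn1 ltnS leq_addr.
have [|S hS] := @survive_far k.+1 sz U0 (diam U0 + m.+1) _ hsz; first by rewrite -qk.
have [x0 x0U] : exists y, y \in U0.
  by apply/fset0Pn; rewrite -cardfs_gt0 (leq_trans _ n2m)// addn2.
have [y yU ytop] := top x0U.
have kn : (m.+1 * k + m < n)%N by rewrite (mulnC m.+1) nE qk (mulSn k) [(m.+1 + _)%N]addnC -addnA ltn_add2l ltn_addr.
have [|A' [l [A'U cA' sl [hl sepl _ cn]]]] := @peel S k U0 fset0 (y 0 i0) ytop _ kn; first by [].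
pose s := nth fset0 (A' :: l).
have cE : (A' `|` ((\bigcup_(X <- l) X) `|` fset0))%fset = cup k.+1 s.
  rewrite fsetU0 /cup /s; have -> : iota 0 k.+1 = iota 0 (size (A' :: l)) by rewrite /= sl.
  by rewrite -(big_map (nth fset0 (A' :: l)) xpredT id) map_nth_iota0// take_size big_cons.
have sz1 i : (0 < i < k.+1)%N -> s i \in l.
  by case: i => // i /= ik; rewrite /s /= mem_nth// sl.
have cs : cvld k.+1 sz s.
  case=> [_|i ik]; last by have [] := hl _ (sz1 i.+1 ik).
  by rewrite /s /sz /=; move: cA'; rewrite -/n (mulnC m.+1) nE qk (mulSn k) addnAC => /addIn.
have dm i : (i < k.+1)%N -> diam_le (diam U0 + m.+1) (s i).
  case: i => [_|i ik] u v us vs.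
    apply: leq_trans (leq_addr _ _); apply: diam_ub; exact: (fsubsetP A'U).
  have [_ dl] := hl _ (sz1 i.+1 ik); apply: leq_trans (dl u v us vs) _; exact: leq_addl.
have sp i j : (i < k.+1)%N -> (j < k.+1)%N -> j != i -> forall u v, u \in s i -> v \in s j ->
    (S <= nm (u - v)%R)%N.
  by move=> ik jk ji; apply: (sepsP sepl); rewrite //= sl.
have H0 := hS s cs dm sp; rewrite -cE in H0; rewrite fsetU0 in cn H0.
set D := (A' `|` _)%fset in cn H0.
(* If D were a translate of U0, the survival bound would read 1/2 <= 0. *)
have DH : hat D <> hat U0.
  have := H0 0%N 0%N; case: ifPn => [|_]; last by rewrite leNgt invr_gt0 ltr0n.
  by rewrite in_setC => /negP DH _ HD; apply: DH; rewrite inE.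
have ED : escapes D.
  exists 2^-1; first by rewrite invr_gt0.
  by move=> T t; have := H0 T t; rewrite ifT// in_setC; apply/negP; rewrite inE.
have [] := escapes_conn cn _ DH ED => //.
by apply: leq_trans n2m; rewrite addn2 mul2n -addnn ltnS (leq_trans (leq_addr _ _) (leqnSn _)).
Qed.

End Return.

(** The event of a return is the increasing union of the events of a return by time T, each of
    probability at most 1 - e. *)
Lemma part_ii (U0 : config d) (disp : measure_display) (Omega : measurableType disp)
    (P : probability Omega R) (X : nat -> Omega -> config d) :
  (2 * m + 2 <= #|` U0|)%N -> markov_chain (cat_kernel beta m) U0 P X ->
  (P [set w | exists2 t, (0 < t)%N & hat (X t w) = hat U0] < 1)%E.
Proof.
move=> n2m MC; have [e e0 he] := escapes_U0 n2m.
pose H : set (config d) := [set A | hat A = hat U0].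
pose E T := [set w | forall i, (0 < i <= T)%N -> (~` H) (X i w)].
have mE T : measurable (E T) := measurable_future MC (fun=> ~` H) 0 T.
have PE T : (P (~` E T) <= (1 - e)%:E)%E.
  by rewrite probability_setC// (prob_surv0 beta_pos MC (fun=> ~` H)) -EFinB lee_fin lerD2l lerN2.
have -> : [set w | exists2 t, (0 < t)%N & hat (X t w) = hat U0] = \bigcup_T ~` E T.
  apply/seteqP; split => [w [t t0 Xt]|w [T _ /=]].
    by exists t => //= /(_ t); rewrite t0 leqnn => /(_ isT).
  move=> /existsNP[i /not_implyP[/andP[i0' _] /contrapT Xi]]; by exists i.
have mF : measurable (\bigcup_T ~` E T) by apply: bigcup_measurable => T _; exact: measurableC.
have nd : nondecreasing_seq (fun T => ~` E T).
  move=> S T ST; apply/subsetPset => w; apply: contra_not => ET i /andP[i1' iS].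
  by apply: ET; rewrite i1' (leq_trans iS).
have cv := nondecreasing_cvg_mu (mu := P) (fun T => measurableC (mE T)) mF nd.
apply: (@le_lt_trans _ _ (1 - e)%:E); last by rewrite lte_fin ltrBlDr ltrDl.
rewrite -(cvg_lim _ cv)//; apply: lime_le; first by apply/cvg_ex; eexists; exact: cv.
by near=> T; exact: PE.
Unshelve. all: by end_near. Qed.

End Transience.

Theorem theorem1p5 (R : realType) (d m n : nat) (beta : R)
    (hd : (3 <= d)%N) (hm : (1 <= m)%N) (hbeta : 2 < beta)
    (hn : (m + 1 <= n)%N) :
  ((n < 2 * m + 2)%N ->
   exists mu : set (config d) -> R,
     [/\ stationary_distribution (classes d n) (hat_kernel beta m) mu,
         forall mu' : set (config d) -> R,
           stationary_distribution (classes d n) (hat_kernel beta m) mu' ->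
           mu' = mu,
         forall c, ~ hat_Prog R d m n c -> mu c = 0
       & forall (C : config d) (disp : measure_display)
           (Omega : measurableType disp) (P : probability Omega R)
           (X : nat -> Omega -> config d),
           #|` C| = n -> markov_chain (cat_kernel beta m) C P X ->
           law_converges (classes d n) P (fun t w => hat (X t w)) mu])
  /\
  ((2 * m + 2 <= n)%N ->
   forall (U : config d) (disp : measure_display)
     (Omega : measurableType disp) (P : probability Omega R)
     (X : nat -> Omega -> config d),
     Prog R d m n U -> markov_chain (cat_kernel beta m) U P X ->
     (P [set w | exists2 t, (0 < t)%N & hat (X t w) = hat U] < 1)%E).
Proof.
(* The dimension enters only through these three distinct coordinate directions. *)
pose i0 := Ordinal (leq_trans (isT : 0 < 3)%N hd).
pose i1 := Ordinal (leq_trans (isT : 1 < 3)%N hd).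
pose i2 := Ordinal (leq_trans (isT : 2 < 3)%N hd).
split=> [n2m|n2m U disp Omega P X [_ Un _]].
  apply: (@part_i R beta d m _ n i0 i1 i2) => //.
  - exact: lt_trans hbeta.
  - by rewrite -addn1.
  - by rewrite addn1 -ltnS -addn2.
by apply: (@part_ii R beta d m hm hbeta i0 i1 i2) => //; rewrite Un.
Qed.
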